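(* Let $\rho>0$. For $1\le p\le\infty$ let $c_p=\rho^2(1-\gamma_p^2)$, and for $c\in\mathbb{R}$ define $T_t^c=e^{-t(\Delta+\rho^2-c)}$, where $\Delta$ is the standard Laplacian on $\mathbb{R}^n$. Then: (1) For $1\le p<\infty$, $p\ne2$, $T_t^c$ is chaotic on $L^p_\rho(\mathbb{R}^n)$ if $c>c_p$. (2) $T_t^c$ is not chaotic on $L^\infty_\rho(\mathbb{R}^n)$ for any $c\in\mathbb{R}$. (3) For $1\le p<\infty$ and $c\le c_p$, $T_t^c$ is not chaotic on $L^p_\rho(\mathbb{R}^n)$, and for $c<c_p$ it is not even hypercyclic.
   Context: All functions are complex-valued. $\Delta=-\sum_{j=1}^n\partial^2/\partial x_j^2$. $\gamma_p=|\frac2p-1|$ (with $\gamma_\infty=1$). For $\nu>0$, $z>0$, $K_\nu(z)=\frac12(\frac z2)^\nu\int_0^\infty e^{-(t+z^2/(4t))}t^{-\nu-1}dt$ is the Macdonald function and $\tilde K_\nu(z)=z^\nu K_\nu(z)$ (extended continuously to $z=0$). For $1\le p<\infty$, $L^p_\rho(\mathbb{R}^n)=L^p(\mathbb{R}^n,(\tilde K_{n/2}(\rho|x|))^{\gamma_pp}\,dx)$; $L^\infty_\rho(\mathbb{R}^n)$ denotes $L^\infty(\mathbb{R}^n)$. The operator $e^{-t(\Delta+\rho^2-c)}$ is given, for $t>0$, by $f\mapsto e^{-t(\rho^2-c)}\int_{\mathbb{R}^n}h_t(x-y)f(y)\,dy$ with $h_t(x)=(4\pi t)^{-n/2}e^{-|x|^2/(4t)}$,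 and by the identity for $t=0$. For a semigroup $T_t$ of bounded operators on a Banach space $\mathcal{B}$: $T_t$ is hypercyclic if there is $v\in\mathcal{B}$ such that $\{T_tv:t\ge0\}$ is dense in $\mathcal{B}$; $v\in\mathcal{B}$ is periodic if $T_tv=v$ for some $t>0$; $T_t$ is chaotic if it is hypercyclic and its periodic points are dense in $\mathcal{B}$. *)

(* Defs.v *)
From HB Require Import structures.
From mathcomp Require Import all_boot all_order all_algebra.
From mathcomp Require Import all_classical all_reals all_analysis.
From mathcomp Require Import ess_sup_inf complex.

Set Implicit Arguments.
Unset Strict Implicit.
Unset Printing Implicit Defensive.

Import Order.TTheory GRing.Theory Num.Theory.
Import numFieldNormedType.Exports.

Local Open Scope classical_set_scope.
Local Open Scope complex_scope.
Local Open Scope ring_scope.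

(* The library equips n-tuples with the product sigma-algebra. *)
Notation euclidean R n := (n.-tuple (measurableTypeR R)).

Section LebesgueMeasure.
Context {R : realType}.
Local Notation E n := (euclidean R n).

Definition cons_euclidean n (z : measurableTypeR R * E n) : E n.+1 :=
  [the n.+1.-tuple _ of z.1 :: z.2].

Definition uncons_euclidean n (x : E n.+1) : measurableTypeR R * E n :=
  (tnth x ord0, [tuple of behead x]).

Lemma measurable_cons_euclidean n : measurable_fun setT (@cons_euclidean n).
Proof. exact: measurable_cons. Qed.

Lemma measurable_uncons_euclidean n : measurable_fun setT (@uncons_euclidean n).
Proof.
apply: measurable_fun_pair; [exact: measurable_tnth|exact: measurable_behead].
Qed.

Lemma uncons_euclideanK n : cancel (@uncons_euclidean n) (@cons_euclidean n).
Proof. by move=> x; rewrite [RHS]tuple_eta; exact/val_inj. Qed.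

Lemma cons_euclideanK n : cancel (@cons_euclidean n) (@uncons_euclidean n).
Proof. by move=> [a x]; congr pair; exact/val_inj. Qed.

Section lebesgue_step.
Variables (n : nat) (m : {sigma_finite_measure set (E n) -> \bar R}).

Definition lebesgue_step : set (E n.+1) -> \bar R :=
  pushforward (@lebesgue_measure R \x m)%E (@cons_euclidean n).

Let lebesgue_step0 : lebesgue_step set0 = 0%E.
Proof. by rewrite /lebesgue_step /pushforward preimage_set0 measure0. Qed.

Let lebesgue_step_ge0 A : (0 <= lebesgue_step A)%E.
Proof. by rewrite /lebesgue_step /pushforward measure_ge0. Qed.

Let lebesgue_step_sigma_additive : semi_sigma_additive lebesgue_step.
Proof.
apply: measure_semi_sigma_additive; exact: measurable_cons_euclidean.
Qed.

HB.instance Definition _ := isMeasure.Build _ _ _ lebesgue_step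
  lebesgue_step0 lebesgue_step_ge0 lebesgue_step_sigma_additive.

Let lebesgue_step_sigma_finite : sigma_finite setT lebesgue_step.
Proof.
have /sigma_finiteP[F [TF ndF Foo]] := sigma_finiteT (@lebesgue_measure R).
have /sigma_finiteP[G [TG ndG Goo]] := sigma_finiteT m.
exists (fun i => @uncons_euclidean n @^-1` (F i `*` G i)).
  rewrite -preimage_bigcup (_ : \bigcup_i _ = setT) ?preimage_setT//.
  rewrite -subTset => -[a x] _.
  have [i _ Fia] : (\bigcup_i F i) a by rewrite -TF.
  have [j _ Gjx] : (\bigcup_i G i) x by rewrite -TG.
  exists (maxn i j) => //; split => /=.
    by move: a Fia; exact/subsetPset/ndF/leq_maxl.
  by move: x Gjx; exact/subsetPset/ndG/leq_maxr.
move=> i; have [mF Fi] := Foo i; have [mG Gi] := Goo i.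
have mFG : measurable (F i `*` G i) by exact: measurableX.
split.
  by rewrite -[X in measurable X]setTI; exact: measurable_uncons_euclidean.
rewrite /lebesgue_step /pushforward -comp_preimage.
rewrite (_ : _ \o _ = id); last first.
  by apply/funext => z /=; rewrite cons_euclideanK.
by rewrite preimage_id product_measure1E// lte_mul_pinfty// ge0_fin_numE.
Qed.

HB.instance Definition _ :=
  Measure_isSigmaFinite.Build _ _ _ lebesgue_step lebesgue_step_sigma_finite.

End lebesgue_step.

(* For n = 0 this is the unit mass on the one-point space; for n.+1 it is the
   product of the one-dimensional Lebesgue measure with the n-dimensional one,
   transported from R * R^n to R^(n+1). See lebesgue_euclidean_box. *)
Fixpoint lebesgue_euclidean n : {sigma_finite_measure set (E n) -> \bar R} :=
  if n is k.+1 then lebesgue_step (lebesgue_euclidean k)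
  else (\d_([tuple] : E 0) : {sigma_finite_measure set (E 0) -> \bar R}).

Lemma lebesgue_euclidean_box n (A : 'I_n -> set (measurableTypeR R)) :
  (forall i, measurable (A i)) ->
  lebesgue_euclidean n [set x | forall i, A i (tnth x i)] =
  (\prod_(i < n) lebesgue_measure (A i))%E.
Proof.
elim: n A => [|n IHn] A mA.
  by rewrite big_ord0 /= diracE mem_set// => -[].
have mB : measurable [set x : E n | forall i, A (lift ord0 i) (tnth x i)].
  rewrite (_ : mkset _ = \big[setI/setT]_(i < n)
      ((fun x : E n => tnth x i) @^-1` A (lift ord0 i))).
    apply: bigsetI_measurable => i _; rewrite -[X in measurable X]setTI.
    exact: measurable_tnth.
  apply/seteqP; split => x /=.
    by move=> Ax; rewrite -bigcap_seq => i _ /=; exact: Ax.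
  by rewrite -bigcap_seq => Ax i; apply: Ax; rewrite /= mem_index_enum.
rewrite big_ord_recl -(IHn (fun i => A (lift ord0 i))) //.
rewrite -product_measure1E//=; congr (product_measure1 _ _ _).
apply/seteqP; split => -[a x] /=.
  move=> Ax; split; first exact: (Ax ord0).
  by move=> i; have := Ax (lift ord0 i); rewrite /cons_euclidean/= tnthS.
move=> [Aa Ax] i; case: (unliftP ord0 i) => [j ->|->//].
by rewrite /cons_euclidean/= tnthS; exact: Ax.
Qed.

End LebesgueMeasure.

Section Functions.
Context {R : realType}.

Definition enorm n (x : euclidean R n) : R :=
  Num.sqrt (\sum_(i < n) (tnth x i : R) ^+ 2).

Definition esub n (x y : euclidean R n) : euclidean R n :=
  [tuple (tnth x i : R) - (tnth y i : R) | i < n].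

Definition macdonald (nu z : R) : R :=
  2^-1 * (z / 2) `^ nu *
  \int[@lebesgue_measure R]_(t in `]0, +oo[)
    (expR (- (t + z ^+ 2 / (4 * t))) * t `^ (- nu - 1)).

(* Only used at z >= 0; the second branch is the continuous extension to 0. *)
Definition macdonald_tilde (nu z : R) : R :=
  if 0 < z then z `^ nu * macdonald nu z
  else lim (w `^ nu * macdonald nu w @[w --> 0^'+]).

Definition gammap (p : \bar R) : R := if p is r%:E then `|2 / r - 1| else 1.

Definition critical (rho : R) (p : \bar R) : R := rho ^+ 2 * (1 - gammap p ^+ 2).

Definition heat_kernel n (t : R) (x : euclidean R n) : R :=
  (4 * pi * t) `^ (- (n%:R / 2)) * expR (- (enorm x ^+ 2) / (4 * t)).

Definition cintegral d (T : measurableType d) (mu : {measure set T -> \bar R})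
    (f : T -> R[i]) : R[i] :=
  (\int[mu]_x complex.Re (f x)) +i* (\int[mu]_x complex.Im (f x)).

Definition cmeasurable d (T : measurableType d) (f : T -> R[i]) : Prop :=
  measurable_fun setT (fun x => complex.Re (f x)) /\
  measurable_fun setT (fun x => complex.Im (f x)).

(* exp (-t (Delta + rho^2 - c)), with Delta the nonnegative Laplacian *)
Definition heat_semigroup n (rho c t : R) (f : euclidean R n -> R[i]) :
    euclidean R n -> R[i] :=
  if t == 0 then f else fun x =>
    (expR (- (t * (rho ^+ 2 - c))))%:C *
    cintegral (lebesgue_euclidean n)
      (fun y => (heat_kernel t (esub x y))%:C * f y).

Definition Lrho_norm n (rho : R) (p : \bar R) (f : euclidean R n -> R[i]) :
    \bar R :=
  if p is r%:E then
    ((\int[lebesgue_euclidean n]_x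
        (Normc.normc (f x) `^ r *
         macdonald_tilde (n%:R / 2) (rho * enorm x) `^ (gammap p * r))%:E)
      `^ r^-1)%E
  else ess_sup (lebesgue_euclidean n) (fun x => (Normc.normc (f x))%:E).

(* The functions representing the elements of L^p_rho: two of them represent
   the same element when their difference has norm 0, i.e. almost everywhere. *)
Definition Lrho n (rho : R) (p : \bar R) : set (euclidean R n -> R[i]) :=
  [set f | cmeasurable f /\ (Lrho_norm rho p f < +oo)%E].

End Functions.

Arguments Lrho {R} n rho p.

(* The Banach space is given by a set B of functions with a seminorm N: its
   elements are the members of B, where u and v are the same element when
   N (u \- v) = 0. *)
Section Dynamics.
Context {R : realType} {X : Type}.
Local Notation V := (X -> R[i]).
Variables (B : set V) (N : V -> \bar R) (T : R -> V -> V).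

Definition ndense (D : set V) : Prop :=
  forall g, B g -> forall e : R, 0 < e ->
    exists u, [/\ B u, D u & (N (u \- g)%R < e%:E)%E].

Definition hypercyclic : Prop :=
  exists2 v, B v & ndense [set T t v | t in [set t | 0 <= t]].

Definition periodic (v : V) : Prop :=
  B v /\ exists2 t, 0 < t & N (T t v \- v) = 0%E.

Definition chaotic : Prop := hypercyclic /\ ndense periodic.

End Dynamics.

(* Main.v *)
Require Import Defs.
From mathcomp Require Import all_boot all_order all_algebra.
From mathcomp Require Import all_classical all_reals all_analysis.
From mathcomp Require Import measurable_realfun ess_sup_inf complex ring lra.
Set Implicit Arguments.
Unset Strict Implicit.
Unset Printing Implicit Defensive.
Import Order.TTheory GRing.Theory Num.Theory.
Import numFieldNormedType.Exports.
Local Open Scope classical_set_scope.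
Local Open Scope complex_scope.
Local Open Scope ring_scope.

(** Why the theorem is true.

An exponential ee z : x |-> exp (z_1 x_1 + ... + z_n x_n) with complex z is an
eigenfunction of the heat semigroup (heat_semigroup_ee):
T_t (ee z) = exp (t (c - rho^2 + z_1^2 + ... + z_n^2)) ee z.  Write
sigma = gamma_p rho.  The weight of L^p_rho behaves like exp (- sigma p |x|) up
to a power of 1 + |x| (macdonald_tilde_le, macdonald_tilde_ge), so that an
exponential belongs to the space when its exponent has a real part of length
less than sigma.  Since c_p = rho^2 - sigma^2, the condition c > c_p says that
the eigenvalues of these exponentials can have moduli below, at and above one.

Chaos for c > c_p.  There is b with (rho^2 - c) / n < b^2 < sigma^2 / n.  The
function Phi b : x |-> exp (b |x|_1) then belongs to the space (Phi_pfinite),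
and it dominates the exponentials with all z_i in the strip |Re z| <= b.  This
strip meets the hyperbola Re z^2 = (rho^2 - c) / n.  When all z_i lie on one
side of it the exponential decays under the semigroup, on the other side it
grows, and on the hyperbola itself it only rotates.  Each of the three families
spans a dense subspace: for the norm sup |f| / Phi b, analyticity in the
exponents shows that the closed span of exponentials with exponents clustering
at z0 contains those with exponents on the line Re z = Re z0
(ee_continuation).  These are one exponential times all the characters of R^n,
and trigonometric polynomials are dense in L^p of a finite measure
(trig_dense), whence span_dense.  Exponents on the hyperbola whose eigenvalue is
a rational multiple of 2 pi i give a dense set of periodic points
(periodic_dense).  A hypercyclic vector is a limit of combinations of decaying
exponentials: to approximate a combination y of growing exponentials at a late
time, one adds a small correction close to the backward evolution of y
(excursion, limit_of_stages, hypercyclic_vector).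

Essentially bounded functions.  For t > 0 the functions T_t v are continuous,
and a jump function is at positive distance from all continuous functions; the
only remaining element of the orbit is v itself (not_hypercyclic_bounded).

No hypercyclicity for c <= c_p.  It suffices that the Gaussian mass, the
integral of h_1 |T_t v|, is bounded in t, because the mass is a non-zero
continuous seminorm on the space.  By the semigroup property of the heat kernel
(gaussian_mass_le) the mass at time t is at most a constant times
exp (- T sigma^2) times the integral of h_T |v|, where T = 1 + t.  Now h_T
exp (- T sigma^2) is the product of a lower bound for the weight to the power
1/p and of a profile concentrated at |y| = 2 sigma T (kernel_factor).  The
L^q-norm of the profile, with 1/p + 1/q = 1, is bounded in T (shell_integral,
integral_profile), so that Young's inequality applies (kernel_test_le,
not_hypercyclic_subcritical). *)

(** * Derivatives of real functions *)

Section PointwiseDerivatives.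
Context {R : realType}.
Implicit Types (f g : R -> R) (x a b : R).

(** Same as is_derive in the only direction of the line; not being a class, it
keeps a derivative as an unknown to be read off from the derivation. *)
Definition der f x a : Prop := is_derive x 1 f a.

Lemma derE f x a b : der f x a -> a = b -> der f x b.
Proof. by move=> + <-. Qed.

Lemma derI x : der (fun t => t) x 1.
Proof. exact: is_derive_id. Qed.

Lemma derC a x : der (fun=> a) x 0.
Proof. exact: is_derive_cst. Qed.

Lemma derD f g x a b : der f x a -> der g x b ->
  der (fun t => f t + g t) x (a + b).
Proof. exact: is_deriveD. Qed.

Lemma derB f g x a b : der f x a -> der g x b ->
  der (fun t => f t - g t) x (a - b).
Proof. exact: is_deriveB. Qed.

Lemma derN f x a : der f x a -> der (fun t => - f t) x (- a).
Proof. exact: is_deriveN. Qed.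

Lemma derM f g x a b : der f x a -> der g x b ->
  der (fun t => f t * g t) x (a * g x + f x * b).
Proof.
by move=> df dg; rewrite /der addrC (mulrC a); exact: (is_deriveM df dg).
Qed.

Lemma dercomp h h' f x a : is_derive (f x) 1 h (h' (f x)) -> der f x a ->
  der (fun t => h (f t)) x (a * h' (f x)).
Proof. by move=> dh df; rewrite mulrC; exact: (is_derive1_comp dh df). Qed.

Lemma derexp f x a : der f x a -> der (fun t => expR (f t)) x (a * expR (f x)).
Proof. by move=> df; exact: (dercomp (h' := expR) (is_derive_expR _)). Qed.

Lemma dercos f x a : der f x a -> der (fun t => cos (f t)) x (a * - sin (f x)).
Proof.
by move=> df; exact: (dercomp (h' := fun y => - sin y) (is_derive_cos _)).
Qed.

Lemma dersin f x a : der f x a -> der (fun t => sin (f t)) x (a * cos (f x)).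
Proof. by move=> df; exact: (dercomp (h' := cos) (is_derive_sin _)). Qed.

Lemma derX f n x a : der f x a ->
  der (fun t => f t ^+ n) x (n%:R * f x ^+ n.-1 * a).
Proof.
move=> df; have := @is_deriveX _ _ f n x 1 a df; congr is_derive.
by apply/funext => t; elim: n => [|n IH]; rewrite ?expr0// !exprS -IH.
Qed.

Lemma dersum n (F : 'I_n -> R -> R) (d : 'I_n -> R) x :
  (forall i, der (F i) x (d i)) ->
  der (fun t => \sum_(i < n) F i t) x (\sum_(i < n) d i).
Proof.
move=> dF; have := is_derive_sum dF; congr is_derive.
by apply/funext => t; rewrite fct_sumE.
Qed.

Lemma derlin a x : der (fun t => t * a) x a.
Proof. by apply: derE (derM (derI x) (derC a x)) _; rewrite mul1r mulr0 addr0. Qed.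

Lemma der_cont f x a : der f x a -> {for x, continuous f}.
Proof.
by move=> df; apply/differentiable_continuous/derivable1_diffP; case: df.
Qed.

Lemma der_derivable f x a : der f x a -> derivable f x 1.
Proof. by case. Qed.

Lemma der_derive1 f x a : der f x a -> f^`()%classic x = a.
Proof. by move=> df; rewrite derive1E; exact: derive_val. Qed.

Lemma der_le (f d : R -> R) a b : a <= b ->
  (forall x, a <= x -> x <= b -> der f x (d x)) ->
  (forall x, a < x -> x < b -> 0 <= d x) -> f a <= f b.
Proof.
move=> ab df d0; apply: (@ger0_derive1_le_cc _ _ a b) => //.
- by move=> t /[!in_itv]/= /andP[? ?]; apply: der_derivable (df t _ _); exact: ltW.
- move=> t /[!in_itv]/= /andP[at_ tb].
  by rewrite (der_derive1 (df t (ltW at_) (ltW tb))) d0.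
- by apply: derivable_within_continuous => t /[!in_itv]/= /andP[? ?];
    apply: der_derivable (df t _ _).
- by rewrite in_itv/= lexx.
- by rewrite in_itv/= lexx ab.
Qed.

Lemma der_cst f : (forall x, der f x 0) -> forall x y, f x = f y.
Proof.
move=> df; suff le x y : x <= y -> f x = f y.
  by move=> x y; case/orP: (le_total x y) => /le.
move=> xy; apply/eqP; rewrite eq_le; apply/andP; split.
  exact: der_le xy (fun z _ _ => df z) (fun _ _ _ => lexx 0).
rewrite -lerN2; apply: (der_le xy (fun z _ _ => derN (df z))) => z _ _.
by rewrite oppr0.
Qed.

End PointwiseDerivatives.

(** * Complex numbers and the complex exponential *)

Section ComplexBasics.
Context {R : realType}.
Implicit Types (z w : R[i]) (a b : R).

Notation Re := complex.Re.
Notation Im := complex.Im.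
Notation normc := Normc.normc.

Lemma normc_ge0 z : 0 <= normc z.
Proof. by case: z => a b; exact: sqrtr_ge0. Qed.

Lemma normcE z : normc z = Num.sqrt (Re z ^+ 2 + Im z ^+ 2).
Proof. by case: z. Qed.

Lemma le_Re_normc z : `|Re z| <= normc z.
Proof. by rewrite normcE -[leLHS]sqrtr_sqr ler_wsqrtr// lerDl sqr_ge0. Qed.

Lemma le_Im_normc z : `|Im z| <= normc z.
Proof. by rewrite normcE -[leLHS]sqrtr_sqr ler_wsqrtr// lerDr sqr_ge0. Qed.

Lemma normc_le_ReIm z : normc z <= `|Re z| + `|Im z|.
Proof.
rewrite normcE -[leRHS](@ger0_norm)// ?addr_ge0// -sqrtr_sqr ler_wsqrtr//.
by rewrite sqrrD !real_normK ?num_real// -addrA lerD2l lerDr mulrn_wge0// mulr_ge0.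
Qed.

Lemma normc_real a : normc a%:C = `|a|.
Proof. by rewrite normcE/= expr0n addr0 sqrtr_sqr. Qed.

Lemma normcX z k : normc (z ^+ k) = normc z ^+ k.
Proof.
elim: k => [|k IH]; first by rewrite !expr0 Normc.normc1.
by rewrite !exprS Normc.normcM IH.
Qed.

Lemma normc_sub z w : normc z <= normc (z - w) + normc w.
Proof. by have := le_normcD (z - w) w; rewrite subrK. Qed.

Lemma ReM z w : Re (z * w) = Re z * Re w - Im z * Im w.
Proof. by case: z; case: w. Qed.

Lemma ImM z w : Im (z * w) = Re z * Im w + Im z * Re w.
Proof. by case: z; case: w. Qed.

Lemma ReD z w : Re (z + w) = Re z + Re w. Proof. by case: z; case: w. Qed.
Lemma ImD z w : Im (z + w) = Im z + Im w. Proof. by case: z; case: w. Qed.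
Lemma ReN z : Re (- z) = - Re z. Proof. by case: z. Qed.
Lemma ImN z : Im (- z) = - Im z. Proof. by case: z. Qed.
Lemma ReZ a z : Re (a%:C * z) = a * Re z.
Proof. by rewrite ReM/= mul0r subr0. Qed.
Lemma ImZ a z : Im (a%:C * z) = a * Im z.
Proof. by rewrite ImM/= mul0r addr0. Qed.

Lemma complexP z w : Re z = Re w -> Im z = Im w -> z = w.
Proof. by case: z w => [a b] [c d] /= -> ->. Qed.

Lemma Re_sum I (r : seq I) (F : I -> R[i]) :
  Re (\sum_(i <- r) F i) = \sum_(i <- r) Re (F i).
Proof. by elim/big_rec2: _ => // i y z _ <-; rewrite ReD. Qed.

Lemma Im_sum I (r : seq I) (F : I -> R[i]) :
  Im (\sum_(i <- r) F i) = \sum_(i <- r) Im (F i).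
Proof. by elim/big_rec2: _ => // i y z _ <-; rewrite ImD. Qed.

Lemma normc_prod I (r : seq I) (P : pred I) (F : I -> R[i]) :
  normc (\prod_(i <- r | P i) F i) = \prod_(i <- r | P i) normc (F i).
Proof.
by elim/big_rec2: _ => [|i y z _ <-]; rewrite ?Normc.normc1 ?Normc.normcM.
Qed.

(** Locked, so that unification does not unfold the exponential to trigonometric
functions. *)
Definition cexp : R[i] -> R[i] :=
  locked (fun z => (expR (Re z))%:C * (cos (Im z) +i* sin (Im z))).

Lemma cexpE z : cexp z = (expR (Re z))%:C * (cos (Im z) +i* sin (Im z)).
Proof. by rewrite /cexp -lock. Qed.

Lemma Re_cexp z : Re (cexp z) = expR (Re z) * cos (Im z).
Proof. by rewrite cexpE ReZ. Qed.

Lemma Im_cexp z : Im (cexp z) = expR (Re z) * sin (Im z).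
Proof. by rewrite cexpE ImZ. Qed.

Lemma cexpD z w : cexp (z + w) = cexp z * cexp w.
Proof.
apply: complexP.
  by rewrite Re_cexp ReM !(Re_cexp, Im_cexp) ReD ImD expRD cosD; ring.
by rewrite Im_cexp ImM !(Re_cexp, Im_cexp) ReD ImD expRD sinD; ring.
Qed.

Lemma cexp0 : cexp 0 = 1.
Proof. by apply: complexP; rewrite ?(Re_cexp, Im_cexp)/= expR0 mul1r ?cos0 ?sin0. Qed.

Lemma normc_cexp z : normc (cexp z) = expR (Re z).
Proof.
rewrite cexpE Normc.normcM normc_real ger0_norm ?expR_ge0// normcE/=.
by rewrite cos2Dsin2 sqrtr1 mulr1.
Qed.

Lemma cexp_neq0 z : cexp z != 0.
Proof.
by apply/eqP => h; have := expR_gt0 (Re z); rewrite -normc_cexp h Normc.normc0 ltxx.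
Qed.

Lemma cexp_sum I (r : seq I) (F : I -> R[i]) :
  cexp (\sum_(i <- r) F i) = \prod_(i <- r) cexp (F i).
Proof. by elim/big_rec2: _ => [|i y z _ <-]; rewrite ?cexp0 ?cexpD. Qed.

Definition cexp_taylor k w : R[i] := \sum_(i < k) (i`!%:R^-1)%:C * w ^+ i.

(** The real part, tested against u, of the Taylor remainder along the segment
from 0 to w. *)
Let ray k u w (s : R) : R := Re (u * (cexp (s%:C * w) - cexp_taylor k (s%:C * w))).

Let rayE k u w : ray k u w = (fun s => expR (s * Re w) * (Re u * cos (s * Im w) -
   Im u * sin (s * Im w)) - \sum_(i < k) s ^+ i * Re ((i`!%:R^-1)%:C * u * w ^+ i)).
Proof.
apply/funext => s; rewrite /ray mulrBr ReD ReN; congr (_ - _).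
  by rewrite ReM Re_cexp Im_cexp ReZ ImZ; ring.
rewrite /cexp_taylor mulr_sumr Re_sum; apply: eq_bigr => i _.
by rewrite exprMn -rmorphXn/= -ReZ; congr Re; ring.
Qed.

Let der_ray k u w (s : R) : der (ray k.+1 u w) s (ray k (u * w) w s).
Proof.
rewrite rayE; apply: derE.
  apply: derB; last by apply: dersum => i; apply: derM (derX _ (derI s)) (derC _ _).
  apply: derM; first exact/derexp/derlin.
  by apply: derB; apply: derM (derC _ _) _; [exact/dercos/derlin|exact/dersin/derlin].
rewrite rayE; congr (_ - _); first by rewrite !ReM !ImM; ring.
rewrite big_ord_recl/= !mul0r mulr0 !addr0 add0r.
apply: eq_bigr => i _; rewrite /bump/= add1n factS natrM.
have i0 : i.+1%:R != 0 :> R by [].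
have fi0 : i`!%:R != 0 :> R by rewrite pnatr_eq0 -lt0n fact_gt0.
rewrite -!mulrA !ReZ exprS invfM.
rewrite mulr0 addr0 mul1r add0n (mulrCA _ (s ^+ i)); congr (_ * _).
by field; rewrite nat1r i0 fi0.
Qed.

Let ray_le k u w (s : R) : 0 <= s -> s <= 1 ->
  ray k u w s <= normc u * (s * normc w) ^+ k * k`!%:R^-1 * expR (normc w).
Proof.
elim: k u s => [|k IH] u s s0 s1.
  rewrite expr0 fact0 invr1 !mulr1 /ray /cexp_taylor big_ord0 subr0.
  apply: le_trans (ler_norm _) _; apply: le_trans (le_Re_normc _) _.
  rewrite Normc.normcM normc_cexp ler_wpM2l ?normc_ge0// ler_expR ReZ.
  apply: le_trans (ler_norm _) _; rewrite normrM (ger0_norm s0).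
  by rewrite (le_trans _ (le_Re_normc w))// ler_piMl.
pose G (t : R) := normc u * (t * normc w) ^+ k.+1 * k.+1`!%:R^-1 * expR (normc w) - ray k.+1 u w t.
have dG t : der G t (normc (u * w) * (t * normc w) ^+ k * k`!%:R^-1 *
    expR (normc w) - ray k (u * w) w t).
  apply: derE.
    apply: derB (der_ray _ _ _ _); apply: derM (derM (derM (derC _ _) _) (derC _ _)) (derC _ _).
    exact: derX (derlin _ _).
  congr (_ - _).
  rewrite Normc.normcM factS natrM/=.
  have i0 : k.+1%:R != 0 :> R by [].
  have fi0 : k`!%:R != 0 :> R by rewrite pnatr_eq0 -lt0n fact_gt0.
  by rewrite invfM; field; rewrite nat1r i0 fi0.
have G0 : G 0 = 0.
  rewrite /G mul0r expr0n/= mulr0 !mul0r sub0r rayE.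
  rewrite !mul0r expR0 cos0 sin0 mulr1 mul1r mulr0 subr0.
  rewrite big_ord_recl/= expr0 big1 ?addr0; last by move=> i _; rewrite exprS !mul0r.
  by rewrite mul1r fact0 invr1 !mul1r expr0 mulr1 subrr oppr0.
suff : G 0 <= G s by rewrite G0 /G subr_ge0.
apply: der_le s0 (fun t _ _ => dG t) _ => t t0 ts; rewrite subr_ge0.
by apply: IH (ltW t0) _; rewrite (le_trans (ltW ts)).
Qed.

(** Along the segment from 0 to w the successive remainders are derivatives of
one another, so the bound for one order integrates to the bound for the next;
testing against a unit vector u keeps everything real-valued. *)
Lemma cexp_taylor_le k w :
  normc (cexp w - cexp_taylor k w) <= normc w ^+ k * k`!%:R^-1 * expR (normc w).
Proof.
set E := _ - _.
have := @ray_le k (E^*)%C w 1 ler01 (lexx 1).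
rewrite /ray !mul1r -/E.
have -> : Re ((E^*)%C * E) = normc E ^+ 2.
  by rewrite normcE sqr_sqrtr ?addr_ge0 ?sqr_ge0//; case: (E) => a b/=; ring.
have -> : normc (E^*)%C = normc E by rewrite !normcE; case: (E) => a b /=; rewrite sqrrN.
have [->|E0] := eqVneq (normc E) 0.
  by rewrite !mulr_ge0 ?exprn_ge0 ?normc_ge0 ?expR_ge0 ?invr_ge0.
by rewrite expr2 -!mulrA ler_pM2l// lt0r E0 normc_ge0.
Qed.

End ComplexBasics.

(** * Complex-valued integrals *)

Notation intble mu f := (mu.-integrable setT (EFin \o f)).

Section ComplexIntegral.
Context {R : realType} {d : measure_display} {T : measurableType d}.
Variable mu : {measure set T -> \bar R}.
Implicit Types (f g : T -> R[i]) (h : T -> R) (z : R[i]).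
Notation Re := complex.Re.
Notation Im := complex.Im.
Notation normc := Normc.normc.

Lemma cmeasurableM f g : cmeasurable f -> cmeasurable g ->
  cmeasurable (fun x => f x * g x).
Proof.
move=> [f1 f2] [g1 g2]; split.
  rewrite (_ : (fun _ => _) = fun x => Re (f x) * Re (g x) - Im (f x) * Im (g x)).
    by apply: measurable_funB; exact: measurable_funM.
  by apply/funext => x; rewrite ReM.
rewrite (_ : (fun _ => _) = fun x => Re (f x) * Im (g x) + Im (f x) * Re (g x)).
  by apply: measurable_funD; exact: measurable_funM.
by apply/funext => x; rewrite ImM.
Qed.

Lemma cmeasurableD f g : cmeasurable f -> cmeasurable g ->
  cmeasurable (fun x => f x + g x).
Proof.
move=> [f1 f2] [g1 g2]; split.
  by under eq_fun do rewrite ReD; exact: measurable_funD.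
by under eq_fun do rewrite ImD; exact: measurable_funD.
Qed.

Lemma cmeasurable_cst z : cmeasurable (fun _ : T => z).
Proof. by split; exact: measurable_cst. Qed.

Lemma cmeasurable_real h : measurable_fun setT h -> cmeasurable (fun x => (h x)%:C).
Proof. by move=> mh; split => //=; exact: measurable_cst. Qed.

Lemma cmeasurableN f : cmeasurable f -> cmeasurable (fun x => - f x).
Proof.
move=> mf; have := cmeasurableM (cmeasurable_cst (-1)) mf.
by congr cmeasurable; apply/funext => x; rewrite mulN1r.
Qed.

Lemma cmeasurableB f g : cmeasurable f -> cmeasurable g ->
  cmeasurable (fun x => f x - g x).
Proof. by move=> mf mg; exact: cmeasurableD mf (cmeasurableN mg). Qed.

Lemma cmeasurable_sum I (r : seq I) (F : I -> T -> R[i]) :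
  (forall i, cmeasurable (F i)) -> cmeasurable (fun x => \sum_(i <- r) F i x).
Proof.
move=> mF; elim: r => [|i r IH].
  by under eq_fun do rewrite big_nil; exact: cmeasurable_cst.
by under eq_fun do rewrite big_cons; exact: cmeasurableD.
Qed.

Lemma cmeasurable_prod I (r : seq I) (F : I -> T -> R[i]) :
  (forall i, cmeasurable (F i)) -> cmeasurable (fun x => \prod_(i <- r) F i x).
Proof.
move=> mF; elim: r => [|i r IH].
  by under eq_fun do rewrite big_nil; exact: cmeasurable_cst.
by under eq_fun do rewrite big_cons; exact: cmeasurableM.
Qed.

Lemma measurable_normc f : cmeasurable f -> measurable_fun setT (fun x => normc (f x)).
Proof.
move=> [f1 f2]; under eq_fun do rewrite normcE.
apply: (@measurableT_comp _ _ _ _ _ _ (@Num.sqrt R)).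
  by apply: continuous_measurable_fun; exact: sqrt_continuous.
by apply: measurable_funD; exact: measurable_funX.
Qed.

Lemma cmeasurable_cexp f : cmeasurable f -> cmeasurable (fun x => cexp (f x)).
Proof.
move=> [f1 f2]; split.
  under eq_fun do rewrite Re_cexp.
  apply: measurable_funM; first exact: measurableT_comp.
  by apply: measurableT_comp => //; apply: continuous_measurable_fun; exact: continuous_cos.
under eq_fun do rewrite Im_cexp.
apply: measurable_funM; first exact: measurableT_comp.
by apply: measurableT_comp => //; apply: continuous_measurable_fun; exact: continuous_sin.
Qed.

Definition cintegrable f : Prop :=
  intble mu (fun x => Re (f x)) /\ intble mu (fun x => Im (f x)).

Lemma intble_le h h' : measurable_fun setT h -> (forall x, `|h x| <= h' x) ->
  intble mu h' -> intble mu h.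
Proof.
move=> mh hh' ih'; apply: le_integrable ih' => //; first exact/measurable_EFinP.
by move=> x _ /=; rewrite lee_fin (le_trans (hh' x)) ?ler_norm.
Qed.

Lemma cintegrable_le f h : cmeasurable f -> (forall x, normc (f x) <= h x) ->
  intble mu h -> cintegrable f.
Proof.
move=> [mf1 mf2] fh ih; split; apply: intble_le ih => // x.
  exact: le_trans (le_Re_normc _) (fh x).
exact: le_trans (le_Im_normc _) (fh x).
Qed.

Lemma cintegralD f g : cintegrable f -> cintegrable g ->
  cintegral mu (fun x => f x + g x) = cintegral mu f + cintegral mu g.
Proof.
move=> [f1 f2] [g1 g2]; rewrite /cintegral; apply: complexP; rewrite /=.
  by under eq_Rintegral do rewrite ReD; rewrite RintegralD.
by under eq_Rintegral do rewrite ImD; rewrite RintegralD.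
Qed.

Lemma intbleZ h (a : R) : intble mu h -> intble mu (fun x => a * h x).
Proof. by move=> ih; exact: (integrableZl measurableT a ih). Qed.

Lemma intbleD h h' : intble mu h -> intble mu h' -> intble mu (fun x => h x + h' x).
Proof. by move=> ih ih'; exact: (integrableD measurableT ih ih'). Qed.

Lemma intbleB h h' : intble mu h -> intble mu h' -> intble mu (fun x => h x - h' x).
Proof. by move=> ih ih'; exact: (integrableB measurableT ih ih'). Qed.

Lemma cintegralZ z f : cintegrable f ->
  cintegral mu (fun x => z * f x) = z * cintegral mu f.
Proof.
move=> [f1 f2]; rewrite /cintegral; apply: complexP; rewrite ?(ReM, ImM)/=.
  by under eq_Rintegral do rewrite ReM; rewrite RintegralB//; [rewrite !RintegralZl|exact: intbleZ..].
by under eq_Rintegral do rewrite ImM; rewrite RintegralD//; [rewrite !RintegralZl|exact: intbleZ..].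
Qed.

Lemma fine_abs_le (x : \bar R) : (`|fine x|%:E <= `|x|)%E.
Proof. by case: x => //= *; rewrite ?normr0 leey. Qed.

(** Valid even when f is not integrable, where both parts of the integral are
junk, because fine never increases the modulus. *)
Lemma normc_cintegral_le f h : cmeasurable f -> measurable_fun setT h ->
  (forall x, normc (f x) <= h x) ->
  ((normc (cintegral mu f))%:E <= 2%:E * \int[mu]_x (h x)%:E)%E.
Proof.
move=> [mf1 mf2] mh fh.
have h0 x : 0 <= h x by rewrite (le_trans _ (fh x)) ?normc_ge0.
have part (k : T -> R) : measurable_fun setT k -> (forall x, `|k x| <= h x) ->
    (`|\int[mu]_x k x|%:E <= \int[mu]_x (h x)%:E)%E.
  move=> mk kh; apply: le_trans (fine_abs_le _) _.
  apply: le_trans (le_abse_integral _ _ _) _ => //; first exact/measurable_EFinP.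
  apply: ge0_le_integral => //; [exact/measurableT_comp/measurable_EFinP|exact/measurable_EFinP|].
  by move=> x _ /=; rewrite lee_fin.
have Re_le := part _ mf1 (fun x => le_trans (le_Re_normc _) (fh x)).
have Im_le := part _ mf2 (fun x => le_trans (le_Im_normc _) (fh x)).
rewrite mule_natl mule2n; apply: le_trans (leeD Re_le Im_le).
by rewrite -EFinD lee_fin normc_le_ReIm.
Qed.

End ComplexIntegral.

(** * Products on the Euclidean space *)

Section EuclideanFubini.
Context {R : realType}.
Local Notation E n := (euclidean R n).
Local Notation leb := (@lebesgue_measure R).
Local Notation lebn := (@lebesgue_euclidean R).
Notation Im := complex.Im.
Notation normc := Normc.normc.

Lemma ge0_integral_cons n (f : E n.+1 -> \bar R) : measurable_fun setT f ->
  (forall x, 0 <= f x)%E ->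
  (\int[lebn n.+1]_x f x = \int[leb]_a \int[lebn n]_y f (cons_euclidean (a, y)))%E.
Proof.
move=> mf f0.
rewrite [LHS](ge0_integral_pushforward (@measurable_cons_euclidean R n))//.
rewrite preimage_setT fubini_tonelli1//; last by move=> x; exact: f0.
by apply: measurableT_comp => //; exact: measurable_cons_euclidean.
Qed.

Lemma integral_cons n (f : E n.+1 -> R) : intble (lebn n.+1) f ->
  (\int[lebn n.+1]_x (f x)%:E = \int[leb]_a \int[lebn n]_y (f (cons_euclidean (a, y)))%:E)%E.
Proof.
move=> /integrableP[mf fi].
have ic : (leb \x lebn n)%E.-integrable setT (EFin \o (f \o @cons_euclidean R n)).
  apply/integrableP; split.
    by apply: measurableT_comp mf _; exact: measurable_cons_euclidean.
  move: fi; rewrite [X in (X < _)%E -> _](ge0_integral_pushforward (@measurable_cons_euclidean R n))//.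
  exact: measurableT_comp.
rewrite [LHS](integral_pushforward (@measurable_cons_euclidean R n))//.
by rewrite preimage_setT -(integral12_prod_meas1 ic).
Qed.

Lemma measurable_coord n (f : R -> R) (i : 'I_n) : measurable_fun setT f ->
  measurable_fun setT (fun x : E n => f (tnth x i)).
Proof. by move=> mf; apply: measurableT_comp mf _; exact: measurable_tnth. Qed.

Lemma measurable_cprod n (f : 'I_n -> R -> R) : (forall i, measurable_fun setT (f i)) ->
  measurable_fun setT (fun x : E n => \prod_(i < n) f i (tnth x i)).
Proof. by move=> mf; apply: measurable_prod => i _; exact: measurable_coord. Qed.

Lemma prod_cons (K : comNzRingType) n (f : 'I_n.+1 -> R -> K) (a : R) (y : E n) :
  \prod_(i < n.+1) f i (tnth (cons_euclidean (a, y)) i) =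
  f ord0 a * \prod_(i < n) f (lift ord0 i) (tnth y i).
Proof.
rewrite big_ord_recl; congr (_ * _).
by apply: eq_bigr => i _; rewrite /cons_euclidean/= tnthS.
Qed.

Lemma ge0_integral_prod n (f : 'I_n -> R -> R) :
  (forall i, measurable_fun setT (f i)) -> (forall i t, 0 <= f i t) ->
  (\int[lebn n]_x (\prod_(i < n) f i (tnth x i))%:E =
   \prod_(i < n) \int[leb]_t (f i t)%:E)%E.
Proof.
elim: n f => [|n IH] f mf f0.
  rewrite big_ord0 integral_dirac//; last first.
    apply/measurable_EFinP; exact: measurable_cprod.
  by rewrite diracT mul1e big_ord0.
rewrite ge0_integral_cons; [|by apply/measurable_EFinP; exact: measurable_cprod|
  by move=> x; rewrite lee_fin prodr_ge0].
rewrite big_ord_recl -(IH (fun i => f (lift ord0 i)))//.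
under eq_integral => a _.
  under eq_integral do rewrite prod_cons EFinM.
  rewrite ge0_integralZl ?lee_fin//; [over| |by move=> x _; rewrite lee_fin prodr_ge0].
  apply/measurable_EFinP; exact: (measurable_cprod (fun i => mf (lift ord0 i))).
rewrite ge0_integralZr//.
- by apply/measurable_EFinP; exact: mf.
- by move=> x _; rewrite lee_fin.
- by apply: integral_ge0 => x _; rewrite lee_fin prodr_ge0.
Qed.

Lemma intble_prod n (f : 'I_n -> R -> R) : (forall i t, 0 <= f i t) ->
  (forall i, intble leb (f i)) ->
  intble (lebn n) (fun x => \prod_(i < n) f i (tnth x i)).
Proof.
move=> f0 fi.
have mf i : measurable_fun setT (f i) by have /integrableP[/measurable_EFinP] := fi i.
apply/integrableP; split; first by apply/measurable_EFinP; exact: measurable_cprod.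
under eq_integral do rewrite gee0_abs ?lee_fin ?prodr_ge0//.
rewrite ge0_integral_prod//.
pose I i := (\int[leb]_t (f i t)%:E)%E.
have Ii i : (0 <= I i < +oo)%E.
  apply/andP; split; first by apply: integral_ge0 => t _; rewrite lee_fin.
  have /integrableP[_] := fi i; congr (_ < _)%E.
  by apply: eq_integral => t _ /=; rewrite ger0_norm.
suff /andP[] : (0 <= \prod_(i < n) I i < +oo)%E by [].
elim/big_ind: _ => //=; first by rewrite lee_fin ler01 ltry.
move=> x y /andP[x0 xy] /andP[y0 yy]; rewrite mule_ge0//=.
by rewrite lte_mul_pinfty// ge0_fin_numE.
Qed.

Lemma cmeasurable_cprod n (f : 'I_n -> R -> R[i]) : (forall i, cmeasurable (f i)) ->
  cmeasurable (fun x : E n => \prod_(i < n) f i (tnth x i)).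
Proof.
move=> mf; apply: cmeasurable_prod => i.
by have [h1 h2] := mf i; split; [exact: (measurable_coord i h1)|exact: (measurable_coord i h2)].
Qed.

Lemma cintegrable_prod n (f : 'I_n -> R -> R[i]) : (forall i, cmeasurable (f i)) ->
  (forall i, intble leb (fun t => normc (f i t))) ->
  cintegrable (lebn n) (fun x : E n => \prod_(i < n) f i (tnth x i)).
Proof.
move=> mf fi.
apply: (@cintegrable_le _ _ _ (lebn n) _ (fun x : E n => \prod_(i < n) normc (f i (tnth x i)))).
- exact: cmeasurable_cprod.
- by move=> x; rewrite normc_prod.
- exact: (intble_prod (fun i t => normc_ge0 (f i t)) fi).
Qed.

(** The real and imaginary parts of a product of complex functions of separate
variables mix two tensor products. *)
Lemma Rintegral_tensor2 n (u v : measurableTypeR R -> R) (g h : E n -> R) (F : E n.+1 -> R) :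
  intble leb u -> intble leb v -> intble (lebn n) g -> intble (lebn n) h ->
  intble (lebn n.+1) F ->
  (forall a y, F (cons_euclidean (a, y)) = u a * g y + v a * h y) ->
  \int[lebn n.+1]_x F x =
    \int[leb]_a u a * \int[lebn n]_y g y + \int[leb]_a v a * \int[lebn n]_y h y.
Proof.
move=> iu iv ig ih iF FE.
rewrite [LHS]/Rintegral integral_cons//.
have -> : (\int[leb]_a \int[lebn n]_y (F (cons_euclidean (a, y)))%:E =
    \int[leb]_a (u a * \int[lebn n]_y g y + v a * \int[lebn n]_y h y)%:E)%E.
  apply: eq_integral => a _.
  rewrite -!RintegralZl// -RintegralD//; [|exact: intbleZ..].
  rewrite [RHS]fineK; last by apply: integrable_fin_num => //; apply: intbleD; exact: intbleZ.
  by apply: eq_integral => y _; rewrite FE.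
rewrite -/(Rintegral _ _ _) RintegralD//.
- by rewrite !RintegralZr.
- by under [X in intble _ X]eq_fun do rewrite mulrC; exact: intbleZ.
- by under [X in intble _ X]eq_fun do rewrite mulrC; exact: intbleZ.
Qed.

Lemma cintegral_prod n (f : 'I_n -> R -> R[i]) :
  (forall i, cmeasurable (f i)) ->
  (forall i, intble leb (fun t => normc (f i t))) ->
  cintegral (lebn n) (fun x => \prod_(i < n) f i (tnth x i)) =
  \prod_(i < n) cintegral leb (f i).
Proof.
elim: n f => [|n IH] f mf fi.
  have m1 : lebn 0 setT = 1%E by exact: diracT.
  have c0 (c : R) : Rintegral (lebn 0) setT (fun=> c) = c.
    by rewrite Rintegral_cst// -[RHS]mulr1; congr (_ * _); exact: (congr1 fine m1).
  rewrite big_ord0; under eq_fun do rewrite big_ord0.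
  by apply: complexP; exact: c0.
have [iF1 iF2] := cintegrable_prod mf fi.
have [iG1 iG2] : cintegrable (lebn n) (fun x : E n => \prod_(i < n) f (lift ord0 i) (tnth x i)).
  exact: (cintegrable_prod (fun i => mf (lift ord0 i)) (fun i => fi (lift ord0 i))).
pose h (t : measurableTypeR R) := normc (f ord0 t).
have [i01 i02] : cintegrable leb (f ord0).
  by apply: (@cintegrable_le _ _ _ leb (f ord0) h (mf ord0)) => //; exact: (fi ord0).
rewrite big_ord_recl -(IH (fun i => f (lift ord0 i)))//.
set G := fun x : E n => \prod_(i < n) f (lift ord0 i) (tnth x i) in iG1 iG2 *.
have iN02 : intble leb (fun t : measurableTypeR R => - Im (f ord0 t)).
  by under [X in intble _ X]eq_fun do rewrite -mulN1r; exact: intbleZ.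
apply: complexP.
  rewrite ReM /=.
  rewrite (Rintegral_tensor2 i01 iN02 iG1 iG2)//; last first.
    by move=> a y; rewrite prod_cons ReM mulNr.
  congr (_ + _); rewrite -mulNr; congr (_ * _).
  by rewrite -mulN1r -RintegralZl//; apply: eq_Rintegral => t _; rewrite mulN1r.
rewrite ImM /= (Rintegral_tensor2 i01 i02 iG2 iG1)//.
by move=> a y; rewrite prod_cons ImM.
Qed.

End EuclideanFubini.

(** * The one-dimensional heat kernel *)

Section GaussianKernel.
Context {R : realType}.
Local Notation leb := (@lebesgue_measure R).

Definition gauss (t x : R) : R :=
  (Num.sqrt (4 * pi * t))^-1 * expR (- x ^+ 2 / (4 * t)).

Section Fixed.
Variable t : R.
Hypothesis t_gt0 : 0 < t.

Lemma gauss_ge0 x : 0 <= gauss t x.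
Proof. by rewrite mulr_ge0 ?invr_ge0 ?sqrtr_ge0 ?expR_ge0. Qed.

Lemma gauss_normal_pdf x y : gauss t (x - y) = normal_pdf x (Num.sqrt (2 * t)) y.
Proof.
have t2 : 0 < 2 * t by rewrite mulr_gt0.
rewrite normal_pdfE; last by rewrite gt_eqF// sqrtr_gt0.
rewrite /normal_peak /normal_fun sqr_sqrtr ?(ltW t2)// /gauss.
rewrite (_ : 4 * pi * t = 2 * t * pi *+ 2); last by ring.
rewrite (_ : (x - y) ^+ 2 = (y - x) ^+ 2); last by ring.
by rewrite (_ : 2 * t *+ 2 = 4 * t); last by ring.
Qed.

Lemma intble_gauss x : intble leb (fun y => gauss t (x - y)).
Proof. by under [X in intble _ X]eq_fun do rewrite gauss_normal_pdf; exact: integrable_normal_pdf. Qed.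

Lemma integral_gauss x : (\int[leb]_y (gauss t (x - y))%:E = 1)%E.
Proof. by under eq_integral do rewrite gauss_normal_pdf; exact: integral_normal_pdf. Qed.

Lemma measurable_gauss (x : R) : measurable_fun setT (fun y : R => gauss t (x - y)).
Proof. by have /integrableP[/measurable_EFinP] := intble_gauss x. Qed.

(** Completing the square: an exponential tilt of a Gaussian is a translated
Gaussian. *)
Lemma gauss_tilt (a x y : R) : gauss t (x - y) * expR (a * y) =
  expR (t * a ^+ 2 + a * x) * gauss t (x + 2 * t * a - y).
Proof.
rewrite /gauss mulrCA -!mulrA; congr (_ * _); rewrite -!expRD; congr expR.
by field; rewrite gt_eqF.
Qed.

Lemma intble_gauss_expR (a x : R) : intble leb (fun y => gauss t (x - y) * expR (a * y)).
Proof.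
under [X in intble _ X]eq_fun do rewrite gauss_tilt.
by apply: intbleZ; exact: intble_gauss.
Qed.

Lemma integral_gauss_expR (a x : R) :
  (\int[leb]_y (gauss t (x - y) * expR (a * y))%:E = (expR (t * a ^+ 2 + a * x))%:E)%E.
Proof.
under eq_integral do rewrite gauss_tilt EFinM.
rewrite ge0_integralZl ?lee_fin ?expR_ge0// ?integral_gauss ?mule1//.
- by apply/measurable_EFinP; exact: measurable_gauss.
- by move=> y _; rewrite lee_fin gauss_ge0.
Qed.

Lemma der_gauss (m y : R) : der (fun y => gauss t (m - y)) y ((m - y) / (2 * t) * gauss t (m - y)).
Proof.
apply: derE.
  apply: derM (derC _ _) _; apply: derexp; apply: derM (derC _ _); apply: derN.
  exact: derX (derB (derC _ _) (derI _)).
rewrite /gauss/=; set S := (Num.sqrt _)^-1; set e := expR _.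
by field; rewrite gt_eqF.
Qed.

End Fixed.

End GaussianKernel.

(** * The Fourier transform of the Gaussian *)

Section OscillatoryGaussian.
Context {R : realType}.
Local Notation leb := (@lebesgue_measure R).

(** The integral over [-n, n] is a boundary term, which vanishes in the limit. *)
Lemma integral_derivative_eq0 (F f : R -> R) : (forall x, der F x (f x)) ->
  continuous f -> intble leb f ->
  F n%:R @[n --> \oo] --> 0 -> F (- n%:R) @[n --> \oo] --> 0 ->
  \int[leb]_x f x = 0.
Proof.
move=> dF cf intf Fp Fn.
have mf : measurable_fun setT f by have /integrableP[/measurable_EFinP] := intf.
pose A (n : nat) := `[- n%:R, n%:R]%classic : set (measurableTypeR R).
have mA n : measurable (A n) by exact: measurable_itv.
have e n : (\int[leb]_x ((f \_ (A n)) x)%:E = (F n%:R - F (- n%:R))%:E)%E.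
  transitivity (\int[leb]_(x in A n) (f x)%:E)%E.
    by rewrite [RHS]integral_mkcond; apply: eq_integral => x _; rewrite !patchE; case: ifP.
  have [->|n0] := eqVneq n 0%N.
    by rewrite /A !oppr0 set_itv1 integral_set1 subrr.
  rewrite EFinB; apply: continuous_FTC2.
  - by rewrite gtrN// ltr0n lt0n.
  - exact: continuous_subspaceT.
  - split => [x _||]; first exact: der_derivable (dF x).
    + exact/cvg_at_right_filter/(der_cont (dF _)).
    + exact/cvg_at_left_filter/(der_cont (dF _)).
  - by move=> x _; exact: der_derive1 (dF x).
have : (\int[leb]_x ((f \_ (A n)) x)%:E)%E @[n --> \oo] --> (\int[leb]_x (f x)%:E)%E.
  apply: (@dominated_cvg _ _ _ leb setT measurableT _ _ (fun x => `|(f x)%:E|)%E) => //.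
  - by move=> n; apply/measurable_EFinP; apply/(measurable_restrictT _ (mA n)); exact: measurable_funTS.
  - move=> x _; apply: cvg_near_cst.
    near=> n; congr (_%:E); rewrite patchE mem_set// /A /= in_itv/=.
    rewrite -ler_norml; near: n; exact: nbhs_infty_ger.
  - exact: integrable_abse.
  - move=> n x _ /=; rewrite patchE lee_fin; case: ifP => // _.
    by rewrite normr0.
under eq_fun do rewrite e.
move=> cint; have c0 : (F n%:R - F (- n%:R))%:E @[n --> \oo] --> 0%:E.
  by apply/fine_cvgP; split; [exact: nearW|]; rewrite -[X in _ --> X]subr0; exact: cvgB.
by rewrite /Rintegral (cvg_unique _ cint c0).
Unshelve. all: by end_near. Qed.

Section Fixed.
Variables (t m : R).
Hypothesis t_gt0 : 0 < t.
Local Notation g y := (gauss t (m - y)).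

Let dom (y : R) := g y * expR (y - m) + g y * expR (m - y).

Let intble_dom : intble leb dom.
Proof.
have h (a c : R) : intble leb (fun y => g y * expR (a * y + c)).
  under [X in intble _ X]eq_fun do rewrite expRD mulrA mulrC.
  by apply: intbleZ; exact: intble_gauss_expR.
apply: intbleD.
  by under [X in intble _ X]eq_fun do rewrite -[X in expR (X - _)]mul1r; exact: h.
rewrite (_ : (fun y => g y * expR (m - y)) = (fun y => g y * expR (-1 * y + m))); first exact: h.
by apply/funext => y; rewrite mulN1r (addrC (- y)).
Qed.

Let dom_ge (y : R) : `|(y - m) * g y| <= dom y.
Proof.
rewrite normrM (ger0_norm (gauss_ge0 _ _)) mulrC /dom -mulrDr ler_wpM2l ?gauss_ge0//.
rewrite -(opprB y m); move: (y - m) => u.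
have := expR_ge1Dx u; have := expR_ge1Dx (- u); have := expR_ge0 u; have := expR_ge0 (- u).
by have [u0|u0] := leP 0 u; [rewrite ger0_norm//|rewrite ltr0_norm//]; lra.
Qed.

Lemma gauss_cvg0 (s : R) : `|s| = 1 -> g (s * n%:R) @[n --> \oo] --> 0.
Proof.
move=> s1; pose C := (Num.sqrt (4 * pi * t))^-1 * expR ((2 * `|m| + 1) / (4 * t)).
apply: (@squeeze_cvgr _ _ _ _ (cst 0) (geometric C (expR (- (2 * t)^-1)))).
- near=> n; rewrite gauss_ge0//= /gauss /C -[leRHS]mulrA ler_wpM2l ?invr_ge0 ?sqrtr_ge0//.
  rewrite -expRM_natl -expRD ler_expR.
  have -> : (2 * `|m| + 1) / (4 * t) + n%:R * - (2 * t)^-1 = - (2 * (n%:R - `|m|) - 1) / (4 * t).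
    by field; rewrite gt_eqF.
  rewrite ler_pM2r ?invr_gt0 ?mulr_gt0// lerN2.
  have : n%:R - `|m| <= `|m - s * n%:R|.
    rewrite lerBlDl (le_trans _ (ler_normB _ _))// opprB addrC subrK normrM s1 mul1r.
    by rewrite ger0_norm.
  rewrite -[X in _ -> _ <= X]real_normK ?num_real//; move: (`|m - _|) => v nv.
  by have := sqr_ge0 (v - 1); nra.
- exact: cvg_cst.
- apply: cvg_geometric; rewrite ger0_norm ?expR_ge0// expR_lt1 oppr_lt0 invr_gt0.
  by rewrite mulr_gt0.
Unshelve. all: by end_near. Qed.

Lemma gauss_osc_cvg0 (psi : R -> R) (b s : R) : (forall x, `|psi x| <= 1) -> `|s| = 1 ->
  g (s * n%:R) * psi (b * (s * n%:R - m)) @[n --> \oo] --> 0.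
Proof.
move=> psi1 s1; apply/norm_cvg0P; apply: (@squeeze_cvgr _ _ _ _ (cst 0) (fun n => g (s * n%:R))).
- near=> n; rewrite normr_ge0/= normrM (ger0_norm (gauss_ge0 _ _)).
  by rewrite ler_piMr ?gauss_ge0.
- exact: cvg_cst.
- exact: gauss_cvg0.
Unshelve. all: by end_near. Qed.

(** The transform of the Gaussian solves the linear differential equation
H' = - 2 t b H, by differentiation under the integral and one integration by
parts; phi stands for either cosine or sine. *)
Lemma integral_gauss_osc (phi psi : R -> R) (b : R) :
  (forall x, der phi x (psi x)) -> (forall x, der psi x (- phi x)) ->
  (forall x, `|phi x| <= 1) -> (forall x, `|psi x| <= 1) ->
  \int[leb]_y (g y * phi (b * (y - m))) = expR (- (t * b ^+ 2)) * phi 0.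
Proof.
move=> dphi dpsi phi1 psi1.
have cphi : continuous phi by move=> x; exact: der_cont (dphi x).
have cpsi : continuous psi by move=> x; exact: der_cont (dpsi x).
have cg : continuous (fun y => g y) by move=> y; exact: der_cont (der_gauss t_gt0 m y).
have cl b' : continuous (fun y => b' * (y - m)).
  by move=> y; apply: cvgM; [exact: cvg_cst|apply: cvgB; [exact: cvg_id|exact: cvg_cst]].
have meas (f : R -> R) : continuous f -> measurable_fun setT f by exact: continuous_measurable_fun.
have igf (f : R -> R) b' : continuous f -> (forall x, `|f x| <= 1) ->
    intble leb (fun y => g y * f (b' * (y - m))).
  move=> cf f1; apply: (@intble_le _ _ _ leb _ (fun y => g y)).
  - apply: measurable_funM; first exact: measurable_gauss.
    by apply: meas => y; apply: continuous_comp; [exact: cl|exact: cf].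
  - by move=> y; rewrite normrM (ger0_norm (gauss_ge0 _ _)) ler_piMr ?gauss_ge0.
  - exact: intble_gauss.
have igf' (f : R -> R) b' : continuous f -> (forall x, `|f x| <= 1) ->
    intble leb (fun y => (y - m) * g y * f (b' * (y - m))).
  move=> cf f1; apply: (@intble_le _ _ _ leb _ dom) => //.
  - apply: measurable_funM.
      apply: measurable_funM; last exact: measurable_gauss.
      by apply: measurable_funB => //; exact: measurable_cst.
    by apply: meas => y; apply: continuous_comp; [exact: cl|exact: cf].
  - by move=> y; rewrite normrM (le_trans _ (dom_ge y))// ler_piMr.
pose H b' := \int[leb]_y (g y * phi (b' * (y - m))).
have parts b' : \int[leb]_y ((y - m) * g y * psi (b' * (y - m))) = - (2 * t * b') * H b'.
  pose f y := - (2 * t)^-1 * ((y - m) * g y * psi (b' * (y - m))) - b' * (g y * phi (b' * (y - m))).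
  have : \int[leb]_y f y = 0.
    apply: (@integral_derivative_eq0 (fun y => g y * psi (b' * (y - m)))).
    - move=> y; apply: derE.
        apply: derM (der_gauss t_gt0 m y) _.
        by apply: (dercomp (h' := fun x => - phi x) (dpsi _)); apply: derM (derC _ _) (derB (derI _) (derC _ _)).
      by rewrite /f; field; rewrite gt_eqF.
    - move=> y; apply: cvgB; apply: cvgM; try exact: cvg_cst.
      + apply: cvgM; last by apply: continuous_comp; [exact: cl|exact: cpsi].
        by apply: cvgM; [apply: cvgB; [exact: cvg_id|exact: cvg_cst]|exact: cg].
      + by apply: cvgM; [exact: cg|apply: continuous_comp; [exact: cl|exact: cphi]].
    - apply: intbleB; apply: intbleZ; first exact: igf'.
      exact: igf.
    - by have := @gauss_osc_cvg0 psi b' 1 psi1 (normr1 _); under eq_fun do rewrite mul1r.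
    - by have := @gauss_osc_cvg0 psi b' (-1) psi1 (normrN1 _); under eq_fun do rewrite mulN1r.
  rewrite RintegralB//; [|by apply: intbleZ; exact: igf'|by apply: intbleZ; exact: igf].
  rewrite !RintegralZl//; [|exact: igf'|exact: igf].
  rewrite -/(H b') => /eqP; rewrite subr_eq0 => /eqP e.
  transitivity (- (2 * t) * (b' * H b')); last by ring.
  by rewrite -e; field; rewrite gt_eqF.
have dH b' : der H b' (- (2 * t * b') * H b').
  rewrite -parts.
  pose f (x : R) (y : measurableTypeR R) := g y * phi (x * (y - m)).
  have df x y : der (f ^~ y) x ((y - m) * g y * psi (x * (y - m))).
    apply: derE.
      apply: derM (derC _ _) _; apply: (dercomp (h' := psi) (dphi _)); exact: derlin.
    by rewrite /= mul0r add0r mulrA (mulrC (g y)).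
  have bI : `]b' - 1, b' + 1[%classic b' by rewrite /= in_itv/= ltrBlDr ltrDl ltr01.
  have If x : intble leb (f x) by exact: igf.
  have d1 x y : partial1of2 f x y = (y - m) * g y * psi (x * (y - m)).
    exact: der_derive1 (df x y).
  have G0 y : 0 <= dom y by rewrite addr_ge0// mulr_ge0 ?gauss_ge0 ?expR_ge0.
  have dle x (y : measurableTypeR R) : `|partial1of2 f x y| <= dom y.
    by rewrite d1 normrM (le_trans _ (dom_ge y))// ler_piMr.
  have D := @derivable_under_integral R _ _ leb f setT measurableT b' (b' - 1) (b' + 1) bI
    (fun x _ => If x) (fun x y _ _ => der_derivable (df x y)) dom G0 intble_dom
    (fun x y _ _ => dle x y).
  have := @differentiation_under_integral R _ _ leb f setT measurableT b' (b' - 1) (b' + 1) bI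
    (fun x _ => If x) (fun x y _ _ => der_derivable (df x y)) dom G0 intble_dom
    (fun x y _ _ => dle x y).
  rewrite derive1E => D'; apply: DeriveDef => //; rewrite D'.
  by apply: eq_Rintegral => y _; rewrite d1.
have K x : expR (t * x ^+ 2) * H x = expR (t * 0 ^+ 2) * H 0.
  apply: (der_cst (f := fun x => expR (t * x ^+ 2) * H x)) => {}x; apply: derE.
    by apply: derM (dH x); apply: derexp; apply: derM (derC _ _) (derX _ (derI _)).
  by rewrite /=; ring.
have H0 : H 0 = phi 0.
  rewrite /H; under eq_Rintegral do rewrite mul0r mulrC.
  rewrite RintegralZl//; last exact: intble_gauss.
  by rewrite /Rintegral integral_gauss// mulr1.
have := K b; rewrite H0 expr0n/= mulr0 expR0 mul1r => <-.
by rewrite mulrA -expRD addNr expR0 mul1r.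
Qed.

End Fixed.
End OscillatoryGaussian.

(** * Exponentials are eigenfunctions of the heat semigroup *)

Section HeatKernel.
Context {R : realType}.
Local Notation leb := (@lebesgue_measure R).
Local Notation lebn := (@lebesgue_euclidean R).
Local Notation E n := (euclidean R n).
Notation Re := complex.Re.
Notation Im := complex.Im.
Notation normc := Normc.normc.

Lemma sin_le1_norm (x : R) : `|sin x| <= 1.
Proof. by rewrite ler_norml sin_geN1 sin_le1. Qed.

Lemma cos_le1_norm (x : R) : `|cos x| <= 1.
Proof. by rewrite ler_norml cos_geN1 cos_le1. Qed.

Lemma integral_gauss_cos (t m b : R) : 0 < t ->
  \int[leb]_y (gauss t (m - y) * cos (b * (y - m))) = expR (- (t * b ^+ 2)).
Proof.
move=> t0; rewrite (@integral_gauss_osc _ _ _ t0 cos (fun x => - sin x)) ?cos0 ?mulr1//.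
- by move=> x; apply: derE; [exact: dercos (derI _)|rewrite mul1r].
- by move=> x; apply: derE; [exact: derN (dersin (derI _))|rewrite mul1r].
- exact: cos_le1_norm.
- by move=> x; rewrite normrN sin_le1_norm.
Qed.

Lemma integral_gauss_sin (t m b : R) : 0 < t ->
  \int[leb]_y (gauss t (m - y) * sin (b * (y - m))) = 0.
Proof.
move=> t0; rewrite (@integral_gauss_osc _ _ _ t0 sin cos) ?sin0 ?mulr0//.
- by move=> x; apply: derE; [exact: dersin (derI _)|rewrite mul1r].
- by move=> x; apply: derE; [exact: dercos (derI _)|rewrite mul1r].
- exact: sin_le1_norm.
- exact: cos_le1_norm.
Qed.

Lemma cmeasurable_lin z : cmeasurable (fun y : R => z * y%:C).
Proof. by apply: cmeasurableM; [exact: cmeasurable_cst|exact: cmeasurable_real]. Qed.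

Lemma cmeasurable_gauss_cexp (t x : R) (z : R[i]) : 0 < t ->
  cmeasurable (fun y : R => (gauss t (x - y))%:C * cexp (z * y%:C)).
Proof.
move=> t0; apply: cmeasurableM; first by apply: cmeasurable_real; exact: measurable_gauss.
by apply: cmeasurable_cexp; exact: cmeasurable_lin.
Qed.

Lemma normc_gauss_cexp (t x y : R) (z : R[i]) :
  normc ((gauss t (x - y))%:C * cexp (z * y%:C)) = gauss t (x - y) * expR (Re z * y).
Proof.
rewrite Normc.normcM normc_real ger0_norm ?gauss_ge0// normc_cexp.
by rewrite ReM/= mulr0 subr0.
Qed.

(** The identity extends from real z, where it is a completed square, to
complex z through the oscillatory integrals. *)
Lemma cintegral_gauss_cexp (t x : R) (z : R[i]) : 0 < t ->
  cintegral leb (fun y : measurableTypeR R => (gauss t (x - y))%:C * cexp (z * y%:C)) =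
  cexp (t%:C * z ^+ 2 + z * x%:C).
Proof.
case: z => a b t0.
pose m := x + 2 * t * a.
pose A := expR (t * a ^+ 2 + a * x).
pose U (f : R -> R) (y : measurableTypeR R) := gauss t (m - y) * f (b * (y - m)).
have iU f : continuous f -> (forall y, `|f y| <= 1) -> intble leb (U f).
  move=> cf f1; apply: (@intble_le _ _ _ leb _ (fun y => gauss t (m - y))).
  - apply: measurable_funM; first exact: measurable_gauss.
    apply: continuous_measurable_fun => y; apply: continuous_comp; last exact: cf.
    by apply: cvgM; [exact: cvg_cst|apply: cvgB; [exact: cvg_id|exact: cvg_cst]].
  - by move=> y; rewrite normrM (ger0_norm (gauss_ge0 _ _)) ler_piMr ?gauss_ge0.
  - exact: intble_gauss.
have ic := iU _ (@continuous_cos R) cos_le1_norm.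
have is_ := iU _ (@continuous_sin R) sin_le1_norm.
have Ic : \int[leb]_y U cos y = expR (- (t * b ^+ 2)) by exact: integral_gauss_cos.
have Is : \int[leb]_y U sin y = 0 by exact: integral_gauss_sin.
have splitb y : b * y = b * (y - m) + b * m by ring.
have ReE y : Re ((gauss t (x - y))%:C * cexp ((a +i* b) * y%:C)) =
    A * cos (b * m) * U cos y - A * sin (b * m) * U sin y.
  rewrite ReZ Re_cexp ReM ImM/= !mulr0 subr0 add0r mulrA gauss_tilt//.
  by rewrite -/m -/A (splitb y) cosD /U; ring.
have ImE y : Im ((gauss t (x - y))%:C * cexp ((a +i* b) * y%:C)) =
    A * cos (b * m) * U sin y + A * sin (b * m) * U cos y.
  rewrite ImZ Im_cexp ReM ImM/= !mulr0 subr0 add0r mulrA gauss_tilt//.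
  by rewrite -/m -/A (splitb y) sinD /U; ring.
have ReRHS : Re (t%:C * (a +i* b) ^+ 2 + (a +i* b) * x%:C) = t * a ^+ 2 + a * x - t * b ^+ 2.
  by rewrite ReD ReZ expr2 !ReM/=; ring.
have ImRHS : Im (t%:C * (a +i* b) ^+ 2 + (a +i* b) * x%:C) = b * m.
  by rewrite ImD ImZ expr2 !ImM/= /m; ring.
apply: complexP.
  rewrite Re_cexp ReRHS ImRHS.
  transitivity (\int[leb]_y (A * cos (b * m) * U cos y - A * sin (b * m) * U sin y)).
    by apply: eq_Rintegral => y _; exact: ReE.
  rewrite RintegralB//; [|exact: intbleZ..]; rewrite !RintegralZl// Ic Is.
  by rewrite expRD -/A; ring.
rewrite Im_cexp ReRHS ImRHS.
transitivity (\int[leb]_y (A * cos (b * m) * U sin y + A * sin (b * m) * U cos y)).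
  by apply: eq_Rintegral => y _; exact: ImE.
rewrite RintegralD//; [|exact: intbleZ..]; rewrite !RintegralZl// Ic Is.
by rewrite expRD -/A; ring.
Qed.

Lemma enorm_ge0 n (x : E n) : 0 <= enorm x.
Proof. exact: sqrtr_ge0. Qed.

Lemma enorm_sqr n (x : E n) : enorm x ^+ 2 = \sum_(i < n) (tnth x i : R) ^+ 2.
Proof. by rewrite /enorm sqr_sqrtr// sumr_ge0// => i _; exact: sqr_ge0. Qed.

Lemma heat_kernelE n (t : R) (x y : E n) : 0 < t ->
  heat_kernel t (esub x y) = \prod_(i < n) gauss t (tnth x i - tnth y i : R).
Proof.
move=> t0; rewrite /heat_kernel enorm_sqr.
have p0 : 0 < 4 * pi * t :> R by rewrite !mulr_gt0// pi_gt0.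
rewrite /gauss big_split/= prodr_const card_ord; congr (_ * _).
  rewrite powRN exprVn; congr (_^-1).
  by rewrite -powR12_sqrt ?ltW// -powR_mulrn ?powR_ge0// -powRrM [n%:R / 2]mulrC.
rewrite -expR_sum -sumrN mulr_suml; congr expR.
by apply: eq_bigr => i _; rewrite tnth_mktuple mulNr.
Qed.

Lemma heat_kernel_ge0 n (t : R) (x : E n) : 0 <= heat_kernel t x.
Proof. by rewrite mulr_ge0 ?powR_ge0 ?expR_ge0. Qed.

Definition ee n (z : 'I_n -> R[i]) (x : E n) : R[i] :=
  \prod_(i < n) cexp (z i * (tnth x i : R)%:C).

Definition eigenvalue_of n (rho c : R) (z : 'I_n -> R[i]) : R[i] :=
  (c - rho ^+ 2)%:C + \sum_(i < n) z i ^+ 2.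

Lemma cmeasurable_ee n (z : 'I_n -> R[i]) : cmeasurable (ee z).
Proof.
exact: (@cmeasurable_cprod _ n (fun i (y : R) => cexp (z i * y%:C))
  (fun i => cmeasurable_cexp (cmeasurable_lin (z i)))).
Qed.

Lemma heat_semigroup0 n rho c (f : E n -> R[i]) : heat_semigroup rho c 0 f = f.
Proof. by rewrite /heat_semigroup eqxx. Qed.

Lemma heat_semigroupE n rho c (t : R) (f : E n -> R[i]) x : 0 < t ->
  heat_semigroup rho c t f x = (expR (t * (c - rho ^+ 2)))%:C *
    cintegral (lebn n) (fun y => (heat_kernel t (esub x y))%:C * f y).
Proof.
by move=> t0; rewrite /heat_semigroup gt_eqF// -mulrN opprB.
Qed.

(** The kernel is a product of Gaussians, so that the integral factors into
one-dimensional transforms. *)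
Lemma heat_semigroup_ee n rho c (t : R) (z : 'I_n -> R[i]) : 0 <= t ->
  heat_semigroup rho c t (ee z) =
  fun x => cexp (t%:C * eigenvalue_of rho c z) * ee z x.
Proof.
rewrite le_eqVlt => /predU1P[<-|t0]; apply/funext => x.
  by rewrite heat_semigroup0 mul0r cexp0 mul1r.
rewrite heat_semigroupE//.
under eq_fun do rewrite heat_kernelE// rmorph_prod -big_split/=.
rewrite (@cintegral_prod _ n (fun i (y : measurableTypeR R) =>
  (gauss t (tnth x i - y))%:C * cexp (z i * y%:C))); last 2 first.
- by move=> i; exact: cmeasurable_gauss_cexp.
- move=> i; under [X in intble _ X]eq_fun do rewrite normc_gauss_cexp.
  exact: intble_gauss_expR.
under eq_bigr do rewrite cintegral_gauss_cexp// cexpD.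
rewrite big_split/= mulrA; congr (_ * _).
rewrite /eigenvalue_of [in RHS]mulrDr cexpD mulr_sumr cexp_sum; congr (_ * _).
by apply: complexP; rewrite ?(Re_cexp, Im_cexp) -rmorphM/= ?cos0 ?sin0 ?mulr1 ?mulr0.
Qed.

End HeatKernel.

(** * Functions dominated by exp (b |x|_1) *)

Lemma intble_ge0 {R : realType} {d} {T : measurableType d} (mu : {measure set T -> \bar R})
  (h : T -> R) : measurable_fun setT h -> (forall x, 0 <= h x) ->
  (\int[mu]_x (h x)%:E < +oo)%E -> intble mu h.
Proof.
move=> mh h0 fin; apply/integrableP; split; first exact/measurable_EFinP.
rewrite (eq_integral (fun x => (h x)%:E))// => x _ /=.
by rewrite ger0_norm.
Qed.

Section Domination.
Context {R : realType}.
Local Notation leb := (@lebesgue_measure R).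
Local Notation lebn := (@lebesgue_euclidean R).
Local Notation E n := (euclidean R n).
Notation normc := Normc.normc.

(** Built from the l1 norm, it factors over the coordinates as the heat kernel
does. *)
Definition Phi n (b : R) (x : E n) : R := \prod_(i < n) expR (b * `|tnth x i : R|).

Lemma Phi_gt0 n b (x : E n) : 0 < Phi b x.
Proof. by apply: prodr_gt0 => i _; exact: expR_gt0. Qed.

Lemma Phi_ge0 n b (x : E n) : 0 <= Phi b x.
Proof. exact/ltW/Phi_gt0. Qed.

Lemma measurable_expR_norm (b : R) : measurable_fun setT (fun y : R => expR (b * `|y|)).
Proof.
by apply: measurableT_comp => //; apply: measurable_funM => //; exact: measurableT_comp.
Qed.

Lemma measurable_Phi n b : measurable_fun setT (@Phi n b).
Proof. exact: (measurable_cprod (fun i : 'I_n => measurable_expR_norm b)). Qed.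

Lemma PhiE n b (x : E n) : Phi b x = expR (b * \sum_(i < n) `|tnth x i : R|).
Proof. by rewrite /Phi -expR_sum mulr_sumr. Qed.

Lemma PhiD n a b (x : E n) : Phi (a + b) x = Phi a x * Phi b x.
Proof. by rewrite !PhiE mulrDl expRD. Qed.

Lemma le_expR_norm (a b y : R) : `|a| <= b -> expR (a * y) <= expR (b * `|y|).
Proof.
move=> ab; rewrite ler_expR (le_trans (ler_norm _))// normrM ler_wpM2r//.
Qed.

Lemma expR_norm_le (b y : R) : expR (b * `|y|) <= expR (b * y) + expR (- b * y).
Proof.
by have [y0|y0] := leP 0 y; [rewrite ger0_norm ?lerDl ?expR_ge0|
  rewrite ltr0_norm// mulrN -mulNr lerDr expR_ge0].
Qed.

Lemma integral_gauss_norm_le (t b x : R) : 0 < t ->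
  (\int[leb]_y (gauss t (x - y) * expR (b * `|y|))%:E <=
   (2 * expR (t * b ^+ 2) * expR (`|b| * `|x|))%:E)%E.
Proof.
move=> t0; apply: le_trans (_ : \int[leb]_y ((gauss t (x - y) * expR (b * y))%:E +
    (gauss t (x - y) * expR (- b * y))%:E) <= _)%E.
  apply: ge0_le_integral => //.
  - by move=> y _; rewrite lee_fin mulr_ge0 ?gauss_ge0 ?expR_ge0.
  - apply/measurable_EFinP; apply: measurable_funM; [exact: measurable_gauss|exact: measurable_expR_norm].
  - by apply: emeasurable_funD; apply/measurable_EFinP; apply: measurable_funM;
      try exact: measurable_gauss; apply: measurableT_comp => //; exact: measurable_funM.
  - by move=> y _; rewrite -EFinD lee_fin -mulrDr ler_wpM2l ?gauss_ge0 ?expR_norm_le.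
have m a : measurable_fun setT (fun y : R => (gauss t (x - y) * expR (a * y))%:E).
  by apply/measurable_EFinP; apply: measurable_funM; [exact: measurable_gauss|
     apply: measurableT_comp => //; exact: measurable_funM].
rewrite ge0_integralD//; do ?[exact: m |
  by move=> y _; rewrite lee_fin mulr_ge0 ?gauss_ge0 ?expR_ge0].
rewrite !integral_gauss_expR// -EFinD lee_fin !expRD sqrrN -mulrDr.
rewrite (mulrC 2) -mulrA ler_wpM2l ?expR_ge0// mulr2n mulrDl !mul1r.
by rewrite lerD// le_expR_norm// normrN.
Qed.

Lemma heat_Phi_prod n (t b : R) (x : E n) : 0 < t ->
  (\int[lebn n]_y (heat_kernel t (esub x y) * Phi b y)%:E =
   \prod_(i < n) \int[leb]_s (gauss t ((tnth x i : R) - s) * expR (b * `|s|))%:E)%E.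
Proof.
move=> t0; rewrite -ge0_integral_prod.
- by apply: eq_integral => y _; rewrite heat_kernelE// /Phi -big_split.
- by move=> i; apply: measurable_funM; [exact: measurable_gauss|exact: measurable_expR_norm].
- by move=> i s; rewrite mulr_ge0 ?gauss_ge0 ?expR_ge0.
Qed.

Lemma prode_le n (F : 'I_n -> \bar R) (G : 'I_n -> R) :
  (forall i, 0 <= F i)%E -> (forall i, F i <= (G i)%:E)%E ->
  (\prod_(i < n) F i <= (\prod_(i < n) G i)%:E)%E.
Proof.
move=> F0 FG; have G0 i : 0 <= G i by rewrite -lee_fin (le_trans (F0 i)).
suff /andP[] : (0 <= \prod_(i < n) F i <= (\prod_(i < n) G i)%:E)%E by [].
elim/big_rec2: _ => [|i y z _ /andP[y0 yz]]; first by rewrite lee_fin ler01 lexx.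
by rewrite mule_ge0//= EFinM lee_pmul.
Qed.

Lemma heat_Phi_le n (t b : R) (x : E n) : 0 < t -> 0 <= b ->
  (\int[lebn n]_y (heat_kernel t (esub x y) * Phi b y)%:E <=
   ((2 * expR (t * b ^+ 2)) ^+ n * Phi b x)%:E)%E.
Proof.
move=> t0 b0; rewrite heat_Phi_prod//.
have -> : (2 * expR (t * b ^+ 2)) ^+ n * Phi b x =
    \prod_(i < n) (2 * expR (t * b ^+ 2) * expR (b * `|tnth x i : R|)).
  by rewrite big_split/= prodr_const card_ord.
apply: prode_le => i.
  by apply: integral_ge0 => s _; rewrite lee_fin mulr_ge0 ?gauss_ge0 ?expR_ge0.
by have := integral_gauss_norm_le b (tnth x i) t0; rewrite (ger0_norm b0).
Qed.

Lemma measurable_heat_kernel n (t : R) (x : E n) : 0 < t ->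
  measurable_fun setT (fun y : E n => heat_kernel t (esub x y)).
Proof.
move=> t0; under eq_fun do rewrite heat_kernelE//.
exact: (@measurable_cprod _ n (fun i s => gauss t ((tnth x i : R) - s)) (fun i => measurable_gauss t0 _)).
Qed.

Lemma intble_heat_Phi n (t b : R) (x : E n) : 0 < t -> 0 <= b ->
  intble (lebn n) (fun y => heat_kernel t (esub x y) * Phi b y).
Proof.
move=> t0 b0; apply: intble_ge0.
- by apply: measurable_funM; [exact: measurable_heat_kernel|exact: measurable_Phi].
- by move=> y; rewrite mulr_ge0 ?heat_kernel_ge0 ?Phi_ge0.
- by rewrite (le_lt_trans (heat_Phi_le x t0 b0))// ltry.
Qed.

Section Dominated.
Variables (n : nat) (rho c b : R).
Hypothesis b_ge0 : 0 <= b.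
Local Notation T := (@heat_semigroup R n rho c).

Definition dominated (A : R) (f : E n -> R[i]) : Prop :=
  cmeasurable f /\ forall x, normc (f x) <= A * Phi b x.

Definition heat_const (t : R) : R :=
  2 * expR (t * (c - rho ^+ 2)) * (2 * expR (t * b ^+ 2)) ^+ n.

Lemma heat_const_gt0 t : 0 < heat_const t.
Proof. by rewrite /heat_const !mulr_gt0 ?exprn_gt0 ?mulr_gt0 ?expR_gt0. Qed.

Lemma cmeasurable_kernel_mul t f (x : E n) : 0 < t -> cmeasurable f ->
  cmeasurable (fun y => (heat_kernel t (esub x y))%:C * f y).
Proof.
by move=> t0 mf; apply: cmeasurableM => //; apply: cmeasurable_real; exact: measurable_heat_kernel.
Qed.

Lemma normc_kernel_mul t f A (x y : E n) : dominated A f ->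
  normc ((heat_kernel t (esub x y))%:C * f y) <= A * (heat_kernel t (esub x y) * Phi b y).
Proof.
move=> [_ fA]; rewrite Normc.normcM normc_real ger0_norm ?heat_kernel_ge0//.
by rewrite mulrCA ler_wpM2l ?heat_kernel_ge0.
Qed.

Lemma cintegrable_kernel_mul t f A (x : E n) : 0 < t -> dominated A f ->
  cintegrable (lebn n) (fun y => (heat_kernel t (esub x y))%:C * f y).
Proof.
move=> t0 df; apply: (cintegrable_le (cmeasurable_kernel_mul x t0 df.1) (fun y => normc_kernel_mul t x y df)).
by apply: intbleZ; exact: intble_heat_Phi.
Qed.

Lemma heat_normc_le t f A : 0 <= t -> 0 <= A -> dominated A f ->
  forall x, normc (T t f x) <= heat_const t * A * Phi b x.
Proof.
rewrite le_eqVlt => /predU1P[<-|t0] A0 df x.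
  rewrite heat_semigroup0 (le_trans (df.2 x))// ler_wpM2r ?Phi_ge0//.
  rewrite ler_peMl// /heat_const !mul0r expR0 !mulr1 -exprS.
  by rewrite -natrX ler1n expn_gt0.
rewrite heat_semigroupE// Normc.normcM normc_real ger0_norm ?expR_ge0//.
have mk : measurable_fun setT (fun y : E n => heat_kernel t (esub x y) * Phi b y).
  by apply: measurable_funM; [exact: measurable_heat_kernel|exact: measurable_Phi].
have k0 (y : E n) : 0 <= heat_kernel t (esub x y) * Phi b y.
  by rewrite mulr_ge0 ?heat_kernel_ge0 ?Phi_ge0.
rewrite [leRHS](_ : _ = expR (t * (c - rho ^+ 2)) *
    (2 * (A * ((2 * expR (t * b ^+ 2)) ^+ n * Phi b x)))); last by rewrite /heat_const; ring.
rewrite ler_wpM2l ?expR_ge0// -lee_fin.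
apply: le_trans (normc_cintegral_le (lebn n) (cmeasurable_kernel_mul x t0 df.1) _
  (fun y => normc_kernel_mul t x y df)) _; first exact: measurable_funM.
rewrite EFinM lee_pmul ?lee_fin//.
  by apply: integral_ge0 => y _; rewrite lee_fin mulr_ge0.
under eq_integral do rewrite EFinM.
rewrite ge0_integralZl ?lee_fin//; do ?[by apply/measurable_EFinP; exact: mk |
  by move=> y _; rewrite lee_fin; exact: k0].
by rewrite EFinM lee_pmul ?lee_fin// ?heat_Phi_le//; apply: integral_ge0 => y _; rewrite lee_fin.
Qed.

Lemma heatD t f g A B : 0 <= t -> dominated A f -> dominated B g ->
  T t (fun x => f x + g x) = fun x => T t f x + T t g x.
Proof.
rewrite le_eqVlt => /predU1P[<-|t0] df dg; apply/funext => x; first by rewrite !heat_semigroup0.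
rewrite !heat_semigroupE// -mulrDr -cintegralD; last 2 first.
- exact: cintegrable_kernel_mul df.
- exact: cintegrable_kernel_mul dg.
by congr (_ * _); congr cintegral; apply/funext => y; rewrite mulrDr.
Qed.

Lemma heatZ t f A (z : R[i]) : 0 <= t -> dominated A f ->
  T t (fun x => z * f x) = fun x => z * T t f x.
Proof.
rewrite le_eqVlt => /predU1P[<-|t0] df; apply/funext => x; first by rewrite !heat_semigroup0.
rewrite !heat_semigroupE// [RHS]mulrCA -(cintegralZ z (cintegrable_kernel_mul x t0 df)).
by congr (_ * _); congr cintegral; apply/funext => y; rewrite mulrCA.
Qed.

Lemma dominatedZ f A (z : R[i]) : dominated A f -> dominated (normc z * A) (fun x => z * f x).
Proof.
move=> [mf fA]; split; first by apply: cmeasurableM => //; exact: cmeasurable_cst.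
by move=> x; rewrite Normc.normcM -mulrA ler_wpM2l ?normc_ge0.
Qed.

End Dominated.
End Domination.

(** * Measurability of the heat flow *)

Section HeatMeasurable.
Context {R : realType}.
Local Notation lebn := (@lebesgue_euclidean R).
Local Notation E n := (euclidean R n).

Lemma measurable_Rintegral_param d1 d2 (T1 : measurableType d1) (T2 : measurableType d2)
    (mu : {sigma_finite_measure set T2 -> \bar R}) (F : T1 * T2 -> R) :
  measurable_fun setT F -> measurable_fun setT (fun x => \int[mu]_y F (x, y)).
Proof.
move=> mF; apply: measurableT_comp => //.
under eq_fun do rewrite integralE.
have mFE : measurable_fun setT (EFin \o F) by exact/measurable_EFinP.
apply: emeasurable_funB.
  have := measurable_fun_fubini_tonelli_F (m2 := mu) _ (measurable_funepos mFE) (funepos_ge0 _).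
  by congr measurable_fun; apply/funext => x; apply: eq_integral => y _; rewrite !funeposE.
have := measurable_fun_fubini_tonelli_F (m2 := mu) _ (measurable_funeneg mFE) (funeneg_ge0 _).
by congr measurable_fun; apply/funext => x; apply: eq_integral => y _; rewrite !funenegE.
Qed.

Lemma measurable_heat_kernel2 n (t : R) : 0 < t ->
  measurable_fun setT (fun z : E n * E n => heat_kernel t (esub z.1 z.2)).
Proof.
move=> t0; under eq_fun do rewrite heat_kernelE//.
apply: measurable_prod => i _.
have mg : measurable_fun setT (gauss t : R -> R).
  have := measurable_gauss t0 0; under eq_fun do rewrite sub0r.
  move=> m; have := measurableT_comp m (@oppr_measurable R setT); congr measurable_fun.
  by apply/funext => y /=; rewrite opprK.
apply: measurableT_comp => //; apply: measurable_funB.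
- apply: (@measurableT_comp _ _ _ _ _ _ (fun x : E n => tnth x i)) => //; exact: measurable_tnth.
- apply: (@measurableT_comp _ _ _ _ _ _ (fun x : E n => tnth x i)) => //; exact: measurable_tnth.
Qed.

Lemma cmeasurable_heat n rho c (t : R) (f : E n -> R[i]) : 0 <= t -> cmeasurable f ->
  cmeasurable (heat_semigroup rho c t f).
Proof.
rewrite le_eqVlt => /predU1P[<-|t0] [f1 f2]; first by rewrite heat_semigroup0.
have -> : heat_semigroup rho c t f = fun x => (expR (t * (c - rho ^+ 2)))%:C *
    cintegral (lebn n) (fun y => (heat_kernel t (esub x y))%:C * f y).
  by apply/funext => x; exact: heat_semigroupE.
apply: cmeasurableM; first exact: cmeasurable_cst.
have mk (h : E n -> R) : measurable_fun setT h ->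
    measurable_fun setT (fun z : E n * E n => heat_kernel t (esub z.1 z.2) * h z.2).
  by move=> mh; apply: measurable_funM; [exact: measurable_heat_kernel2|exact: measurableT_comp].
split.
  have := measurable_Rintegral_param (lebn n) (mk _ f1); congr measurable_fun.
  by apply/funext => x; apply: eq_Rintegral => y _; rewrite ReZ.
have := measurable_Rintegral_param (lebn n) (mk _ f2); congr measurable_fun.
by apply/funext => x; apply: eq_Rintegral => y _; rewrite ImZ.
Qed.

End HeatMeasurable.

(** * Analytic continuation in the exponents *)

Section AnalyticContinuation.
Context {R : realType}.
Local Notation E n := (euclidean R n).
Notation Re := complex.Re.
Notation Im := complex.Im.
Notation normc := Normc.normc.
Variables (n : nat) (b : R).
Implicit Types (f g F : E n -> R[i]) (M : set (E n -> R[i])) (Z : set R[i]).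

Definition Phi_near (e : R) f g : Prop := forall x, normc (f x - g x) <= e * Phi b x.

(** The closed subspaces for the norm sup |f| / Phi b. *)
Definition Phi_closed M : Prop := [/\ M (fun=> 0),
  (forall f g, M f -> M g -> M (fun x => f x + g x)),
  (forall (a : R[i]) f, M f -> M (fun x => a * f x)) &
  (forall f, (forall e, 0 < e -> exists2 g, M g & Phi_near e f g) -> M f)].

Lemma Phi_closed_sum M k (a : 'I_k -> R[i]) (f : 'I_k -> E n -> R[i]) : Phi_closed M ->
  (forall i, M (f i)) -> M (fun x => \sum_(i < k) a i * f i x).
Proof.
move=> [M0 MD MZ _] Mf; elim: k a f Mf => [|k IH] a f Mf.
  by under eq_fun do rewrite big_ord0.
by under eq_fun do rewrite big_ord_recl; apply: MD; [exact: MZ|exact: IH].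
Qed.

Definition clusters_at Z (z0 : R[i]) : Prop :=
  forall e : R, 0 < e -> exists z, [/\ Z z, z != z0 & normc (z - z0) < e].

Lemma powr_fact_le (r y : R) k : 0 < r -> 0 <= y ->
  y ^+ k * k`!%:R^-1 <= r^-1 ^+ k * expR (r * y).
Proof.
move=> r0 y0; have ry0 : 0 <= r * y by rewrite (mulr_ge0 (ltW r0) y0).
have -> : y ^+ k = r^-1 ^+ k * (r * y) ^+ k by rewrite -exprMn mulKf ?gt_eqF.
rewrite -mulrA ler_wpM2l ?exprn_ge0 ?invr_ge0 ?(ltW r0)//.
apply: le_trans (_ : series (exp_coeff (r * y)) k.+1 <= _).
  rewrite /series/= big_nat_recr//= lerDr sumr_ge0// => i _.
  by rewrite exp_coeff_ge0.
rewrite -[leRHS]/(limn (series (exp_coeff (r * y)))).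
apply: nondecreasing_cvgn_le; last exact: is_cvg_series_exp_coeff.
by apply: nondecreasing_series => i _ _; exact: exp_coeff_ge0.
Qed.

Section OneCoordinate.
Variables (M : set (E n -> R[i])) (F : E n -> R[i]) (j : 'I_n) (a r : R).
Hypothesis Mc : Phi_closed M.
Hypothesis r_gt0 : 0 < r.
Hypothesis F_le : forall x, normc (F x) * expR ((a + 2 * r) * `|tnth x j : R|) <= Phi b x.
Local Notation y x := ((tnth x j : R)%:C : R[i]).

Let term (z0 : R[i]) (k : nat) x := F x * cexp (z0 * y x) * ((k`!%:R^-1)%:C * y x ^+ k).

Let remainder_le (z0 h : R[i]) k x : `|Re z0| <= a -> normc h <= r ->
  normc (F x * cexp ((z0 + h) * y x) - \sum_(i < k) h ^+ i * term z0 i x) <=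
  (normc h / r) ^+ k * Phi b x.
Proof.
move=> z0a hr; set t : R := tnth x j.
have -> : F x * cexp ((z0 + h) * y x) - \sum_(i < k) h ^+ i * term z0 i x =
    F x * (cexp (z0 * y x) * (cexp (h * y x) - cexp_taylor k (h * y x))).
  rewrite mulrDl cexpD mulrBr mulrBr; congr (_ - _).
  rewrite mulrA /cexp_taylor mulr_sumr; apply: eq_bigr => i _.
  by rewrite /term exprMn; ring.
rewrite Normc.normcM [normc (cexp _ * _)]Normc.normcM normc_cexp.
apply: (@le_trans _ _ (normc (F x) * (expR (a * `|t|) * ((normc h * `|t|) ^+ k * k`!%:R^-1 * expR (r * `|t|))))).
  rewrite ler_wpM2l ?normc_ge0// ler_pM ?expR_ge0 ?normc_ge0//.
    by rewrite ReM/= mulr0 subr0; exact: le_expR_norm.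
  rewrite (le_trans (cexp_taylor_le _ _))// Normc.normcM normc_real.
  rewrite ler_wpM2l ?mulr_ge0 ?exprn_ge0 ?mulr_ge0 ?normc_ge0 ?invr_ge0//.
  by rewrite ler_expR ler_wpM2r.
have := powr_fact_le k r_gt0 (normr_ge0 t) => pf.
apply: (@le_trans _ _ (normc (F x) * (expR (a * `|t|) * (normc h ^+ k * (r^-1 ^+ k * expR (r * `|t|)) * expR (r * `|t|))))).
  rewrite ler_wpM2l ?normc_ge0// ler_wpM2l ?expR_ge0// ler_wpM2r ?expR_ge0//.
  by rewrite exprMn -mulrA ler_wpM2l ?exprn_ge0 ?normc_ge0.
have := F_le x; rewrite -/t.
have -> : (a + 2 * r) * `|t| = a * `|t| + (r * `|t| + r * `|t|) by ring.
rewrite !expRD => Fx.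
rewrite [leLHS](_ : _ = (normc h / r) ^+ k * (normc (F x) * (expR (a * `|t|) * (expR (r * `|t|) * expR (r * `|t|))))).
  by rewrite ler_wpM2l// exprn_ge0// divr_ge0 ?normc_ge0 ?ltW.
by rewrite exprMn; ring.
Qed.

(** The Taylor coefficients at z0 are, one after the other, limits of the Taylor
remainders divided by powers of z - z0, at points z of Z that approach z0. *)
Let term_in Z (z0 : R[i]) k : `|Re z0| <= a -> clusters_at Z z0 ->
  (forall z, Z z -> M (fun x => F x * cexp (z * y x))) -> M (term z0 k).
Proof.
move=> z0a acc MZ; have [_ Madd Mscale Mlim] := Mc.
elim/ltn_ind: k => k IH; apply: (Mlim) => e e0.
have e'0 : 0 < Num.min r (e * r ^+ k.+1).
  by rewrite lt_min r_gt0 mulr_gt0 ?exprn_gt0.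
have [z [Zz zz0]] := acc _ e'0; rewrite lt_min => /andP[hr he].
set h := z - z0 in hr he; have h0 : h != 0 by rewrite subr_eq0.
have zE : z = z0 + h by rewrite addrC subrK.
exists (fun x => (h ^+ k)^-1 * (F x * cexp (z * y x) + (-1) * \sum_(i < k) h ^+ i * term z0 i x)).
  apply: (Mscale); apply: (Madd); first exact: MZ.
  apply: (Mscale); apply: Phi_closed_sum => // i; exact: IH.
move=> x.
have hk : h ^+ k != 0 by rewrite expf_neq0.
have -> : term z0 k x - (h ^+ k)^-1 * (F x * cexp (z * y x) + (-1) * \sum_(i < k) h ^+ i * term z0 i x)
  = - (h ^+ k)^-1 * (F x * cexp ((z0 + h) * y x) - \sum_(i < k.+1) h ^+ i * term z0 i x).
  by rewrite big_ord_recr/= -zE; field.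
rewrite Normc.normcM normcN Normc.normcV normcX.
have nh0 : 0 < normc h.
  by rewrite lt_neqAle normc_ge0 andbT eq_sym; apply: contra h0 => /eqP/Normc.eq0_normc ->.
apply: le_trans (ler_wpM2l _ (remainder_le _ _ z0a (ltW hr))) _.
  by rewrite invr_ge0 exprn_ge0 ?ltW.
rewrite mulrA ler_wpM2r ?Phi_ge0// exprMn exprS mulrA -mulrA mulrA.
rewrite mulrCA mulVf ?mulr1 ?expf_neq0 ?gt_eqF//.
by rewrite exprVn ler_pdivrMr ?exprn_gt0// ltW.
Qed.

(** The Taylor series at z0 converges on the disc, in the norm sup |f| / Phi b. *)
Let disc_in Z (z0 z : R[i]) : `|Re z0| <= a -> clusters_at Z z0 ->
  (forall z, Z z -> M (fun x => F x * cexp (z * y x))) ->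
  normc (z - z0) < r -> M (fun x => F x * cexp (z * y x)).
Proof.
move=> z0a acc MZ; rewrite -{2}(subrK z0 z) [z - z0 + z0]addrC.
move: (z - z0) => h hr; have [_ Madd Mscale Mlim] := Mc.
apply: (Mlim) => e e0.
have q1 : `|normc h / r| < 1.
  by rewrite ger0_norm ?divr_ge0 ?normc_ge0 ?(ltW r_gt0)// ltr_pdivrMr// mul1r.
have /cvgrPdist_lt/(_ _ e0)[N _ /(_ N (leqnn N))/=] := cvg_geometric 1 q1.
rewrite /geometric/= mul1r sub0r normrN ger0_norm; last first.
  by rewrite exprn_ge0// divr_ge0 ?normc_ge0 ?ltW.
move=> qe; exists (fun x => \sum_(i < N) h ^+ i * term z0 i x).
  by apply: Phi_closed_sum => // i; exact: (term_in _ z0a acc MZ).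
move=> x; apply: le_trans (remainder_le _ _ z0a (ltW hr)) _.
by rewrite ler_wpM2r ?Phi_ge0 ?ltW.
Qed.

(** A vertical line is covered by discs of the same radius, each of them centered
in the part reached before, so that the strip grows by r / 2 at every step. *)
Lemma continuation_in Z (z0 z : R[i]) : `|Re z0| <= a -> clusters_at Z z0 ->
  (forall z, Z z -> M (fun x => F x * cexp (z * y x))) ->
  normc (z - z0) < r \/ Re z = Re z0 -> M (fun x => F x * cexp (z * y x)).
Proof.
move=> z0a acc MZ [zr|zz0].
  exact: disc_in acc MZ zr.
pose w (s : R) : R[i] := z0 + (0 +i* s).
have normw s t : normc (w s - w t) = `|s - t|.
  by rewrite /w opprD addrACA subrr add0r normcE/= subrr expr0n add0r sqrtr_sqr.
have Rew s : `|Re (w s)| <= a by rewrite /w ReD/= addr0.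
have w0 : w 0 = z0 by rewrite /w addr0.
have strip m s : `|s| < m.+1%:R * (r / 2) -> M (fun x => F x * cexp (w s * y x)).
  elim: m s => [|m IH] s sm.
    apply: (disc_in z0a acc MZ); rewrite -w0 normw subr0.
    by rewrite (lt_trans sm)// mul1r ltr_pdivrMr// ltr_pMr// ltr1n.
  pose q : R := m.+1%:R / m.+2%:R.
  have sq : `|s * q| < m.+1%:R * (r / 2).
    rewrite normrM (ger0_norm (_ : 0 <= q)) ?divr_ge0// /q mulrCA ltr_pM2l//.
    by rewrite ltr_pdivrMr// mulrC.
  apply: (@disc_in [set w t | t in [set t | `|t| < m.+1%:R * (r / 2)]] (w (s * q))) => //.
  - move=> e e0; pose d := m.+1%:R * (r / 2) - `|s * q|.
    have d0 : 0 < d by rewrite subr_gt0.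
    pose u := Num.min e d / 2.
    have u0 : 0 < u by rewrite divr_gt0// lt_min e0.
    have [ue ud] : u < e /\ u < d.
      by apply/andP; rewrite -lt_min ltr_pdivrMr// ltr_pMr ?ltr1n// lt_min e0.
    exists (w (s * q + u)); split.
    + exists (s * q + u) => //=; rewrite (le_lt_trans (ler_normD _ _))// (ger0_norm (ltW u0)).
      by rewrite addrC -ltrBrDr.
    + by apply/eqP => ww; have := normw (s * q + u) (s * q);
        rewrite ww subrr Normc.normc0 addrC addKr ger0_norm ?(ltW u0)// => /eqP; rewrite lt_eqF.
    + by rewrite normw addrC addKr ger0_norm// ltW.
  - by move=> z' [t tm <-]; exact: IH.
  - rewrite normw (_ : s - s * q = s / m.+2%:R); last first.
      by rewrite /q; field.
    rewrite normrM [X in _ * X]ger0_norm ?invr_ge0// ltr_pdivrMr//.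
    apply: lt_le_trans sm _; rewrite mulrCA ler_wpM2l ?(ltW r_gt0)//.
    by rewrite ler_pdivrMr// ler_peMr// ler1n.
have -> : z = w (Im z - Im z0).
  by apply: complexP; rewrite /w ?(ReD, ImD)/= ?addr0// addrC subrK.
set s := Im z - Im z0.
have s0 : 0 <= `|s| / (r / 2) by rewrite divr_ge0// divr_ge0// ltW.
apply: (strip (Num.bound (`|s| / (r / 2)))); rewrite -ltr_pdivrMr ?divr_gt0//.
by rewrite (lt_le_trans (archi_boundP s0))// ler_nat.
Qed.

End OneCoordinate.

Definition fupd (z : 'I_n -> R[i]) (j : 'I_n) (w : R[i]) : 'I_n -> R[i] :=
  fun i => if i == j then w else z i.

Lemma ee_fupd (z : 'I_n -> R[i]) j w (x : E n) : ee (fupd z j w) x =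
  (\prod_(i < n | i != j) cexp (z i * (tnth x i : R)%:C)) * cexp (w * (tnth x j : R)%:C).
Proof.
rewrite /ee (bigD1 j)//= /fupd eqxx mulrC; congr (_ * _).
by apply: eq_bigr => i /negbTE ->.
Qed.

(** One coordinate at a time, the exponents may be moved from a set
accumulating at z0 to the disc around z0 and to the vertical line through z0. *)
Lemma ee_continuation M Z (z0 : R[i]) (r : R) : Phi_closed M -> 0 < r ->
  `|Re z0| + 2 * r <= b -> (forall z, Z z -> `|Re z| <= b) -> clusters_at Z z0 ->
  (forall z : 'I_n -> R[i], (forall i, Z (z i)) -> M (ee z)) ->
  forall z : 'I_n -> R[i], (forall i, normc (z i - z0) < r \/ Re (z i) = Re z0) -> M (ee z).
Proof.
move=> Mc r0 z0b Zb acc MZ.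
pose G w := normc (w - z0) < r \/ Re w = Re z0.
have Gb w : G w -> `|Re w| <= b.
  move=> [wr|->]; last by rewrite (le_trans _ z0b)// lerDl mulr_ge0// ltW.
  rewrite (le_trans _ z0b)// -[w](subrK z0) ReD (le_trans (ler_normD _ _))// addrC lerD2l.
  by rewrite (le_trans (le_Re_normc _))// (le_trans (ltW wr))// ler_peMl ?ltW// ltr1n.
suff H k : (k <= n)%N -> forall z : 'I_n -> R[i], (forall i : 'I_n, (i < k)%N -> G (z i)) ->
    (forall i : 'I_n, (k <= i)%N -> Z (z i)) -> M (ee z).
  move=> z Gz; apply: (H n) => // i; first by move=> _; exact: Gz.
  by rewrite leqNgt ltn_ord.
elim: k => [_ z _ Zz|k IH kn z Gz Zz]; first by apply: MZ => i; exact: Zz.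
pose j := Ordinal kn.
pose F (x : E n) : R[i] := \prod_(i < n | i != j) cexp (z i * (tnth x i : R)%:C).
have zE x : ee z x = F x * cexp (z j * (tnth x j : R)%:C).
  by rewrite /ee (bigD1 j)//= mulrC.
have -> : ee z = fun x => F x * cexp (z j * (tnth x j : R)%:C) by apply/funext.
apply: (@continuation_in M F j `|Re z0| r Mc r0 _ Z z0 (z j) (lexx _) acc).
- move=> x; rewrite /F /Phi [leRHS](bigD1 j)//= mulrC ler_pM ?expR_ge0 ?normc_ge0//.
    by rewrite ler_expR ler_wpM2r.
  rewrite normc_prod; apply: ler_prod => i ij; apply/andP; split; first exact: normc_ge0.
  rewrite normc_cexp ReM/= mulr0 subr0 le_expR_norm//.
  by have [ik|ki] := ltnP i k.+1; [exact: Gb (Gz _ ik)|exact: Zb (Zz _ ki)].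
- move=> w Zw; have -> : (fun x => F x * cexp (w * (tnth x j : R)%:C)) = ee (fupd z j w).
    by apply/funext => x; rewrite ee_fupd.
  apply: IH => [|i ik|i ki]; first exact: ltnW.
    by rewrite /fupd; case: eqP => [e|_]; [move: ik; rewrite e ltnn|apply: Gz; rewrite ltnS ltnW].
  rewrite /fupd; case: eqP => // /eqP ij; apply: Zz.
  by rewrite ltn_neqAle ki andbT; apply: contra ij => /eqP ki'; apply/eqP/val_inj.
- exact: Gz.
Qed.

End AnalyticContinuation.

(** * Weighted p-th powers *)

Section WeightedPower.
Context {R : realType} {d : measure_display} {T : measurableType d}.
Variables (mu : {measure set T -> \bar R}) (p : R) (v : T -> R).
Hypothesis p_gt0 : 0 < p.
Hypothesis mv : measurable_fun setT v.
Hypothesis v_ge0 : forall x, 0 <= v x.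
Implicit Types (f g : T -> R[i]) (h : T -> R).
Notation normc := Normc.normc.

Definition pint f : \bar R := (\int[mu]_x (normc (f x) `^ p * v x)%:E)%E.

Lemma pintE f : pint f = (\int[mu]_x (normc (f x) `^ p * v x)%:E)%E.
Proof. by []. Qed.

(** Wrapped in an inductive type, as pfinite below, so that unification does not
unfold the integrals. *)
Variant psmall f (e : R) : Prop := Psmall of (pint f < e%:E)%E.
Variant pfinite f : Prop := Pfinite of (pint f < +oo)%E.

Lemma psmallE f e : psmall f e <-> (pint f < e%:E)%E.
Proof. by split=> [[]|]. Qed.

Lemma pfiniteE f : pfinite f <-> (pint f < +oo)%E.
Proof. by split=> [[]|]. Qed.

Lemma pint_ge0 f : (0 <= pint f)%E.
Proof. by apply: integral_ge0 => x _; rewrite lee_fin mulr_ge0 ?powR_ge0. Qed.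

Lemma measurable_powRp h : measurable_fun setT h -> measurable_fun setT (fun x => h x `^ p).
Proof. by move=> mh; exact: (measurableT_comp (measurable_powR p) mh). Qed.

Lemma measurable_pint f : cmeasurable f ->
  measurable_fun setT (fun x => (normc (f x) `^ p * v x)%:E).
Proof.
move=> mf; apply/measurable_EFinP; apply: measurable_funM => //.
by apply: measurable_powRp; exact: measurable_normc.
Qed.

Lemma le_pint_real f h : cmeasurable f -> measurable_fun setT h ->
  (forall x, normc (f x) <= h x) ->
  (pint f <= \int[mu]_x (h x `^ p * v x)%:E)%E.
Proof.
move=> mf mh fh; apply: ge0_le_integral => //.
- by move=> x _; rewrite lee_fin mulr_ge0 ?powR_ge0.
- exact: measurable_pint.
- by apply/measurable_EFinP; apply: measurable_funM => //; exact: measurable_powRp.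
- move=> x _; rewrite lee_fin ler_wpM2r// ge0_ler_powR ?nnegrE ?normc_ge0//; first exact: ltW.
  by rewrite (le_trans _ (fh x)) ?normc_ge0.
Qed.

Lemma le_pint f g : cmeasurable f -> cmeasurable g ->
  (forall x, normc (f x) <= normc (g x)) -> (pint f <= pint g)%E.
Proof. by move=> mf mg; apply: le_pint_real => //; exact: measurable_normc. Qed.

Lemma powR_addr_le (a b : R) : 0 <= a -> 0 <= b ->
  (a + b) `^ p <= 2 `^ p * (a `^ p + b `^ p).
Proof.
move=> a0 b0; have m0 : 0 <= Num.max a b by rewrite le_max a0.
apply: (@le_trans _ _ ((2 * Num.max a b) `^ p)).
  rewrite ge0_ler_powR ?nnegrE ?addr_ge0 ?mulr_ge0//; first exact: ltW.
  by rewrite mulr_natl mulr2n lerD// le_max lexx ?orbT.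
rewrite powRM// ler_wpM2l ?powR_ge0//.
by rewrite /Num.max; case: ifP => _; rewrite ?lerDl ?lerDr powR_ge0.
Qed.

(** A quasi-triangle inequality, with the factor 2^p, is as good as Minkowski's for
density arguments. *)
Lemma pintD_le f g : cmeasurable f -> cmeasurable g ->
  (pint (fun x => f x + g x)%R <= (2 `^ p)%:E * (pint f + pint g))%E.
Proof.
move=> mf mg; rewrite -ge0_integralD//; do ?[exact: measurable_pint |
  by move=> x _; rewrite lee_fin mulr_ge0 ?powR_ge0].
rewrite -ge0_integralZl//; do ?[by apply: emeasurable_funD; exact: measurable_pint |
  by move=> x _; rewrite -EFinD lee_fin addr_ge0// mulr_ge0 ?powR_ge0 |
  by rewrite lee_fin powR_ge0].
apply: ge0_le_integral => //.
- by move=> x _; rewrite lee_fin mulr_ge0 ?powR_ge0.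
- by apply: measurable_pint; exact: cmeasurableD.
- by apply: measurable_funeM; apply: emeasurable_funD; exact: measurable_pint.
- move=> x _; rewrite -EFinD -EFinM lee_fin -mulrDl mulrA ler_wpM2r//.
  apply: le_trans (powR_addr_le (normc_ge0 _) (normc_ge0 _)).
  rewrite ge0_ler_powR ?nnegrE ?normc_ge0 ?addr_ge0 ?normc_ge0//; first exact: ltW.
  exact: le_normcD.
Qed.

Lemma powR_lt_eps (e u : R) : 0 < e -> 0 <= u -> u < e `^ p^-1 -> u `^ p < e.
Proof.
move=> e0 u0 ue; rewrite -[ltRHS](_ : (e `^ p^-1) `^ p = e).
  by rewrite gt0_ltr_powR ?nnegrE ?powR_ge0.
by rewrite -powRrM mulVf ?gt_eqF// powRr1// ltW.
Qed.

Lemma pintZ_lt f (e : R) : cmeasurable f -> pfinite f -> 0 < e ->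
  exists2 k : R, 0 < k & forall g, cmeasurable g ->
    (forall x, normc (g x) <= k * normc (f x)) -> psmall g e.
Proof.
move=> mf /pfiniteE fi e0.
have [m fm] : exists m : R, pint f = m%:E.
  by exists (fine (pint f)); rewrite fineK// ge0_fin_numE// pint_ge0.
have m0 : 0 <= m by rewrite -lee_fin -fm pint_ge0.
have em0 : 0 < e / (m + 1) by rewrite divr_gt0// ltr_wpDl.
exists ((e / (m + 1)) `^ p^-1); first exact: powR_gt0.
set k := _ `^ _ => g mg gk; apply/psmallE.
apply: (@le_lt_trans _ _ (k `^ p * m)%:E); last first.
  rewrite /k -powRrM mulVf ?gt_eqF// powRr1 ?ltW// lte_fin.
  by rewrite mulrAC ltr_pdivrMr ?ltr_wpDl// ltr_pM2l// ltrDl.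
rewrite EFinM -fm /pint -ge0_integralZl//; do ?[exact: measurable_pint |
  by move=> x _; rewrite lee_fin mulr_ge0 ?powR_ge0 | by rewrite lee_fin powR_ge0].
apply: le_trans (le_pint_real mg _ gk) _.
  by apply: measurable_funM => //; exact: measurable_normc.
rewrite le_eqVlt; apply/predU1l/eq_integral => x _.
by rewrite -EFinM mulrA powRM ?powR_ge0 ?normc_ge0.
Qed.

Lemma pint_dominated (f_ : nat -> T -> R[i]) f g :
  (forall k, cmeasurable (f_ k)) -> cmeasurable f -> cmeasurable g ->
  pfinite g ->
  (forall k x, normc (f x - f_ k x) <= normc (g x)) ->
  (forall x, normc (f x - f_ k x) @[k --> \oo] --> 0) ->
  forall e : R, 0 < e -> exists k, psmall (fun x => f x - f_ k x) e.
Proof.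
move=> mf_ mf mg /pfiniteE gi fg f_f e e0.
have md k : cmeasurable (fun x => f x - f_ k x) by exact: cmeasurableB.
have ptw x : setT x -> (normc (f x - f_ k x) `^ p * v x)%:E @[k --> \oo] --> 0%:E.
  move=> _; apply/fine_cvgP; split; first exact: nearW.
  rewrite /comp/= -[X in _ --> X](mul0r (v x)); apply: cvgM; last exact: cvg_cst.
  apply/cvgrPdist_lt => r r0; have /cvgrPdist_lt/(_ _ (powR_gt0 p^-1 r0)) := f_f x.
  apply: filterS => k; rewrite !sub0r !normrN ger0_norm ?normc_ge0// => fr.
  by rewrite ger0_norm ?powR_ge0// powR_lt_eps// normc_ge0.
have gint : mu.-integrable setT (fun x => (normc (g x) `^ p * v x)%:E).
  apply: intble_ge0 => //; last by move=> x; rewrite mulr_ge0 ?powR_ge0.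
  by apply/measurable_EFinP; exact: measurable_pint.
have dom k x : setT x -> (`|(normc (f x - f_ k x) `^ p * v x)%:E| <=
    (normc (g x) `^ p * v x)%:E)%E.
  move=> _ /=; rewrite lee_fin ger0_norm ?mulr_ge0 ?powR_ge0// ler_wpM2r//.
  by rewrite ge0_ler_powR ?nnegrE ?normc_ge0//; exact: ltW.
have := @dominated_cvg _ _ _ mu setT measurableT _ (cst 0%E)
  (fun x => (normc (g x) `^ p * v x)%:E) (fun k => measurable_pint (md k)) ptw
  (fun x _ => isT) gint dom.
rewrite integral0 => cv.
have /fine_cvgP[fin /cvgrPdist_lt/(_ _ e0) lt_e] := cv.
have [N _ /(_ N (leqnn N))[finN]] := filterI fin lt_e.
rewrite sub0r normrN => lt_eN; exists N; apply/psmallE; rewrite -[pint _]fineK// lte_fin.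
by rewrite (le_lt_trans (ler_norm _)).
Qed.

End WeightedPower.

(** * Trigonometric polynomials for a finite measure *)

Section TrigonometricDensity.
Context {R : realType}.
Local Notation E n := (euclidean R n).
Local Notation lebn := (@lebesgue_euclidean R).
Notation normc := Normc.normc.
Variable n : nat.
Implicit Types (f g u w : E n -> R[i]).

Definition character (xi : 'I_n -> R) : E n -> R[i] := ee (fun i => 0 +i* xi i).

Inductive trig : (E n -> R[i]) -> Prop :=
| trig_character xi : trig (character xi)
| trig0 : trig (fun=> 0)
| trigD u w : trig u -> trig w -> trig (fun x => u x + w x)
| trigZ (a : R[i]) u : trig u -> trig (fun x => a * u x).

Lemma characterM xi xi' x :
  character xi x * character xi' x = character (fun i => xi i + xi' i) x.
Proof.
rewrite /character /ee -big_split/=; apply: eq_bigr => i _; rewrite -cexpD -mulrDl.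
rewrite (_ : 0 +i* xi i + 0 +i* xi' i = 0 +i* (xi i + xi' i))//.
by apply: complexP; rewrite /= ?addr0.
Qed.

Lemma character0 x : character (fun=> 0) x = 1.
Proof.
rewrite /character /ee big1// => i _; rewrite (_ : 0 +i* 0 = 0 :> R[i])//.
by rewrite mul0r cexp0.
Qed.

Lemma normc_character xi x : normc (character xi x) = 1.
Proof.
rewrite /character /ee normc_prod big1// => i _.
by rewrite normc_cexp ReM/= mul0r mulr0 subr0 expR0.
Qed.

Lemma trigM u w : trig u -> trig w -> trig (fun x => u x * w x).
Proof.
elim=> [xi||u1 u2 _ IH1 _ IH2|a u' _ IH] tw.
- elim: tw => [xi'||w1 w2 _ IH1 _ IH2|a w' _ IH].
  + rewrite (_ : (fun _ => _) = character (fun i => xi i + xi' i)); first exact: trig_character.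
    by apply/funext => x; rewrite characterM.
  + by under eq_fun do rewrite mulr0; exact: trig0.
  + by under eq_fun do rewrite mulrDr; exact: trigD.
  + by under eq_fun do rewrite mulrCA; exact: trigZ.
- by under eq_fun do rewrite mul0r; exact: trig0.
- by under eq_fun do rewrite mulrDl; apply: trigD; [exact: IH1|exact: IH2].
- by under eq_fun do rewrite -mulrA; apply: trigZ; exact: IH.
Qed.

Lemma trig_meas_bdd u : trig u -> cmeasurable u /\ exists A : R, forall x, normc (u x) <= A.
Proof.
elim=> [xi||u1 u2 _ [m1 [A hA]] _ [m2 [B hB]]|a u' _ [m [A hA]]].
- split; first exact: cmeasurable_ee.
  by exists 1 => x; rewrite normc_character.
- by split; [exact: cmeasurable_cst|exists 0 => x; rewrite Normc.normc0].
- split; first exact: cmeasurableD.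
  by exists (A + B) => x; rewrite (le_trans (le_normcD _ _))// lerD.
- split; first by apply: cmeasurableM => //; exact: cmeasurable_cst.
  by exists (normc a * A) => x; rewrite Normc.normcM ler_wpM2l ?normc_ge0.
Qed.

Variables (p : R) (v : E n -> R).
Hypothesis p_gt0 : 0 < p.
Hypothesis mv : measurable_fun setT v.
Hypothesis v_ge0 : forall x, 0 <= v x.
Hypothesis v_fin : (\int[lebn n]_x (v x)%:E < +oo)%E.
Local Notation J := (pint (lebn n) p v).
Local Notation small := (psmall (lebn n) p v).
Local Notation pfin := (pfinite (lebn n) p v).

Lemma pint_cst_fin (A : R[i]) : pfin (fun=> A).
Proof.
apply/pfiniteE; rewrite pintE; under eq_integral do rewrite EFinM.
rewrite ge0_integralZl//; do ?[exact/measurable_EFinP | by move=> x _; rewrite lee_fin |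
  by rewrite lee_fin powR_ge0].
by rewrite lte_mul_pinfty ?lee_fin ?powR_ge0.
Qed.

(** Boundedness is kept so that the limits are stable under products. *)
Definition trig_limit f : Prop := [/\ cmeasurable f, exists A : R, forall x, normc (f x) <= A &
  forall e : R, 0 < e -> exists2 u, trig u & small (fun x => f x - u x) e].

Lemma pint_tri f g w : cmeasurable f -> cmeasurable g -> cmeasurable w ->
  (J (fun x => f x - w x)%R <=
   (2 `^ p)%:E * (J (fun x => f x - g x)%R + J (fun x => g x - w x)%R))%E.
Proof.
move=> mf mg mw.
rewrite (_ : (fun x => f x - w x) = fun x => (f x - g x) + (g x - w x)).
  exact: (pintD_le (lebn n) p_gt0 mv v_ge0 (cmeasurableB mf mg) (cmeasurableB mg mw)).
by apply/funext => x; rewrite addrA subrK.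
Qed.

Lemma pint_tri_lt f g w (e : R) : cmeasurable f -> cmeasurable g -> cmeasurable w -> 0 < e ->
  small (fun x => f x - g x) (e / (2 * 2 `^ p)) ->
  small (fun x => g x - w x) (e / (2 * 2 `^ p)) ->
  small (fun x => f x - w x) e.
Proof.
move=> mf mg mw e0 /psmallE h1 /psmallE h2; apply/psmallE; apply: le_lt_trans (pint_tri mf mg mw) _.
have := lteD h1 h2; rewrite -EFinD.
move: (J _ + J _)%E => s; have c0 : 0 < 2 `^ p :> R by rewrite powR_gt0.
move=> s_lt; have : ((2 `^ p)%:E * s < (2 `^ p)%:E * (e / (2 * 2 `^ p) + e / (2 * 2 `^ p))%:E)%E.
  by rewrite lte_pmul2l.
by rewrite -EFinM (_ : 2 `^ p * _ = e)//; field; rewrite gt_eqF.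
Qed.

Lemma tol_gt0 (e : R) : 0 < e -> 0 < e / (2 * 2 `^ p).
Proof. by move=> e0; rewrite divr_gt0// mulr_gt0// powR_gt0. Qed.

Lemma trig_limit_trig u : trig u -> trig_limit u.
Proof.
move=> tu; have [mu bu] := trig_meas_bdd tu; split => // e e0; exists u => //.
apply/psmallE; rewrite pintE (eq_integral (cst 0%E)) ?integral0 ?lte_fin// => x _.
by rewrite subrr Normc.normc0 powR0 ?mul0r// gt_eqF.
Qed.

Lemma trig_limit_adh f : cmeasurable f -> (exists A : R, forall x, normc (f x) <= A) ->
  (forall e : R, 0 < e -> exists2 g, trig_limit g & small (fun x => f x - g x) e) ->
  trig_limit f.
Proof.
move=> mf bf af; split=> // e e0.
have [g [mg _ ag] fg] := af _ (tol_gt0 e0).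
have [u tu gu] := ag _ (tol_gt0 e0); exists u => //.
by apply: pint_tri_lt fg gu => //; have [] := trig_meas_bdd tu.
Qed.

Lemma trig_limit_lim (f_ : nat -> E n -> R[i]) f (A : R) :
  (forall k, trig_limit (f_ k)) -> (forall k x, normc (f_ k x) <= A) ->
  (forall x, normc (f x) <= A) -> cmeasurable f ->
  (forall x, normc (f x - f_ k x) @[k --> \oo] --> 0) -> trig_limit f.
Proof.
move=> af_ f_A fA mf cf; apply: trig_limit_adh => //; first by exists A.
move=> e e0.
have fb k x : normc (f x - f_ k x) <= normc (2 * A)%:C.
  rewrite normc_real (le_trans _ (ler_norm _))// mulr_natl mulr2n.
  by rewrite (le_trans (le_normcD _ _))// normcN lerD.
have mf_ k : cmeasurable (f_ k) by have [] := af_ k.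
have [k fk] := pint_dominated p_gt0 mv v_ge0 mf_ mf (cmeasurable_cst _) (pint_cst_fin _) fb cf e0.
by exists (f_ k).
Qed.

Lemma pintD_lt f g (e : R) : cmeasurable f -> cmeasurable g -> 0 < e ->
  small f (e / (2 * 2 `^ p)) -> small g (e / (2 * 2 `^ p)) ->
  small (fun x => f x + g x) e.
Proof.
move=> mf mg e0 h1 h2.
rewrite (_ : (fun x => f x + g x) = fun x => f x - - g x); last first.
  by apply/funext => x; rewrite opprK.
apply: (@pint_tri_lt f (fun=> 0) (fun x => - g x) e mf (cmeasurable_cst _) (cmeasurableN mg) e0).
  by under eq_fun do rewrite subr0.
by under eq_fun do rewrite sub0r opprK.
Qed.

Lemma trig_limitD f g : trig_limit f -> trig_limit g -> trig_limit (fun x => f x + g x).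
Proof.
move=> [mf [A fA] af] [mg [B gB] ag]; split.
- exact: cmeasurableD.
- by exists (A + B) => x; rewrite (le_trans (le_normcD _ _))// lerD.
- move=> e e0; have [u tu fu] := af _ (tol_gt0 e0); have [w tw gw] := ag _ (tol_gt0 e0).
  exists (fun x => u x + w x); first exact: trigD.
  have [mu _] := trig_meas_bdd tu; have [mw _] := trig_meas_bdd tw.
  rewrite (_ : (fun x => _) = fun x => (f x - u x) + (g x - w x)).
    exact: (pintD_lt (cmeasurableB mf mu) (cmeasurableB mg mw) e0 fu gw).
  by apply/funext => x; rewrite opprD addrACA.
Qed.

(** For a bounded factor w, multiplication by w is continuous; apply this first
with w a trigonometric polynomial, then with w a limit of such. *)
Lemma trig_limitM f g : trig_limit f -> trig_limit g -> trig_limit (fun x => f x * g x).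
Proof.
suff bddM h w : trig_limit h -> (forall e : R, 0 < e -> exists2 g, trig g /\ trig_limit (fun x => w x * g x)
    & small (fun x => h x - g x) e) -> trig_limit w -> trig_limit (fun x => w x * h x).
  have tf h u : trig u -> trig_limit h -> trig_limit (fun x => u x * h x).
    move=> tu ah; apply: bddM => //; last exact: trig_limit_trig.
    have [_ _ ah'] := ah; move=> e /ah'[w tw hw]; exists w => //; split => //.
    by apply: trig_limit_trig; exact: trigM.
  move=> af ag; apply: bddM => //.
  have [_ _ ag'] := ag; move=> e /ag'[w tw gw]; exists w => //; split => //.
  by under eq_fun do rewrite mulrC; exact: tf.
move=> [mh [A hA] ah] ah' [mw [B wB] _].
have B0 : 0 <= `|B| by [].
apply: trig_limit_adh.
- exact: cmeasurableM.
- by exists (B * A) => x; rewrite Normc.normcM ler_pM ?normc_ge0.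
- move=> e e0.
  pose C := (`|B| + 1) `^ p; have C0 : 0 < C by apply: powR_gt0; exact: ltr_wpDl.
  have eC : 0 < e / C by rewrite divr_gt0.
  have [u [tu twu] hu] := ah' _ eC.
  exists (fun x => w x * u x) => //.
  have [mu _] := trig_meas_bdd tu.
  have : (J (fun x => w x * h x - w x * u x)%R <= C%:E * J (fun x => h x - u x)%R)%E.
    rewrite !pintE -ge0_integralZl//; do ?[by apply: measurable_pint => //; exact: cmeasurableB |
      by move=> x _; rewrite lee_fin mulr_ge0 ?powR_ge0 | by rewrite lee_fin ltW].
    apply: ge0_le_integral => //.
    - by move=> x _; rewrite lee_fin mulr_ge0 ?powR_ge0.
    - by apply: measurable_pint => //; apply: cmeasurableB; exact: cmeasurableM.
    - by apply: measurable_funeM; apply: measurable_pint => //; exact: cmeasurableB.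
    - move=> x _; rewrite -EFinM lee_fin mulrA ler_wpM2r// -mulrBr Normc.normcM.
      rewrite powRM ?normc_ge0// ler_wpM2r ?powR_ge0// ge0_ler_powR ?nnegrE ?normc_ge0//.
      + exact: ltW.
      + by rewrite (le_trans (wB x))// (le_trans (ler_norm _))// lerDl.
  move=> /le_lt_trans le_J; apply/psmallE; apply: le_J; rewrite -lte_pdivlMl//.
  move/psmallE: hu => /lt_le_trans; apply.
  by rewrite -EFinM lee_fin mulrC.
Qed.

Lemma trig_limit_cst (a : R[i]) : trig_limit (fun=> a).
Proof.
apply: trig_limit_trig; have := trigZ a (trig_character (fun=> 0)).
by rewrite (_ : (fun x => _) = fun=> a)//; apply/funext => x; rewrite character0 mulr1.
Qed.

Lemma trig_limitZ (a : R[i]) f : trig_limit f -> trig_limit (fun x => a * f x).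
Proof. by move=> af; exact: trig_limitM (trig_limit_cst a) af. Qed.

End TrigonometricDensity.

(** * Density of the trigonometric polynomials *)

Import HBNNSimple.

Section BoundedApproximation.
Context {R : realType}.
Local Notation E n := (euclidean R n).
Local Notation lebn := (@lebesgue_euclidean R).
Notation Re := complex.Re.
Notation Im := complex.Im.
Notation normc := Normc.normc.
Variables (n : nat) (p : R) (v : E n -> R).
Hypothesis p_gt0 : 0 < p.
Hypothesis mv : measurable_fun setT v.
Hypothesis v_ge0 : forall x, 0 <= v x.
Hypothesis v_fin : (\int[lebn n]_x (v x)%:E < +oo)%E.
Local Notation small := (psmall (lebn n) p v).
Local Notation TL := (@trig_limit R n p v).

Lemma cmeasurable_lim (f_ : nat -> E n -> R[i]) (f : E n -> R[i]) :
  (forall k, cmeasurable (f_ k)) ->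
  (forall x, normc (f x - f_ k x) @[k --> \oo] --> 0) -> cmeasurable f.
Proof.
move=> mf_ cf.
have part (g : R[i] -> R) : (forall z w, g (z - w) = g z - g w) -> (forall z, `|g z| <= normc z) ->
    forall x, g (f_ k x) @[k --> \oo] --> g (f x).
  move=> gB gn x; apply/cvgrPdist_lt => e e0; have /cvgrPdist_lt/(_ _ e0) := cf x.
  apply: filterS => k; rewrite sub0r normrN ger0_norm ?normc_ge0// => h.
  by rewrite -gB (le_lt_trans (gn _)).
split.
  apply: (@measurable_fun_cvg _ _ _ setT (fun k x => Re (f_ k x))) => [k|x _]; first by have [] := mf_ k.
  by have := part (@complex.Re R) (fun z w => etrans (ReD z (- w)) (congr1 _ (ReN w))) (@le_Re_normc R) x.
apply: (@measurable_fun_cvg _ _ _ setT (fun k x => Im (f_ k x))) => [k|x _]; first by have [] := mf_ k.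
by have := part (@complex.Im R) (fun z w => etrans (ImD z (- w)) (congr1 _ (ImN w))) (@le_Im_normc R) x.
Qed.

Lemma trig_limit_cvg (f_ : nat -> E n -> R[i]) f (A : R) :
  (forall k, TL (f_ k)) -> (forall k x, normc (f_ k x) <= A) ->
  (forall x, normc (f x - f_ k x) @[k --> \oo] --> 0) -> TL f.
Proof.
move=> tf_ f_A cf.
have mf_ k : cmeasurable (f_ k) by have [] := tf_ k.
apply: (trig_limit_lim p_gt0 mv v_ge0 v_fin tf_ f_A _ (cmeasurable_lim mf_ cf) cf) => x.
apply/ler_addgt0Pr => e e0; have /cvgrPdist_lt/(_ _ e0)[N _ /(_ N (leqnn N))/=] := cf x.
rewrite sub0r normrN ger0_norm ?normc_ge0// => h.
by rewrite (le_trans (normc_sub _ (f_ N x)))// addrC lerD// ltW.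
Qed.

Lemma eventually_cvg0 (z_ : nat -> R[i]) z :
  (exists N, forall k, (N <= k)%N -> z_ k = z) -> normc (z - z_ k) @[k --> \oo] --> 0.
Proof.
move=> [N zN]; apply: cvg_near_cst; exists N => // k /= Nk.
by rewrite zN// subrr Normc.normc0.
Qed.

(** Iterating this odd map of [-1, 1] pushes every point away from 0 to the
endpoint of its sign. *)
Definition smoothstep (u : R) : R := (3 * u - u ^+ 3) / 2.

Lemma smoothstepN u : smoothstep (- u) = - smoothstep u.
Proof. by rewrite /smoothstep; field. Qed.

Lemma iter_smoothstepN m u : iter m smoothstep (- u) = - iter m smoothstep u.
Proof. by elim: m => //= m ->; rewrite smoothstepN. Qed.

Lemma iter_smoothstep_pos m u : 0 < u -> u <= 1 ->
  [/\ u <= iter m smoothstep u, iter m smoothstep u <= 1 &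
      1 - iter m smoothstep u <= (1 - u / 2) ^+ m].
Proof.
move=> u0 u1; elim: m => [|m [IH1 IH2 IH3]] /=; first by rewrite expr0; split => //; lra.
set y := iter m smoothstep u in IH1 IH2 IH3 *.
have y0 : 0 < y by rewrite (lt_le_trans u0).
have yy : 0 <= y * (1 - y) by nra.
split.
- apply: le_trans IH1 _; rewrite /smoothstep; nra.
- by rewrite /smoothstep; nra.
- rewrite exprS; apply: le_trans (_ : _ <= (1 - u / 2) * (1 - y)) _.
    have -> : 1 - smoothstep y = (1 - y) * ((1 - y) * (2 + y) / 2) by rewrite /smoothstep; field.
    by rewrite mulrC ler_wpM2r; nra.
  by rewrite ler_wpM2l//; lra.
Qed.

Lemma iter_smoothstep0 m : iter m smoothstep 0 = 0.
Proof. by elim: m => //= m ->; rewrite /smoothstep expr0n/= mulr0 subrr mul0r. Qed.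

Lemma iter_smoothstep_le1 m u : `|u| <= 1 -> `|iter m smoothstep u| <= 1.
Proof.
move=> u1; have [u0|u0|<-] := ltgtP 0 u; last by rewrite iter_smoothstep0 normr0.
  move: u1; rewrite (ger0_norm (ltW u0)) => u1.
  have [h1 h2 _] := iter_smoothstep_pos m u0 u1.
  by rewrite ger0_norm// (le_trans (ltW u0)).
move: u1; rewrite (ltr0_norm u0) => u1.
rewrite -[u]opprK iter_smoothstepN normrN.
have nu0 : 0 < - u by rewrite oppr_gt0.
have [h1 h2 _] := iter_smoothstep_pos m nu0 u1.
by rewrite ger0_norm// (le_trans (ltW nu0)).
Qed.

Lemma iter_smoothstep_cvg u : `|u| <= 1 -> `|Num.sg u - iter m smoothstep u| @[m --> \oo] --> 0.
Proof.
have pos w : 0 < w -> w <= 1 -> `|1 - iter m smoothstep w| @[m --> \oo] --> 0.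
  move=> w0 w1; apply: (@squeeze_cvgr _ _ _ _ (cst 0) (geometric 1 (1 - w / 2))).
  - near=> m; rewrite normr_ge0/= mul1r.
    have [h1 h2 h3] := @iter_smoothstep_pos m w w0 w1.
    by rewrite ger0_norm// subr_ge0.
  - exact: cvg_cst.
  - by apply: cvg_geometric; rewrite ger0_norm; lra.
move=> u1; have [u0|u0|<-] := ltgtP 0 u.
- by rewrite gtr0_sg//; apply: pos => //; rewrite -(ger0_norm (ltW u0)).
- rewrite ltr0_sg//.
  rewrite (_ : (fun m => _) = fun m => `|1 - iter m smoothstep (- u)|).
    by apply: pos; rewrite ?oppr_gt0// -(ltr0_norm u0).
  by apply/funext => m; rewrite iter_smoothstepN opprK -normrN opprD !opprK.
- rewrite sgr0; under eq_fun do rewrite iter_smoothstep0 subrr normr0.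
  exact: cvg_cst.
Unshelve. all: by end_near. Qed.

Lemma TL_real_smoothstep (g : E n -> R) : TL (fun x => (g x)%:C) ->
  TL (fun x => (smoothstep (g x))%:C).
Proof.
move=> tg.
have := trig_limitD p_gt0 mv v_ge0
  (trig_limitZ p_gt0 mv v_ge0 (3 / 2)%:C tg)
  (trig_limitZ p_gt0 mv v_ge0 (- 2^-1)%:C (trig_limitM p_gt0 mv v_ge0 tg
     (trig_limitM p_gt0 mv v_ge0 tg tg))).
rewrite (_ : (fun x => (smoothstep (g x))%:C) = fun x => (3 / 2)%:C * (g x)%:C +
  (- 2^-1)%:C * ((g x)%:C * ((g x)%:C * (g x)%:C))) //.
apply/funext => x; rewrite -!rmorphM -rmorphD/=; congr (_%:C).
by rewrite /smoothstep; field.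
Qed.

Lemma TL_sg (g : E n -> R) : (forall x, `|g x| <= 1) -> TL (fun x => (g x)%:C) ->
  TL (fun x => (Num.sg (g x))%:C).
Proof.
move=> g1 tg; apply: (@trig_limit_cvg (fun m x => (iter m smoothstep (g x))%:C) _ 1).
- by elim=> [|m IH] //=; exact: TL_real_smoothstep.
- by move=> m x; rewrite normc_real; exact: iter_smoothstep_le1.
- move=> x; have := iter_smoothstep_cvg (g1 x).
  by under [X in _ -> X @ _ --> _]eq_fun do rewrite -rmorphB normc_real.
Qed.

Lemma TL_sin (j : 'I_n) (k a : R) : TL (fun x => (sin (k * ((tnth x j : R) - a)))%:C).
Proof.
pose xi (s : R) (i : 'I_n) : R := if i == j then s else 0.
have chE s x : character (xi s) x = cos (s * tnth x j) +i* sin (s * tnth x j).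
  rewrite /character /ee (bigD1 j)//= big1 ?mulr1 => [|i /negbTE ij].
    rewrite /xi eqxx; apply: complexP; rewrite ?(Re_cexp, Im_cexp) ReM ImM/=.
      by rewrite !mul0r mulr0 subr0 add0r expR0 mul1r.
    by rewrite !mul0r mulr0 subr0 add0r expR0 mul1r.
  by rewrite /xi ij (_ : 0 +i* 0 = 0 :> R[i])// mul0r cexp0.
have t s : TL (character (xi s)) by apply: trig_limit_trig => //; exact: trig_character.
have := trig_limitD p_gt0 mv v_ge0
  (trig_limitZ p_gt0 mv v_ge0 ((- sin (k * a) / 2) +i* (- cos (k * a) / 2)) (t k))
  (trig_limitZ p_gt0 mv v_ge0 ((- sin (k * a) / 2) +i* (cos (k * a) / 2)) (t (- k))).
rewrite [X in TL X -> _](_ : _ = fun x => (sin (k * ((tnth x j : R) - a)))%:C)//.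
apply/funext => x; rewrite !chE !mulNr cosN sinN mulrBr.
by apply: complexP; rewrite ?(ReD, ImD) ?(ReM, ImM)/= ?sinB; field.
Qed.

(** A sine of low frequency has the sign of x_j - a on a long interval. *)
Lemma TL_sg_coord (j : 'I_n) (a : R) : TL (fun x => (Num.sg ((tnth x j : R) - a))%:C).
Proof.
apply: (@trig_limit_cvg (fun m x => (Num.sg (sin (m.+1%:R^-1 * ((tnth x j : R) - a))))%:C) _ 1).
- by move=> m; apply: TL_sg; [move=> x; exact: sin_le1_norm|exact: TL_sin].
- by move=> m x; rewrite normc_real normr_sg; case: (_ != 0); rewrite ?lexx.
- move=> x; apply: eventually_cvg0; set u := _ - a.
  exists (Num.bound `|u|) => m um; congr (_%:C).
  have m0 : 0 < m.+1%:R^-1 :> R by rewrite invr_gt0.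
  have small w : 0 < w -> w <= `|u| -> 0 < m.+1%:R^-1 * w < pi.
    move=> w0 wu; rewrite mulr_gt0//= (lt_trans (_ : _ < 1)) ?(lt_le_trans _ (pi_ge2 _)) ?ltr1n//.
    rewrite mulrC ltr_pdivrMr// mul1r (le_lt_trans wu)// (lt_le_trans (archi_boundP (normr_ge0 _)))//.
    by rewrite ler_nat (leq_trans um).
  have [u0|u0|<-] := ltgtP 0 u.
  - by rewrite !gtr0_sg// sin_gt0_pi// small// ler_norm.
  - rewrite !ltr0_sg//; rewrite -[u]opprK mulrN sinN oppr_lt0.
    by rewrite sin_gt0_pi// small ?oppr_gt0// -normrN ler_norm.
  - by rewrite mulr0 sin0 sgr0.
Qed.

Definition TLset (A : set (E n)) : Prop := TL (fun x => (\1_A x)%:C).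

Lemma TLset_gt (j : 'I_n) (a : R) : TLset [set x | a < (tnth x j : R)].
Proof.
have s := TL_sg_coord j a.
have := trig_limitZ p_gt0 mv v_ge0 (2^-1)%:C
  (trig_limitD p_gt0 mv v_ge0 s (trig_limitM p_gt0 mv v_ge0 s s)).
rewrite /TLset [X in TL X -> _](_ : _ = fun x => (\1_[set x | a < (tnth x j : R)] x)%:C)//.
apply/funext => x; rewrite -rmorphM -rmorphD -rmorphM/= indicE; congr (_%:C).
have [h|h|h] := ltgtP a (tnth x j : R).
- by rewrite gtr0_sg ?subr_gt0// mem_set// mul1r mulVf.
- rewrite ltr0_sg ?subr_lt0// memNset/=; first by rewrite mulrNN mulr1 addNr mulr0.
  by apply/negP; rewrite -leNgt ltW.
- by rewrite -h subrr sgr0 mul0r addr0 mulr0 memNset//= -h ltxx.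
Qed.

Lemma TLset0 : TLset set0.
Proof.
rewrite /TLset (_ : (fun _ => _) = fun=> 0); first exact: trig_limit_cst.
by apply/funext => x; rewrite indic0.
Qed.

Lemma TLsetC A : TLset A -> TLset (~` A).
Proof.
move=> tA; have := trig_limitD p_gt0 mv v_ge0 (trig_limit_cst v p_gt0 1)
  (trig_limitZ p_gt0 mv v_ge0 (-1) tA).
rewrite /TLset [X in TL X -> _](_ : _ = fun x => (\1_(~` A) x)%:C)//.
apply/funext => x; rewrite !indicE in_setC.
by case: (x \in A); rewrite /= ?rmorph1 ?rmorph0 ?mulr1 ?subrr ?mulr0 ?addr0.
Qed.

Lemma TLsetI A B : TLset A -> TLset B -> TLset (A `&` B).
Proof.
move=> tA tB; have := trig_limitM p_gt0 mv v_ge0 tA tB.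
rewrite /TLset [X in TL X -> _](_ : _ = fun x => (\1_(A `&` B) x)%:C)//.
by apply/funext => x; rewrite indicI rmorphM.
Qed.

Lemma TLset_bigcup (A : (set (E n))^nat) : (forall k, TLset (A k)) -> TLset (\bigcup_k A k).
Proof.
move=> tA; pose B m := \bigcup_(k in [set k | (k < m)%N]) A k.
have tB m : TLset (B m).
  elim: m => [|m IH]; first by rewrite /B (_ : [set k | _] = set0) ?bigcup_set0; [exact: TLset0|apply/seteqP; split].
  have -> : B m.+1 = ~` (~` B m `&` ~` A m).
    rewrite setCI !setCK; apply/seteqP; split => x.
      by move=> [k /=]; rewrite ltnS leq_eqVlt => /predU1P[->|km] Akx; [right|left; exists k].
    by move=> [[k /= km Akx]|Amx]; [exists k => //=; exact: ltnW|exists m => /=].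
  by apply: TLsetC; apply: TLsetI; exact: TLsetC.
apply: (@trig_limit_cvg (fun m x => (\1_(B m) x)%:C) _ 1) => //.
- by move=> m x; rewrite normc_real indicE; case: (_ \in _); rewrite ?normr1 ?normr0.
- move=> x; apply: eventually_cvg0.
  have [[k _ Akx]|nA] := pselect ((\bigcup_k A k) x).
    exists k.+1 => m km; rewrite !indicE !mem_set//; [by exists k|by exists k].
  exists 0%N => m _; rewrite !indicE !memNset// => -[k _ Akx].
  by apply: nA; exists k.
Qed.

(** The sets whose indicators are limits of trigonometric polynomials form a
sigma-algebra, which contains the half-spaces. *)
Lemma TLset_measurable (A : set (E n)) : measurable A -> TLset A.
Proof.
have sig : sigma_algebra setT TLset.
  split; [exact: TLset0|by move=> B tB; rewrite setTD; exact: TLsetC|exact: TLset_bigcup].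
have coord (j : 'I_n) (B : set (measurableTypeR R)) : measurable B -> TLset ((fun x : E n => tnth x j) @^-1` B).
  rewrite [X in X -> _](_ : _ = (RGenOInfty.G (R:=R)).-sigma.-measurable B); last first.
    by rewrite -RGenOInfty.measurableE.
  apply: (@smallest_sub _ (sigma_algebra setT) _ [set B | TLset ((fun x : E n => tnth x j) @^-1` B)]).
    split => /=.
    - by rewrite preimage_set0; exact: TLset0.
    - by move=> C tC; rewrite setTD preimage_setC; exact: TLsetC.
    - by move=> F tF; rewrite preimage_bigcup; exact: TLset_bigcup.
  move=> C [a ->] /=; have := TLset_gt j a; congr TLset.
  by apply/seteqP; split => x /=; rewrite in_itv/= andbT.
apply: smallest_sub => // B.
rewrite -bigcup_seq => -[j _ [C mC <-]].
by rewrite setTI; exact: coord.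
Qed.

Lemma TL_nnsfun (h : {nnsfun (E n) >-> R}) : TL (fun x => (h x)%:C).
Proof.
have -> : (fun x => (h x)%:C) = fun x =>
    \sum_(y <- finmap.enum_fset (fset_set (range h))) (y%:C * (\1_(h @^-1` [set y]) x)%:C).
  apply/funext => x; rewrite fimfunE fsbig_finite//= rmorph_sum.
  by apply: eq_bigr => y _; rewrite rmorphM.
elim: (finmap.enum_fset _) => [|y s IH].
  by under eq_fun do rewrite big_nil; exact: trig_limit_cst.
under eq_fun do rewrite big_cons; apply: trig_limitD => //.
by apply: trig_limitZ => //; exact: TLset_measurable.
Qed.

Lemma TL_nonneg (h : E n -> R) (A : R) : measurable_fun setT h -> (forall x, 0 <= h x) ->
  (forall x, h x <= A) -> TL (fun x => (h x)%:C).
Proof.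
move=> mh h0 hA; have mhE : measurable_fun setT (EFin \o h) by exact/measurable_EFinP.
pose a k := nnsfun_approx measurableT mhE k.
have ah x : a k x @[k --> \oo] --> h x.
  have h0E y : setT y -> (0 <= (EFin \o h) y)%E by move=> _; rewrite lee_fin.
  by have /fine_cvgP[_] := @cvg_nnsfun_approx _ _ _ _ measurableT _ mhE h0E x I.
have a_le k x : a k x <= h x.
  rewrite -(cvg_lim _ (ah x))//; apply: (@nondecreasing_cvgn_le _ (fun k => a k x)).
    by move=> i j ij; have /lefP := nd_nnsfun_approx measurableT mhE ij; exact.
  by apply/cvg_ex; exists (h x).
apply: (@trig_limit_cvg (fun k x => (a k x)%:C) _ A).
- by move=> k; exact: TL_nnsfun.
- by move=> k x; rewrite normc_real ger0_norm// (le_trans (a_le k x)).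
- move=> x; under eq_fun do rewrite -rmorphB normc_real.
  apply/cvgrPdist_lt => e e0; have /cvgrPdist_lt/(_ _ e0) := ah x.
  by apply: filterS => k; rewrite sub0r normrN normr_id.
Qed.

Lemma TL_real (h : E n -> R) (A : R) : measurable_fun setT h ->
  (forall x, `|h x| <= A) -> TL (fun x => (h x)%:C).
Proof.
move=> mh hA.
have h1 : TL (fun x => (h x + A)%:C).
  apply: (@TL_nonneg _ (A + A)).
  - by apply: measurable_funD => //; exact: measurable_cst.
  - by move=> x; have := hA x; rewrite ler_norml => /andP[]; rewrite -subr_ge0 opprK.
  - by move=> x; rewrite lerD2r (le_trans (ler_norm _)).
have := trig_limitD p_gt0 mv v_ge0 h1 (trig_limit_cst v p_gt0 (- A)%:C).
rewrite [X in TL X -> _](_ : _ = fun x => (h x)%:C)//.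
by apply/funext => x; rewrite -rmorphD/= addrK.
Qed.

Lemma TL_bounded (g : E n -> R[i]) (A : R) : cmeasurable g ->
  (forall x, normc (g x) <= A) -> TL g.
Proof.
move=> [m1 m2] gA.
have t1 := TL_real m1 (fun x => le_trans (le_Re_normc (g x)) (gA x)).
have t2 := TL_real m2 (fun x => le_trans (le_Im_normc (g x)) (gA x)).
have := trig_limitD p_gt0 mv v_ge0 t1 (trig_limitZ p_gt0 mv v_ge0 (0 +i* 1) t2).
rewrite [X in TL X -> _](_ : _ = g)//.
by apply/funext => x; rewrite [RHS]complexE.
Qed.

(** Truncation reduces the claim to bounded functions, which are bounded limits of
simple functions. *)
Theorem trig_dense (g : E n -> R[i]) (e : R) : cmeasurable g -> pfinite (lebn n) p v g ->
  0 < e -> exists2 u, trig u & small (fun x => g x - u x) e.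
Proof.
move=> mg gfin e0.
pose B (k : nat) := [set x | normc (g x) <= k%:R].
pose g_ k x := g x * (\1_(B k) x)%:C.
have mB k : measurable (B k).
  rewrite -[X in measurable X]setTI; apply: measurable_fun_le => //.
    exact: measurable_normc.
have mg_ k : cmeasurable (g_ k).
  apply: cmeasurableM => //; apply: cmeasurable_real; exact: measurable_indic.
have g_le k x : normc (g x - g_ k x) <= normc (g x).
  rewrite /g_ indicE; case: (_ \in _); rewrite ?rmorph1 ?rmorph0 ?mulr1 ?mulr0.
    by rewrite subrr Normc.normc0 normc_ge0.
  by rewrite subr0.
have cg x : normc (g x - g_ k x) @[k --> \oo] --> 0.
  apply: eventually_cvg0; exists (Num.bound (normc (g x))) => k Nk.
  rewrite /g_ indicE mem_set ?rmorph1 ?mulr1// /B/= ltW//.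
  by rewrite (lt_le_trans (archi_boundP (normc_ge0 _)))// ler_nat.
have [k gk] := pint_dominated p_gt0 mv v_ge0 mg_ mg mg gfin g_le cg (tol_gt0 p e0).
have [_ _ /(_ _ (tol_gt0 p e0))[u tu gu]] : TL (g_ k).
  apply: (@TL_bounded _ k%:R) => // x; rewrite /g_ indicE.
  have [xB|xB] := boolP (x \in B k); last by rewrite rmorph0 mulr0 Normc.normc0.
  by rewrite rmorph1 mulr1; move: xB; rewrite inE.
exists u => //; apply: pint_tri_lt gk gu => //.
by have [] := trig_meas_bdd tu.
Qed.

End BoundedApproximation.

(** * Combinations of exponentials *)

Section Combinations.
Context {R : realType}.
Local Notation E n := (euclidean R n).
Local Notation lebn := (@lebesgue_euclidean R).
Notation Re := complex.Re.
Notation normc := Normc.normc.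
Variables (n : nat) (rho c p b : R) (wt : E n -> R).
Hypothesis n_gt0 : (0 < n)%N.
Hypothesis p_gt0 : 0 < p.
Hypothesis b_ge0 : 0 <= b.
Hypothesis mwt : measurable_fun setT wt.
Hypothesis wt_ge0 : forall x, 0 <= wt x.
Hypothesis Phi_fin : pfinite (lebn n) p wt (fun x => (Phi b x)%:C).
Local Notation small := (psmall (lebn n) p wt).
Local Notation fin := (pfinite (lebn n) p wt).
Local Notation T := (@heat_semigroup R n rho c).
Local Notation word := (seq (R[i] * {ffun 'I_n -> R[i]})).
Implicit Types (s : word) (Z : set R[i]) (f g : E n -> R[i]).

Definition comb s : E n -> R[i] := fun x => \sum_(q <- s) q.1 * ee q.2 x.

Definition exponents_in Z s : Prop := forall q, q \in s -> forall i, Z (q.2 i).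

Lemma exponents_in_cons Z q s :
  exponents_in Z (q :: s) <-> (forall i, Z (q.2 i)) /\ exponents_in Z s.
Proof.
split=> [h|[h1 h2] q'].
  by split => [|q' q's]; apply: h; rewrite inE ?eqxx ?q's ?orbT.
by rewrite inE => /predU1P[->|]; [|exact: h2].
Qed.

Lemma exponents_in_cat Z s s' : exponents_in Z s -> exponents_in Z s' ->
  exponents_in Z (s ++ s').
Proof. by move=> h h' q; rewrite mem_cat => /orP[/h|/h']. Qed.

Lemma comb_cat s s' x : comb (s ++ s') x = comb s x + comb s' x.
Proof. by rewrite /comb big_cat. Qed.

Lemma comb_nil x : comb [::] x = 0. Proof. by rewrite /comb big_nil. Qed.

Lemma comb_cons q s x : comb (q :: s) x = q.1 * ee q.2 x + comb s x.
Proof. by rewrite /comb big_cons. Qed.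

Lemma cmeasurable_comb s : cmeasurable (comb s).
Proof.
apply: cmeasurable_sum => q; apply: cmeasurableM; first exact: cmeasurable_cst.
exact: cmeasurable_ee.
Qed.

Definition strip : set R[i] := [set z | `|Re z| <= b].

Lemma ee_le_Phi (z : 'I_n -> R[i]) x : (forall i, strip (z i)) -> normc (ee z x) <= Phi b x.
Proof.
move=> zb; rewrite /ee normc_prod /Phi; apply: ler_prod => i _.
apply/andP; split; first exact: normc_ge0.
by rewrite normc_cexp ReM/= mulr0 subr0; apply: le_expR_norm; exact: zb.
Qed.

Definition cnorm s : R := \sum_(q <- s) normc q.1.

Lemma comb_dominated s : exponents_in strip s -> dominated b (cnorm s) (comb s).
Proof.
move=> sZ; split; first exact: cmeasurable_comb.
move=> x; elim: s sZ => [|q s IH] sZ.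
  by rewrite comb_nil Normc.normc0 /cnorm big_nil mul0r.
have [qZ {}/IH IH] := (exponents_in_cons _ _ _).1 sZ.
rewrite comb_cons /cnorm big_cons mulrDl (le_trans (le_normcD _ _))// lerD//.
by rewrite Normc.normcM ler_wpM2l ?normc_ge0// ee_le_Phi.
Qed.

(** The action of the semigroup on words, which also makes sense for negative
times. *)
Definition flow (t : R) s : word :=
  [seq (q.1 * cexp (t%:C * eigenvalue_of rho c (q.2 : 'I_n -> R[i])), q.2) | q : R[i] * {ffun 'I_n -> R[i]} <- s].

Lemma exponents_in_flow Z t s : exponents_in Z s -> exponents_in Z (flow t s).
Proof. by move=> sZ q /mapP[q' q's ->] i; exact: (sZ _ q's). Qed.

Lemma flow_comp t s : flow t (flow (- t) s) = s.
Proof.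
rewrite /flow -map_comp -[RHS]map_id; apply: eq_map => q /=.
rewrite -mulrA -cexpD -mulrDl -rmorphD addNr rmorph0 mul0r cexp0 mulr1.
by case: q.
Qed.

Lemma heat_comb t s : 0 <= t -> exponents_in strip s -> T t (comb s) = comb (flow t s).
Proof.
move=> t0; elim: s => [|q s IH] sZ; apply/funext => x.
  rewrite comb_nil.
  have d0 : @dominated R n b 0 (fun=> 0).
    by split=> [|y]; [exact: cmeasurable_cst|rewrite Normc.normc0 mul0r].
  have := heatZ rho c b_ge0 0 t0 d0.
  rewrite (_ : (fun y => 0 * 0) = comb [::]); last first.
    by apply/funext => y; rewrite comb_nil mul0r.
  by move=> ->; rewrite mul0r.
have [qZ sZ'] := (exponents_in_cons _ _ _).1 sZ.
have IH' := IH sZ'.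
have dq : dominated b 1 (ee q.2).
  by split=> [|y]; [exact: cmeasurable_ee|rewrite mul1r ee_le_Phi].
rewrite (_ : comb (q :: s) = fun y => q.1 * ee q.2 y + comb s y); last first.
  by apply/funext => y; rewrite comb_cons.
rewrite (heatD rho c b_ge0 t0 (dominatedZ q.1 dq) (comb_dominated sZ')).
rewrite (heatZ rho c b_ge0 q.1 t0 dq) IH' heat_semigroup_ee// comb_cons/=.
by rewrite mulrA.
Qed.

(** The sign d selects the direction of time: d * t is negative for the words whose eigenvalues
have positive real part. *)
Lemma flow_decay (d : R) s :
  (forall q, q \in s -> d * Re (eigenvalue_of rho c (q.2 : 'I_n -> R[i])) < 0) ->
  forall e : R, 0 < e ->
  exists2 t0, 0 <= t0 & forall t, t0 <= t -> cnorm (flow (d * t) s) <= e.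
Proof.
elim: s => [|q s IH] hs e e0.
  by exists 0 => // t _; rewrite /cnorm /flow big_nil ltW.
have qs : forall q', q' \in s -> d * Re (eigenvalue_of rho c (q'.2 : 'I_n -> R[i])) < 0.
  by move=> q' q's; apply: hs; rewrite inE q's orbT.
have e2 : 0 < e / 2 by rewrite divr_gt0.
have [t0 t00 ht0] := IH qs _ e2.
have l0 : d * Re (eigenvalue_of rho c (q.2 : 'I_n -> R[i])) < 0 by apply: hs; rewrite inE eqxx.
set l := d * Re _ in l0.
pose t1 := normc q.1 / (e / 2 * - l).
have el : 0 < e / 2 * - l by rewrite mulr_gt0// oppr_gt0.
have t10 : 0 <= t1 by rewrite divr_ge0 ?normc_ge0 ?ltW.
exists (Num.max t0 t1); first by rewrite le_max t00.
move=> t; rewrite ge_max => /andP[h0 h1].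
rewrite /flow/= /cnorm big_cons/= -/(flow (d * t) s) -/(cnorm _) [leRHS](splitr e) lerD ?ht0//.
rewrite Normc.normcM normc_cexp ReZ -[d * t]mulrC -mulrA -/l.
have tl : 0 <= t * - l by rewrite mulr_ge0 ?(le_trans t10 h1)// oppr_ge0 ltW.
have ge1 : 0 < 1 + t * - l by rewrite ltr_wpDr.
apply: (@le_trans _ _ (normc q.1 / (1 + t * - l))).
  rewrite ler_wpM2l ?normc_ge0// -[leLHS]invrK -expRN lef_pV2 ?posrE ?expR_gt0//.
  by rewrite mulrN expR_ge1Dx.
rewrite ler_pdivrMr// mulrDr mulr1.
have : t1 * (e / 2 * - l) <= t * (e / 2 * - l) by apply: ler_wpM2r h1; exact: ltW.
rewrite /t1 divfK ?gt_eqF// => /le_trans; apply.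
by rewrite mulrCA lerDr ltW.
Qed.

Definition span Z : set (E n -> R[i]) := [set f | exists2 s, exponents_in Z s & f = comb s].

Definition Phi_closure (S : set (E n -> R[i])) : set (E n -> R[i]) :=
  [set f | forall e : R, 0 < e -> exists2 u, S u & Phi_near b e f u].

Lemma span_closed Z : [/\ span Z (fun=> 0),
  (forall f g, span Z f -> span Z g -> span Z (fun x => f x + g x)) &
  (forall (a : R[i]) f, span Z f -> span Z (fun x => a * f x))].
Proof.
split.
- by exists [::] => //; apply/funext => x; rewrite comb_nil.
- move=> _ _ [s sZ ->] [s' sZ' ->]; exists (s ++ s'); first exact: exponents_in_cat.
  by apply/funext => x; rewrite comb_cat.
- move=> a _ [s sZ ->]; exists [seq (a * q.1, q.2) | q <- s].
    by move=> q /mapP[q' q's ->] i; exact: (sZ _ q's).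
  apply/funext => x; rewrite /comb mulr_sumr big_map; apply: eq_bigr => q _ /=.
  by rewrite mulrA.
Qed.

Lemma Phi_closure_closed Z : Phi_closed b (Phi_closure (span Z)).
Proof.
have [S0 SD SZ] := span_closed Z; split.
- by move=> e e0; exists (fun=> 0) => // x; rewrite subr0 Normc.normc0 mulr_ge0 ?Phi_ge0 ?ltW.
- move=> f g hf hg e e0; have e2 : 0 < e / 2 by rewrite divr_gt0.
  have [u Su fu] := hf _ e2; have [w Sw gw] := hg _ e2.
  exists (fun x => u x + w x); first exact: SD.
  move=> x; rewrite opprD addrACA (le_trans (le_normcD _ _))//.
  by rewrite [e]splitr mulrDl lerD.
- move=> a f hf e e0; have a0 : 0 < normc a + 1 by rewrite ltr_wpDl ?normc_ge0.
  have [u Su fu] := hf _ (divr_gt0 e0 a0).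
  exists (fun x => a * u x); first exact: SZ.
  move=> x; rewrite -mulrBr Normc.normcM.
  apply: (@le_trans _ _ ((normc a + 1) * (e / (normc a + 1) * Phi b x))).
    by rewrite ler_pM ?normc_ge0 ?lerDl.
  by rewrite mulrA mulrCA mulfV ?gt_eqF// mulr1.
- move=> f hf e e0; have e2 : 0 < e / 2 by rewrite divr_gt0.
  have [g hg fg] := hf _ e2; have [u Su gu] := hg _ e2.
  exists u => // x; rewrite -(subrK (g x) (f x)) -addrA (le_trans (le_normcD _ _))//.
  by rewrite [e]splitr mulrDl lerD.
Qed.

Lemma ee_span Z (z : 'I_n -> R[i]) : (forall i, Z (z i)) -> span Z (ee z).
Proof.
move=> zZ; exists [:: (1, finfun z)].
  by move=> q; rewrite inE => /eqP -> i /=; rewrite ffunE.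
apply/funext => x; rewrite comb_cons comb_nil addr0 mul1r /ee.
by apply: eq_bigr => i _; rewrite ffunE.
Qed.

Lemma span_Phi_closure Z f : span Z f -> Phi_closure (span Z) f.
Proof.
by move=> Sf e e0; exists f => // x; rewrite subrr Normc.normc0 mulr_ge0 ?Phi_ge0 ?ltW.
Qed.

Section Accumulation.
Variables (Z : set R[i]) (z0 : R[i]) (r : R).
Hypothesis r_gt0 : 0 < r.
Hypothesis z0b : `|Re z0| + 2 * r <= b.
Hypothesis Z_strip : Z `<=` strip.
Hypothesis Z_acc : clusters_at Z z0.

Lemma ee_closure (z : 'I_n -> R[i]) :
  (forall i, normc (z i - z0) < r \/ Re (z i) = Re z0) -> Phi_closure (span Z) (ee z).
Proof.
apply: (ee_continuation (Phi_closure_closed Z) r_gt0 z0b Z_strip Z_acc) => {}z zZ.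
by apply: span_Phi_closure; exact: ee_span.
Qed.

Lemma comb_closure s : exponents_in [set z | normc (z - z0) < r] s ->
  Phi_closure (span Z) (comb s).
Proof.
have [M0 MD MZ _] := Phi_closure_closed Z.
elim: s => [|q s IH] sr.
  by rewrite (_ : comb [::] = fun=> 0)//; apply/funext => x; rewrite comb_nil.
have [qr {}/IH IH'] := (exponents_in_cons _ _ _).1 sr.
rewrite (_ : comb (q :: s) = fun x => q.1 * ee q.2 x + comb s x); last first.
  by apply/funext => x; rewrite comb_cons.
by apply: MD => //; apply: MZ; apply: ee_closure => i; left; exact: qr.
Qed.

(** A function is divided by the non-vanishing exponential at z0, which turns
the span into the trigonometric polynomials for a finite measure. *)
Theorem span_dense g (e : R) : cmeasurable g -> fin g -> 0 < e ->
  exists2 s, exponents_in Z s & small (fun x => g x - comb s x) e.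
Proof.
move=> mg /pfiniteE gfin e0.
have [M0 MD MZ _] := Phi_closure_closed Z.
pose e0' : E n -> R[i] := ee (fun=> z0).
have z0s : `|Re z0| <= b by rewrite (le_trans _ z0b)// lerDl mulr_ge0// ltW.
have e0'_le x : normc (e0' x) <= Phi b x by apply: ee_le_Phi.
have me0' : cmeasurable e0' by exact: cmeasurable_ee.
have e0'_neq0 x : e0' x != 0 by apply/prodf_neq0 => i _; exact: cexp_neq0.
have Mtrig u : trig u -> Phi_closure (span Z) (fun x => e0' x * u x).
  elim=> [xi||u1 u2 _ IH1 _ IH2|a u' _ IH].
  - rewrite (_ : (fun x => _) = ee (fun i => z0 + (0 +i* xi i))).
      by apply: ee_closure => i; right; rewrite ReD/= addr0.
    apply/funext => x; rewrite /e0' /character /ee -big_split/=.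
    by apply: eq_bigr => i _; rewrite -cexpD -mulrDl.
  - by under eq_fun do rewrite mulr0.
  - by under eq_fun do rewrite mulrDr; exact: MD.
  - by under eq_fun do rewrite mulrCA; exact: MZ.
pose v x := normc (e0' x) `^ p * wt x.
have mv : measurable_fun setT v.
  apply: measurable_funM => //; apply: measurable_powRp; exact: measurable_normc.
have v0 x : 0 <= v x by rewrite mulr_ge0 ?powR_ge0.
have vfin : (\int[lebn n]_x (v x)%:E < +oo)%E.
  rewrite (_ : \int[lebn n]_x _ = pint (lebn n) p wt e0')%E; last by rewrite pintE.
  move/pfiniteE: Phi_fin; apply: le_lt_trans.
  apply: (le_pint (lebn n) p_gt0 mwt wt_ge0 me0') => [|x].
    by apply: cmeasurable_real; exact: measurable_Phi.
  by rewrite normc_real (le_trans (e0'_le x))// ler_norm.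
pose h x := g x / e0' x.
have me0'V : cmeasurable (fun x => (e0' x)^-1).
  have := cmeasurable_ee (fun _ : 'I_n => - z0); congr cmeasurable; apply/funext => x.
  apply: (mulIf (e0'_neq0 x)); rewrite mulVf// /e0' /ee -big_split/= big1// => i _.
  by rewrite -cexpD -mulrDl addNr mul0r cexp0.
have mh : cmeasurable h by exact: cmeasurableM.
have transfer (u : E n -> R[i]) : pint (lebn n) p v (fun x => h x - u x)%R =
    pint (lebn n) p wt (fun x => g x - e0' x * u x)%R.
  rewrite !pintE; apply: eq_integral => x _; congr (_%:E).
  rewrite /v mulrA -powRM ?normc_ge0// -Normc.normcM; congr (_ `^ _ * _).
  by rewrite mulrBl [h x * _]divfK ?e0'_neq0// [u x * _]mulrC.
have hfin : pfinite (lebn n) p v h.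
  apply/pfiniteE; rewrite (_ : h = fun x => h x - 0); last by apply/funext => x; rewrite subr0.
  rewrite (transfer (fun=> 0)); apply: le_lt_trans gfin.
  by rewrite (_ : (fun x => _) = g)//; apply/funext => x; rewrite mulr0 subr0.
have [u tu /psmallE hu] := trig_dense p_gt0 mv v0 vfin mh hfin (tol_gt0 p e0).
have mPhi : cmeasurable (fun x : E n => (Phi b x)%:C).
  by apply: cmeasurable_real; exact: measurable_Phi.
have [k k0 hk] := pintZ_lt p_gt0 mwt wt_ge0 mPhi Phi_fin (tol_gt0 p e0).
have [w [s sZ ->] uw] := Mtrig u tu k k0.
have [mu _] := trig_meas_bdd tu.
exists s => //.
have meu : cmeasurable (fun x => e0' x * u x) by exact: cmeasurableM.
apply: (@pint_tri_lt _ _ _ _ p_gt0 mwt wt_ge0 g (fun x => e0' x * u x)) => //.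
- exact: cmeasurable_comb.
- by apply/psmallE; rewrite -transfer.
- apply: hk; first by apply: cmeasurableB => //; exact: cmeasurable_comb.
  by move=> x; rewrite normc_real ger0_norm ?Phi_ge0//; exact: uw.
Qed.

End Accumulation.
End Combinations.

(** * Construction of a hypercyclic vector *)

Section Hypercyclic.
Context {R : realType}.
Local Notation E n := (euclidean R n).
Notation Re := complex.Re.
Notation Im := complex.Im.
Notation normc := Normc.normc.
Variables (n : nat) (rho c b : R).
Hypothesis b_ge0 : 0 <= b.
Local Notation T := (@heat_semigroup R n rho c).
Local Notation word := (seq (R[i] * {ffun 'I_n -> R[i]})).
Local Notation ev := (fun z : {ffun 'I_n -> R[i]} => eigenvalue_of rho c (z : 'I_n -> R[i])).
Variables (Zm Zp : set R[i]) (z0 : R[i]) (r : R).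
Hypothesis r_gt0 : 0 < r.
Hypothesis z0b : `|Re z0| + 2 * r <= b.
Hypothesis Zm_strip : Zm `<=` strip b.
Hypothesis Zm_clusters : clusters_at Zm z0.
Hypothesis Zm_neg : forall z : {ffun 'I_n -> R[i]}, (forall i, Zm (z i)) -> Re (ev z) < 0.
Hypothesis Zp_near : Zp `<=` [set z | normc (z - z0) < r].
Hypothesis Zp_pos : forall z : {ffun 'I_n -> R[i]}, (forall i, Zp (z i)) -> 0 < Re (ev z).
Implicit Types (s y : word).

Lemma Zp_strip : Zp `<=` strip b.
Proof.
move=> z /Zp_near/= /ltW h; rewrite /strip/=.
have : `|Re (z - z0)| <= r by rewrite (le_trans _ h)// le_Re_normc.
rewrite ReD ReN => h'; rewrite (le_trans _ z0b)// -[Re z](subrK (Re z0)).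
by rewrite (le_trans (ler_normD _ _))// addrC lerD2l (le_trans h')// mulr_natl mulr2n lerDl ltW.
Qed.

Lemma exponents_in_sub (Z Z' : set R[i]) s : Z `<=` Z' -> exponents_in Z s -> exponents_in Z' s.
Proof. by move=> ZZ h q qs i; apply: ZZ; exact: h. Qed.

Lemma heat_subr t f g A B : 0 <= t -> dominated b A f -> dominated b B g ->
  T t (fun x => f x - g x) = fun x => T t f x - T t g x.
Proof.
move=> t0 df dg; pose N1 : R[i] := -1.
have -> : (fun x => f x - g x) = (fun x => f x + N1 * g x).
  by apply/funext => x; rewrite mulN1r.
rewrite (heatD rho c b_ge0 t0 df (dominatedZ N1 dg)) (heatZ rho c b_ge0 N1 t0 dg).
by apply/funext => x; rewrite mulN1r.
Qed.

(** The word y is run backwards in time, where it decays, and the small result is replaced by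
a word that decays forwards in time. *)
Lemma excursion s y (eta e : R) : exponents_in Zm s -> exponents_in Zp y -> 0 < eta -> 0 < e ->
  exists t z, [/\ 0 <= t, exponents_in Zm z, dominated b eta (comb z),
    dominated b e (fun x => T t (comb z) x - comb y x) & cnorm (flow rho c t s) <= e].
Proof.
move=> sZ yZ eta0 e0.
have [t1 t10 ht1] : exists2 t1, 0 <= t1 & forall t, t1 <= t -> cnorm (flow rho c (1 * t) s) <= e.
  by apply: flow_decay => // q qs; rewrite mul1r; apply: Zm_neg; exact: sZ.
have eta2 : 0 < eta / 2 by rewrite divr_gt0.
have [t2 t20 ht2] : exists2 t2, 0 <= t2 & forall t, t2 <= t -> cnorm (flow rho c (-1 * t) y) <= eta / 2.
  by apply: flow_decay => // q qs; rewrite mulN1r oppr_lt0; apply: Zp_pos; exact: yZ.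
pose t := Num.max t1 t2.
have t0 : 0 <= t by rewrite le_max t10.
have {}ht1 : cnorm (flow rho c t s) <= e by rewrite -[t]mul1r ht1// le_max lexx.
have {}ht2 : cnorm (flow rho c (- t) y) <= eta / 2 by rewrite -mulN1r ht2// le_max lexx orbT.
have yb := exponents_in_sub Zp_strip yZ.
pose u := flow rho c (- t) y.
have uZ : exponents_in Zp u by exact: exponents_in_flow.
have ub := exponents_in_sub Zp_strip uZ.
pose k := Num.min (eta / 2) (e / heat_const n rho c b t).
have k0 : 0 < k by rewrite lt_min eta2 divr_gt0// heat_const_gt0.
have [_ [z zZ ->] uz] := comb_closure r_gt0 z0b Zm_strip Zm_clusters (exponents_in_sub Zp_near uZ) k0.
have zb := exponents_in_sub Zm_strip zZ.
have dz := comb_dominated zb; have du := comb_dominated ub.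
have dzu : dominated b k (fun x => comb z x - comb u x).
  split=> [|x]; first by apply: cmeasurableB; exact: cmeasurable_comb.
  by rewrite -opprB normcN; exact: uz.
exists t, z; split => //.
- split=> [|x]; first exact: cmeasurable_comb.
  rewrite -(subrK (comb u x) (comb z x)) (le_trans (le_normcD _ _))//.
  rewrite [eta]splitr mulrDl lerD//.
    by rewrite (le_trans (dzu.2 x))// ler_wpM2r ?Phi_ge0// /k ge_min lexx.
  by rewrite (le_trans (du.2 x))// ler_wpM2r ?Phi_ge0.
- have yE : comb y = T t (comb u) by rewrite (heat_comb rho c b_ge0 t0 ub) flow_comp.
  have E x : T t (comb z) x - comb y x = T t (fun x => comb z x - comb u x) x.
    by rewrite yE (heat_subr t0 dz du).
  split=> [|x].
    apply: cmeasurableB; last exact: cmeasurable_comb.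
    by apply: cmeasurable_heat => //; exact: cmeasurable_comb.
  rewrite E (le_trans (heat_normc_le rho c b_ge0 t0 (ltW k0) dzu x))//.
  rewrite ler_wpM2r ?Phi_ge0// mulrC -ler_pdivlMr ?heat_const_gt0//.
  by rewrite /k ge_min lexx orbT.
Qed.

(** An increasing sequence of words, each correction being small with respect to all the
previous times. *)
Section Limit.
Variables (y_ : nat -> word) (eps_ : nat -> R).
Hypothesis y_Zp : forall k, exponents_in Zp (y_ k).
Hypothesis eps_gt0 : forall k, 0 < eps_ k.

Fixpoint stage (step : nat * (word * R) -> R * word) k : word * R :=
  if k is j.+1 then
    let st := stage step j in let q := step (j, st) in
    (st.1 ++ q.2, Num.min (st.2 / 2) (eps_ j / heat_const n rho c b q.1))
  else ([::], 1).

Lemma stages : exists (s_ : nat -> word) (eta_ t_ : nat -> R) (z_ : nat -> word),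
  forall k, [/\ (exponents_in Zm (s_ k) /\ 0 < eta_ k), s_ k.+1 = s_ k ++ z_ k,
    ((eta_ 0%N = 1 /\ s_ 0%N = [::]) /\ (eta_ k.+1 <= eta_ k / 2 /\ eta_ k.+1 * heat_const n rho c b (t_ k) <= eps_ k)),
    (0 <= t_ k /\ dominated b (eta_ k) (comb (z_ k))) &
    dominated b (eps_ k) (fun x => T (t_ k) (comb (z_ k)) x - comb (y_ k) x) /\
    cnorm (flow rho c (t_ k) (s_ k)) <= eps_ k].
Proof.
have /choice[step stepP] : forall a : nat * (word * R), exists q : R * word,
    exponents_in Zm a.2.1 -> 0 < a.2.2 ->
    [/\ 0 <= q.1, exponents_in Zm q.2, dominated b a.2.2 (comb q.2),
      dominated b (eps_ a.1) (fun x => T q.1 (comb q.2) x - comb (y_ a.1) x) &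
      cnorm (flow rho c q.1 a.2.1) <= eps_ a.1].
  move=> [k [s eta]] /=.
  have [[sZ eta0]|h] := pselect (exponents_in Zm s /\ 0 < eta).
    have [t [z hz]] := excursion sZ (@y_Zp k) eta0 (eps_gt0 k).
    by exists (t, z) => _ _.
  by exists (0, [::]) => sZ eta0; exfalso; apply: h.
have inv k : exponents_in Zm (stage step k).1 /\ 0 < (stage step k).2.
  elim: k => [|k [sZ eta0]]; first by split => //= q.
  have [_ zZ _ _ _] := stepP (k, stage step k) sZ eta0.
  split; first exact: exponents_in_cat.
  by rewrite /= lt_min divr_gt0// divr_gt0// heat_const_gt0.
exists (fun k => (stage step k).1), (fun k => (stage step k).2),
  (fun k => (step (k, stage step k)).1), (fun k => (step (k, stage step k)).2) => k.
have [sZ eta0] := inv k.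
have [t0 zZ dz dT hc] := stepP (k, stage step k) sZ eta0.
split => //; split => //; split; first by rewrite /= ge_min lexx.
by rewrite -ler_pdivlMr ?heat_const_gt0//= ge_min lexx orbT.
Qed.

(** At the time of index k the earlier corrections have decayed, the correction of
index k has become the target, and the later ones are still negligible. *)
Lemma limit_of_stages : exists2 v, dominated b 4 v & forall k, exists2 t, 0 <= t &
  dominated b (6 * eps_ k) (fun x => T t v x - comb (y_ k) x).
Proof.
have [s_ [eta_ [t_ [z_ H]]]] := stages.
have eta0 k : 0 < eta_ k by case: (H k) => -[].
have eta_half k : eta_ k.+1 <= eta_ k / 2 by case: (H k) => _ _ [_ []].
have sb k : exponents_in (strip b) (s_ k).
  by apply: exponents_in_sub Zm_strip _; case: (H k) => -[].
have zb k : exponents_in (strip b) (z_ k).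
  move=> q qz; apply: (sb k.+1); case: (H k) => _ -> _ _ _.
  by rewrite mem_cat qz orbT.
have incr k x : normc (comb (s_ k.+1) x - comb (s_ k) x) <= eta_ k * Phi b x.
  by case: (H k) => _ -> _ [_ dz] _; rewrite comb_cat addrAC subrr add0r; exact: dz.2.
have lim_part (g : R[i] -> R) : (forall z w, g (z - w) = g z - g w) ->
    (forall z, `|g z| <= normc z) ->
    exists l : E n -> R, forall k x, `|l x - g (comb (s_ k) x)| <= 2 * eta_ k * Phi b x.
  move=> gB g_le.
  have g_incr k x : `|g (comb (s_ k.+1) x) - g (comb (s_ k) x)| <= eta_ k * Phi b x.
    by rewrite -gB (le_trans (g_le _)).
  pose lo x k := g (comb (s_ k) x) - 2 * eta_ k * Phi b x.
  pose up x k := g (comb (s_ k) x) + 2 * eta_ k * Phi b x.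
  have half_Phi k (x : E n) : eta_ k.+1 * Phi b x <= eta_ k / 2 * Phi b x.
    by rewrite ler_wpM2r ?Phi_ge0.
  have upS x k : up x k.+1 <= up x k.
    move: (g_incr k x) (half_Phi k x); rewrite ler_norml => /andP[_ h1] h2.
    rewrite /up; lra.
  have loS x k : lo x k <= lo x k.+1.
    move: (g_incr k x) (half_Phi k x); rewrite ler_norml => /andP[h1 _] h2.
    rewrite /lo; lra.
  have lo_up x k : lo x k <= up x k.
    by have : 0 <= eta_ k * Phi b x; [rewrite mulr_ge0 ?Phi_ge0 ?ltW|rewrite /lo /up; lra].
  have lo_up2 x j k : lo x j <= up x k.
    apply: (@le_trans _ _ (lo x (maxn j k))).
      by have /nondecreasing_seqP := loS x; apply; exact: leq_maxl.
    apply: (@le_trans _ _ (up x (maxn j k))) => //.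
    by have /nonincreasing_seqP := upS x; apply; exact: leq_maxr.
  exists (fun x => sup (range (lo x))) => k x.
  rewrite ler_distl; apply/andP; split.
    apply: ub_le_sup; last by exists k.
    by exists (up x 0%N) => _ [j _ <-].
  by apply: ge_sup; [exists (lo x 0%N), 0%N|move=> _ [j _ <-]; exact: lo_up2].
have ReB (z w : R[i]) : Re (z - w) = Re z - Re w by rewrite ReD ReN.
have ImB (z w : R[i]) : Im (z - w) = Im z - Im w by rewrite ImD ImN.
have [re hre] := lim_part (@complex.Re R) ReB (@le_Re_normc R).
have [im him] := lim_part (@complex.Im R) ImB (@le_Im_normc R).
pose v x := re x +i* im x.
have vs k x : normc (v x - comb (s_ k) x) <= 4 * eta_ k * Phi b x.
  apply: (le_trans (normc_le_ReIm _)); rewrite ReB ImB/=.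
  by move: (hre k x) (him k x) => h1 h2; rewrite (le_trans (lerD h1 h2))//; lra.
have mv : cmeasurable v.
  apply: (@cmeasurable_lim _ _ (fun k => comb (s_ k))) => [k|x]; first exact: cmeasurable_comb.
  apply: (@squeeze_cvgr _ _ _ _ (fun=> 0) (fun k => 4 * Phi b x * 2^-1 ^+ k)); last 2 first.
  - exact: cvg_cst.
  - rewrite -[X in _ --> X](mulr0 (4 * Phi b x)); apply: cvgMr.
    by apply: cvg_expr; rewrite ger0_norm ?invr_ge0// invf_lt1 ?ltr1n.
  near=> k; rewrite normc_ge0/= (le_trans (vs k x))// mulrAC ler_wpM2l ?mulr_ge0 ?Phi_ge0//.
  elim: (k) => [|j IH]; first by rewrite expr0; case: (H 0%N) => _ _ [[-> _] _] _ _.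
  by rewrite (le_trans (eta_half j))// exprSr ler_wpM2r// invr_ge0.
have vsd k : dominated b (4 * eta_ k) (fun x => v x - comb (s_ k) x).
  by split => //; apply: cmeasurableB => //; exact: cmeasurable_comb.
have vd : dominated b 4 v.
  split => // x; have := vs 0%N x; case: (H 0%N) => _ _ [[-> ->] _] _ _.
  by rewrite comb_nil subr0 mulr1.
exists v => // k.
have [_ sE [_ [_ eta_hc]] [t0 dz] [dTz hc]] := H k.
exists (t_ k) => //; set t := t_ k in t0 eta_hc dTz hc *.
have ds := comb_dominated (sb k); have ds' := comb_dominated (sb k.+1).
have TsE : T t (comb (s_ k.+1)) = fun x => T t (comb (s_ k)) x + T t (comb (z_ k)) x.
  rewrite -(heatD rho c b_ge0 t0 ds dz); congr (T t _); apply/funext => x.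
  by rewrite sE comb_cat.
split=> [|x].
  apply: cmeasurableB; last exact: cmeasurable_comb.
  exact: cmeasurable_heat.
have -> : T t v x - comb (y_ k) x = T t (fun x => v x - comb (s_ k.+1) x) x +
    (T t (comb (s_ k)) x + (T t (comb (z_ k)) x - comb (y_ k) x)).
  by rewrite (heat_subr t0 vd ds') TsE [X in _ = _ + X]addrA [RHS]addrA subrK.
have -> : 6 * eps_ k * Phi b x = 4 * eps_ k * Phi b x + (eps_ k * Phi b x + eps_ k * Phi b x) by lra.
apply: (le_trans (le_normcD _ _)); apply: lerD.
  have e4 : 0 <= 4 * eta_ k.+1 by rewrite mulr_ge0// ltW.
  rewrite (le_trans (heat_normc_le rho c b_ge0 t0 e4 (vsd k.+1) x))//.
  by rewrite ler_wpM2r ?Phi_ge0// mulrCA ler_wpM2l// mulrC.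
apply: (le_trans (le_normcD _ _)); apply: lerD; last exact: dTz.2.
rewrite (heat_comb rho c b_ge0 t0 (sb k)).
have fb : exponents_in (strip b) (flow rho c t (s_ k)) by exact: exponents_in_flow.
rewrite (le_trans ((comb_dominated fb).2 x))//.
by rewrite ler_wpM2r ?Phi_ge0.
Unshelve. all: by end_near. Qed.
End Limit.
End Hypercyclic.

(** * A criterion for chaos *)

Section ChaosCriterion.
Context {R : realType}.
Local Notation E n := (euclidean R n).
Local Notation lebn := (@lebesgue_euclidean R).
Notation Re := complex.Re.
Notation Im := complex.Im.
Notation normc := Normc.normc.
Variables (n : nat) (rho c p b : R) (wt : E n -> R).
Hypothesis p_gt0 : 0 < p.
Hypothesis b_ge0 : 0 <= b.
Hypothesis mwt : measurable_fun setT wt.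
Hypothesis wt_ge0 : forall x, 0 <= wt x.
Hypothesis Phi_fin : pfinite (lebn n) p wt (fun x => (Phi b x)%:C).
Local Notation small := (psmall (lebn n) p wt).
Local Notation fin := (pfinite (lebn n) p wt).
Local Notation T := (@heat_semigroup R n rho c).
Local Notation word := (seq (R[i] * {ffun 'I_n -> R[i]})).
Local Notation code := (seq ((rat * rat) * {ffun 'I_n -> rat * rat})).
Local Notation ev := (fun z : {ffun 'I_n -> R[i]} => eigenvalue_of rho c (z : 'I_n -> R[i])).
Implicit Types (s : word) (w : code) (f g : E n -> R[i]).

Definition crat (q : rat * rat) : R[i] := ratr q.1 +i* ratr q.2.

Definition decode w : word :=
  [seq (crat q.1, [ffun i => crat (q.2 i)]) | q : (rat * rat) * {ffun 'I_n -> rat * rat} <- w].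

Lemma crat_dense (a : R[i]) (e : R) : 0 < e -> exists q, normc (a - crat q) <= e.
Proof.
move=> e0; have e2 : 0 < e / 2 by rewrite divr_gt0.
have real_dense (x : R) : exists q : rat, `|x - ratr q| <= e / 2.
  have lt_x : x - e / 2 < x + e / 2 by lra.
  have [q] := rat_in_itvoo lt_x.
  by rewrite in_itv/= => /andP[h1 h2]; exists q; rewrite ler_norml; lra.
have [q1 h1] := real_dense (Re a); have [q2 h2] := real_dense (Im a).
exists (q1, q2); rewrite (le_trans (normc_le_ReIm _))// ReD ImD ReN ImN/=.
by rewrite [leRHS]splitr lerD.
Qed.

Lemma decode_dense (Z : set R[i]) s (d : R) : Z `<=` strip b -> 0 < d ->
  exponents_in [set z | Z z /\ exists q, z = crat q] s ->
  exists2 w, exponents_in Z (decode w) & dominated b d (fun x => comb s x - comb (decode w) x).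
Proof.
move=> Zb; elim: s d => [|[a z] s IH] d d0 sZ.
  exists [::] => //; split => [|x]; first by apply: cmeasurableB; exact: cmeasurable_comb.
  by rewrite comb_nil subrr Normc.normc0 mulr_ge0 ?Phi_ge0 ?ltW.
have d2 : 0 < d / 2 by rewrite divr_gt0.
have [zZ {}/(IH _ d2)[w wZ [_ hw]]] := (exponents_in_cons _ _ _).1 sZ.
have /choice[zeta zetaE] : forall i, exists q, z i = crat q by move=> i; have [] := zZ i.
have [q hq] := crat_dense a d2.
have zE : [ffun i => crat ([ffun i => zeta i] i)] = z.
  by apply/ffunP => i; rewrite !ffunE zetaE.
exists ((q, [ffun i => zeta i]) :: w).
  by apply/exponents_in_cons; split => //= i; rewrite zE; exact: (zZ i).1.
split => [|x]; first by apply: cmeasurableB; exact: cmeasurable_comb.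
rewrite !comb_cons/= zE opprD addrACA -mulrBl (le_trans (le_normcD _ _))//.
rewrite [leRHS](_ : _ = d / 2 * Phi b x + d / 2 * Phi b x); last by rewrite -mulrDl -splitr.
rewrite lerD// Normc.normcM ler_pM ?normc_ge0//.
by apply: ee_le_Phi => i; apply: Zb; exact: (zZ i).1.
Qed.

Lemma psmall_subC f g e : small (fun x => f x - g x) e -> small (fun x => g x - f x) e.
Proof.
move=> /psmallE h; apply/psmallE; move: h; rewrite !pintE.
rewrite (_ : (fun x => _) = fun x => (normc (g x - f x) `^ p * wt x)%:E)//.
by apply/funext => x; rewrite -opprB normcN.
Qed.

Lemma dominated_small e : 0 < e -> exists2 k, 0 < k & forall f, dominated b k f -> small f e.
Proof.
move=> e0; have mPhi : cmeasurable (fun x : E n => (Phi b x)%:C).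
  by apply: cmeasurable_real; exact: measurable_Phi.
have [k k0 hk] := pintZ_lt p_gt0 mwt wt_ge0 mPhi Phi_fin e0.
exists k => // f [mf fk]; apply: hk => // x.
by rewrite normc_real ger0_norm ?Phi_ge0//; exact: fk.
Qed.

Section Hypercyclic.
Variables (Zm Zp : set R[i]) (z0 : R[i]) (r : R).
Hypothesis r_gt0 : 0 < r.
Hypothesis z0b : `|Re z0| + 2 * r <= b.
Hypothesis Zm_strip : Zm `<=` strip b.
Hypothesis Zm_clusters : clusters_at Zm z0.
Hypothesis Zm_neg : forall z : {ffun 'I_n -> R[i]}, (forall i, Zm (z i)) -> Re (ev z) < 0.
Hypothesis Zp_near : Zp `<=` [set z | normc (z - z0) < r].
Hypothesis Zp_pos : forall z : {ffun 'I_n -> R[i]}, (forall i, Zp (z i)) -> 0 < Re (ev z).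
Hypothesis Zp_clusters : clusters_at [set z | Zp z /\ exists q, z = crat q] z0.

(** The words with rational data and positive eigenvalues are countable and dense; the orbit
meets each of their neighbourhoods. *)
Theorem hypercyclic_vector : exists2 v, dominated b 4 v &
  forall g e, cmeasurable g -> fin g -> 0 < e ->
  exists t, [/\ 0 <= t, exists A, dominated b A (T t v) & small (fun x => T t v x - g x) e].
Proof.
(* Every word occurs with every tolerance in the enumeration. *)
pose y_ (k : nat) : word := let: (_, w) := odflt (0%N, [::]) (unpickle k : option (nat * code)) in
  if `[< exponents_in Zp (decode w) >] then decode w else [::].
pose eps_ (k : nat) : R := (odflt (0%N, [::]) (unpickle k : option (nat * code))).1.+1%:R^-1.
have y_Zp k : exponents_in Zp (y_ k).
  rewrite /y_; case: (odflt _ _) => _ w; case: asboolP => // _; by move=> q.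
have eps0 k : 0 < eps_ k by rewrite invr_gt0 ltr0n.
have [v vd hv] := limit_of_stages b_ge0 r_gt0 z0b Zm_strip Zm_clusters Zm_neg Zp_near Zp_pos y_Zp eps0.
exists v => // g e mg gfin e0.
have Zpb := Zp_strip r_gt0 z0b Zp_near.
have Zqb : [set z | Zp z /\ exists q, z = crat q] `<=` strip b by move=> z [/Zpb].
have e1 := tol_gt0 p e0.
have [s sZ gs] := span_dense p_gt0 mwt wt_ge0 Phi_fin r_gt0 z0b Zqb Zp_clusters mg gfin e1.
have [k k0 hk] := dominated_small e1.
have k2 : 0 < k / 2 by rewrite divr_gt0.
have [w wZ [mw hw]] := decode_dense Zpb k2 sZ.
pose m := Num.bound (12 / k).
have hm : 6 * m.+1%:R^-1 <= k / 2.
  rewrite ler_pdivrMr ?ltr0n// mulrAC ler_pdivlMr// -natr1 mulrDr.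
  have : 12 / k < m%:R by apply: archi_boundP; rewrite divr_ge0// ltW.
  rewrite ltr_pdivrMr// => h; lra.
have [t t0 [mt ht]] := hv (pickle (m, w)).
have yE : y_ (pickle (m, w)) = decode w by rewrite /y_ pickleK/=; case: asboolP.
have epsE : eps_ (pickle (m, w)) = m.+1%:R^-1 by rewrite /eps_ pickleK.
rewrite yE epsE in mt ht.
exists t; split => //.
  exists (heat_const n rho c b t * 4); split; last exact: heat_normc_le.
  by apply: cmeasurable_heat => //; case: vd.
have mTv : cmeasurable (T t v) by apply: cmeasurable_heat => //; case: vd.
apply: (pint_tri_lt p_gt0 mwt wt_ge0 mTv (cmeasurable_comb s) mg e0).
  apply: hk; split => [|x]; first by apply: cmeasurableB => //; exact: cmeasurable_comb.
  rewrite -(subrK (comb (decode w) x) (T t v x)) -addrA (le_trans (le_normcD _ _))//.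
  rewrite [leRHS](_ : _ = k / 2 * Phi b x + k / 2 * Phi b x); last by rewrite -mulrDl -splitr.
  rewrite lerD//; last by rewrite -opprB normcN; exact: hw.
  by rewrite (le_trans (ht x))// ler_wpM2r ?Phi_ge0.
exact: psmall_subC.
Qed.

End Hypercyclic.

Section Periodic.
Variables (Z : set R[i]) (z0 : R[i]) (r : R).
Hypothesis r_gt0 : 0 < r.
Hypothesis z0b : `|Re z0| + 2 * r <= b.
Hypothesis Z_strip : Z `<=` strip b.
Hypothesis Z_clusters : clusters_at Z z0.
Hypothesis Z_periodic : forall z : {ffun 'I_n -> R[i]}, (forall i, Z (z i)) ->
  exists q : rat, ev z = 0 +i* (2 * pi * ratr q).

Lemma cexp_2pi_nat (k : nat) : cexp (0 +i* (2 * pi * k%:R) : R[i]) = 1.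
Proof.
have -> : 2 * pi * k%:R = 0 + pi *+ 2 *+ k :> R by rewrite add0r mulr_natr mulr_natl.
apply: complexP; rewrite ?Re_cexp ?Im_cexp/= expR0 mul1r.
  by rewrite (periodicn (@cosD2pi R)) cos0.
by rewrite (periodicn (@sinD2pi R)) sin0.
Qed.

Lemma cexp_2pi_int (k : int) : cexp (0 +i* (2 * pi * k%:~R) : R[i]) = 1.
Proof.
case: k => k; first exact: cexp_2pi_nat.
rewrite NegzE; have := cexp_2pi_nat k.+1; set z := _ +i* _ => zE.
rewrite (_ : _ +i* _ = - z); last by apply: complexP => /=; rewrite ?oppr0// mulrNz mulrN.
by have := cexpD (- z) z; rewrite addNr cexp0 zE mulr1 => <-.
Qed.

(** The product of the denominators of the frequencies is a common period. *)
Lemma common_period s : exponents_in Z s -> exists2 N : nat, (0 < N)%N &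
  forall q, q \in s -> exists k : int, N%:R%:C * ev q.2 = 0 +i* (2 * pi * k%:~R).
Proof.
elim: s => [|q s IH] sZ; first by exists 1%N.
have [qZ {}/IH[N N0 hN]] := (exponents_in_cons _ _ _).1 sZ.
have [r' qE] := Z_periodic qZ.
have dn0 : (0 < `|denq r'|)%N by rewrite absz_gt0 denq_neq0.
exists (N * `|denq r'|)%N; first by rewrite muln_gt0 N0.
have split_nat z : (N * `|denq r'|)%:R%:C * z = (`|denq r'|)%:R%:C * (N%:R%:C * z) :> R[i].
  by rewrite mulrA -rmorphM/= natrM [_%:R * _]mulrC.
move=> q'; rewrite inE => /predU1P[->|/hN[k hk]].
  exists (N%:Z * numq r'); rewrite split_nat qE.
  apply: complexP; first by rewrite !ReZ/= !mulr0.
  rewrite !ImZ/= [in LHS]/ratr.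
  have dE : (`|denq r'|)%:R = (denq r')%:~R :> R by rewrite -[in RHS]absz_denq.
  rewrite dE intrM; have : (denq r')%:~R != 0 :> R by rewrite intr_eq0 denq_neq0.
  by move=> h; field.
exists (`|denq r'|%:Z * k); rewrite split_nat hk.
by apply: complexP; [rewrite ReZ/= mulr0|rewrite ImZ/= intrM mulrCA].
Qed.

Theorem periodic_dense g e : cmeasurable g -> fin g -> 0 < e ->
  exists u t, [/\ 0 < t, T t u = u, (exists A, dominated b A u) & small (fun x => u x - g x) e].
Proof.
move=> mg gfin e0.
have [s sZ gs] := span_dense p_gt0 mwt wt_ge0 Phi_fin r_gt0 z0b Z_strip Z_clusters mg gfin e0.
have sb : exponents_in (strip b) s by apply: exponents_in_sub Z_strip _.
have [N N0 hN] := common_period sZ.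
exists (comb s), N%:R; split.
- by rewrite ltr0n.
- rewrite (heat_comb rho c b_ge0 (ler0n _ N) sb); congr comb.
  rewrite /flow -[RHS]map_id; apply/eq_in_map => q /hN[k].
  by rewrite rmorph_nat => hk; rewrite hk cexp_2pi_int mulr1; case: q hk.
- by exists (cnorm s); exact: comb_dominated.
- exact: psmall_subC.
Qed.

End Periodic.
End ChaosCriterion.

(** * The hyperbola of purely imaginary eigenvalues *)

Section Hyperbola.
Context {R : realType}.
Notation Re := complex.Re.
Notation Im := complex.Im.
Notation normc := Normc.normc.
Variables (kappa a b : R).
Hypothesis a_gt0 : 0 < a.
Hypothesis a_b : a < b.
Hypothesis kappa_a : kappa < a ^+ 2.

Let h := Num.sqrt (a ^+ 2 - kappa).
Let z0 : R[i] := a +i* h.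
Let r := (b - a) / 2.

Lemma Re_sqr (z : R[i]) : Re (z ^+ 2) = Re z ^+ 2 - Im z ^+ 2.
Proof. by rewrite !expr2 ReM. Qed.

Lemma Im_sqr (z : R[i]) : Im (z ^+ 2) = 2 * Re z * Im z.
Proof. by rewrite expr2 ImM; lra. Qed.

Let h_gt0 : 0 < h. Proof. by rewrite sqrtr_gt0 subr_gt0. Qed.
Let h_sqr : h ^+ 2 = a ^+ 2 - kappa.
Proof. by rewrite sqr_sqrtr// subr_ge0 ltW. Qed.
Let r_gt0 : 0 < r. Proof. by rewrite divr_gt0// subr_gt0. Qed.

Lemma hyperbola_disc : `|Re z0| + 2 * r <= b.
Proof. by rewrite /= gtr0_norm// /r; lra. Qed.

Let sqr_lt (x y : R) : 0 <= x -> x < y -> x ^+ 2 < y ^+ 2.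
Proof. by move=> x0 xy; rewrite ltr_pXn2r ?nnegrE// (le_trans x0) ?ltW. Qed.

Let near_z0 (x y e : R) : `|x - a| < e / 2 -> `|y - h| < e / 2 -> normc ((x +i* y) - z0) < e.
Proof.
move=> hx hy; rewrite (le_lt_trans (normc_le_ReIm _))// ReD ImD ReN ImN/=.
by rewrite [ltRHS]splitr ltrD.
Qed.

Definition below_hyperbola : set R[i] := [set z | `|Re z| <= b /\ Re (z ^+ 2) < kappa].

Definition above_hyperbola : set R[i] := [set z | normc (z - z0) < r /\ kappa < Re (z ^+ 2)].

Definition rational_on_hyperbola : set R[i] :=
  [set z | `|Re z| <= b /\ Re (z ^+ 2) = kappa /\ exists q : rat, Im (z ^+ 2) = 2 * pi * ratr q].

Lemma below_clusters : clusters_at below_hyperbola z0.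
Proof.
move: (a_gt0) (a_b) (kappa_a) (h_gt0) => a0 ab ka h0 e e0; have e4 : 0 < e / 4 by lra.
exists (a +i* (h + e / 4)); split.
- split; first by rewrite /= gtr0_norm// ltW.
  rewrite Re_sqr/= sqrrD h_sqr; have := sqr_ge0 (e / 4); have := mulr_gt0 h_gt0 e4.
  by rewrite -mulr_natr; lra.
- by apply/eqP => -[] /eqP; lra.
- by apply: near_z0; rewrite ?subrr ?normr0 ?[_ - h]addrAC ?subrr ?add0r ?gtr0_norm//; lra.
Qed.

Lemma above_clusters : clusters_at [set z | above_hyperbola z /\ exists q, z = crat q] z0.
Proof.
move: (a_gt0) (a_b) (kappa_a) (h_gt0) (r_gt0) => a0 ab ka h0 r0 e e0.
pose d := Num.min (Num.min (e / 2) (r / 2)) h.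
have d0 : 0 < d by rewrite !lt_min h_gt0 (divr_gt0 e0)// (divr_gt0 r_gt0).
have de : d <= e / 2 by rewrite /d !ge_min lexx.
have dr : d <= r / 2 by rewrite /d !ge_min lexx orbT.
have dh : d <= h by rewrite /d !ge_min lexx !orbT.
have lt_a : a < a + d by lra.
have lt_h : h - d < h by lra.
have [q] := rat_in_itvoo lt_a; rewrite in_itv/= => /andP[q1 q2].
have [q'] := rat_in_itvoo lt_h; rewrite in_itv/= => /andP[q1' q2'].
set x : R := ratr q in q1 q2; set y : R := ratr q' in q1' q2'.
have xd : `|x - a| < d by rewrite gtr0_norm; lra.
have yd : `|y - h| < d by rewrite ltr0_norm; lra.
exists (x +i* y); split.
- split; last by exists (q, q').
  split.
    by apply: near_z0; apply: lt_le_trans dr.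
  rewrite Re_sqr/=; have -> : kappa = a ^+ 2 - h ^+ 2 by rewrite h_sqr; lra.
  have : a ^+ 2 < x ^+ 2 by apply: sqr_lt; lra.
  have : y ^+ 2 < h ^+ 2 by apply: sqr_lt; lra.
  lra.
- by apply/eqP => -[] /eqP; lra.
- by apply: near_z0; apply: lt_le_trans de.
Qed.

(** The imaginary part of the square is a non-constant continuous function along the hyperbola,
hence takes rational multiples of 2 pi arbitrarily close to z0. *)
Lemma rational_on_hyperbola_clusters : clusters_at rational_on_hyperbola z0.
Proof.
move: (a_gt0) (a_b) (kappa_a) (h_gt0) (r_gt0) => a0 ab ka h0 r0 e e0.
pose d := Num.min (Num.min (e / 4) (b - a)) (Num.min 1 (e * h / (4 * (2 * a + 1)))).
have d0 : 0 < d.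
  by rewrite !lt_min ltr01 !divr_gt0 ?mulr_gt0 ?subr_gt0//; lra.
have de : d <= e / 4 by rewrite /d !ge_min lexx.
have db : d <= b - a by rewrite /d !ge_min lexx orbT.
have d1 : d <= 1 by rewrite /d !ge_min lexx !orbT.
have dh : d * (2 * a + 1) <= e * h / 4.
  rewrite -ler_pdivlMr; last by lra.
  rewrite /d ge_min; apply/orP; right; rewrite ge_min; apply/orP; right.
  by rewrite invfM mulrA.
pose F (x : R) : R := x * Num.sqrt (x ^+ 2 - kappa).
have Fcont : {within `[a, a + d], continuous F}.
  apply: continuous_subspaceT => x; apply: cvgM; first exact: cvg_id.
  apply: (@continuous_comp _ _ _ (fun x : R => x ^+ 2 - kappa) Num.sqrt); last exact: sqrt_continuous.
  by apply: cvgB; [exact: exprn_continuous|exact: cvg_cst].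
have a2 : a ^+ 2 < (a + d) ^+ 2 by apply: sqr_lt; lra.
have F_lt : F a < F (a + d).
  rewrite /F; apply: (@lt_trans _ _ ((a + d) * h)).
    by rewrite ltr_pM2r//; lra.
  rewrite ltr_pM2l; last by lra.
  by rewrite ltr_sqrt ?subr_gt0; lra.
have pi0 : 0 < pi :> R by exact: pi_gt0.
have lt_F : F a / pi < F (a + d) / pi by rewrite ltr_pM2r ?invr_gt0.
have [q] := rat_in_itvoo lt_F; rewrite in_itv/= ltr_pdivrMr// ltr_pdivlMr// => /andP[q1 q2].
have ad : a <= a + d by lra.
have qF : Num.min (F a) (F (a + d)) <= ratr q * pi <= Num.max (F a) (F (a + d)).
  by rewrite ge_min le_max (ltW q1) (ltW q2) orbT.
have [x xad Fx] := IVT ad Fcont qF.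
move: xad; rewrite in_itv/= => /andP[ax xd].
have xk : kappa < x ^+ 2.
  by apply: (lt_le_trans kappa_a); rewrite ler_pXn2r ?nnegrE//; lra.
have x_neq : x != a by apply/eqP => xa; move: q1; rewrite -Fx xa ltxx.
set y := Num.sqrt (x ^+ 2 - kappa) in Fx.
have y2 : y ^+ 2 = x ^+ 2 - kappa by rewrite sqr_sqrtr// subr_ge0 ltW.
have hy : h <= y by apply: ler_wsqrtr; rewrite lerD2r ler_pXn2r ?nnegrE//; lra.
exists (x +i* y); split.
- split; first by rewrite /= ger0_norm; lra.
  split; first by rewrite Re_sqr/= y2; lra.
  by exists q; rewrite Im_sqr/= -mulrA -/y -[x * y]/(F x) Fx; lra.
- by apply: contra x_neq => /eqP[-> _].
- apply: near_z0; first by rewrite ger0_norm; lra.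
  rewrite ger0_norm ?subr_ge0//.
  have : h * (y - h) <= e * h / 4.
    apply: le_trans dh; apply: (@le_trans _ _ ((y - h) * (y + h))).
      by rewrite mulrC ler_wpM2l ?subr_ge0//; lra.
    have -> : (y - h) * (y + h) = (x - a) * (x + a).
      by rewrite -!subr_sqr y2 h_sqr; lra.
    by rewrite ler_pM//; lra.
  rewrite mulrC -ler_pdivlMr// => /le_lt_trans; apply.
  rewrite ltr_pdivrMr//; have := mulr_gt0 e0 h_gt0; lra.
Qed.

End Hyperbola.

(** * The heat semigroup under an exponential weight *)

Section Chaos.
Context {R : realType}.
Local Notation E n := (euclidean R n).
Local Notation lebn := (@lebesgue_euclidean R).
Notation Re := complex.Re.
Notation Im := complex.Im.
Variables (n : nat) (rho c p b : R) (wt : E n -> R).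
Hypothesis n_gt0 : (0 < n)%N.
Hypothesis p_gt0 : 0 < p.
Hypothesis b_gt0 : 0 < b.
Hypothesis b_kappa : (rho ^+ 2 - c) / n%:R < b ^+ 2.
Hypothesis mwt : measurable_fun setT wt.
Hypothesis wt_ge0 : forall x, 0 <= wt x.
Hypothesis Phi_fin : pfinite (lebn n) p wt (fun x => (Phi b x)%:C).
Local Notation small := (psmall (lebn n) p wt).
Local Notation fin := (pfinite (lebn n) p wt).
Local Notation T := (@heat_semigroup R n rho c).
Local Notation ev := (fun z : {ffun 'I_n -> R[i]} => eigenvalue_of rho c (z : 'I_n -> R[i])).
Implicit Types (f g : E n -> R[i]).

Let kappa := (rho ^+ 2 - c) / n%:R.

Let Re_ev (z : {ffun 'I_n -> R[i]}) : Re (ev z) = \sum_(i < n) (Re (z i ^+ 2) - kappa).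
Proof.
have n0 : n%:R != 0 :> R by rewrite pnatr_eq0 -lt0n.
rewrite /eigenvalue_of ReD Re_sum sumrB sumr_const card_ord -[kappa *+ n]mulr_natr /kappa divfK//=.
by rewrite addrC -opprB.
Qed.

Let Im_ev (z : {ffun 'I_n -> R[i]}) : Im (ev z) = \sum_(i < n) Im (z i ^+ 2).
Proof. by rewrite /eigenvalue_of ImD Im_sum/= add0r. Qed.

Let sum_gt0 (F : 'I_n -> R) : (forall i, 0 < F i) -> 0 < \sum_(i < n) F i.
Proof.
move=> F0; rewrite (bigD1 (Ordinal n_gt0))//= ltr_pwDl ?F0// sumr_ge0// => i _.
exact: ltW.
Qed.

(** For b^2 > (rho^2 - c) / n the strip |Re z| <= b meets the hyperbola
Re z^2 = (rho^2 - c) / n, along which no coordinate contributes to the growth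
rate. *)
Theorem heat_chaotic :
  (exists2 v, dominated b 4 v & forall g e, cmeasurable g -> fin g -> 0 < e ->
    exists t, [/\ 0 <= t, exists A, dominated b A (T t v) & small (fun x => T t v x - g x) e]) /\
  (forall g e, cmeasurable g -> fin g -> 0 < e ->
    exists u t, [/\ 0 < t, T t u = u, (exists A, dominated b A u) & small (fun x => u x - g x) e]).
Proof.
have b0 := ltW b_gt0.
pose a := Num.sqrt ((Num.max 0 kappa + b ^+ 2) / 2).
have m_lt : Num.max 0 kappa < b ^+ 2 by rewrite gt_max exprn_gt0.
have m0 : 0 <= Num.max 0 kappa by rewrite le_max lexx.
have mk : kappa <= Num.max 0 kappa by rewrite le_max lexx orbT.
have a0 : 0 < a by rewrite sqrtr_gt0; lra.
have a2 : a ^+ 2 = (Num.max 0 kappa + b ^+ 2) / 2 by rewrite sqr_sqrtr//; lra.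
have ab : a < b by rewrite -(ltr_pXn2r (n := 2)) ?nnegrE ?ltW// a2; lra.
have ka : kappa < a ^+ 2 by rewrite a2; lra.
have r0 : 0 < (b - a) / 2 by rewrite divr_gt0 ?subr_gt0.
have z0b := hyperbola_disc kappa b a0.
split.
  apply: (hypercyclic_vector p_gt0 b0 mwt wt_ge0 Phi_fin r0 z0b
    (Zm := below_hyperbola kappa b) (Zp := above_hyperbola kappa a b)).
  - by move=> z [].
  - exact: below_clusters.
  - move=> z zZ; rewrite Re_ev -oppr_gt0 -sumrN; apply: sum_gt0 => i.
    by rewrite oppr_gt0 subr_lt0; case: (zZ i).
  - by move=> z [].
  - by move=> z zZ; rewrite Re_ev; apply: sum_gt0 => i; rewrite subr_gt0; case: (zZ i).
  - exact: above_clusters.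
apply: (periodic_dense p_gt0 b0 mwt wt_ge0 Phi_fin r0 z0b (Z := rational_on_hyperbola kappa b)).
- by move=> z [].
- exact: rational_on_hyperbola_clusters.
- move=> z zZ.
  have /choice[q qE] : forall i, exists q : rat, Im (z i ^+ 2) = 2 * pi * ratr q.
    by move=> i; have [_ []] := zZ i.
  exists (\sum_(i < n) q i); apply: complexP.
    by rewrite Re_ev big1// => i _; have [_ [-> _]] := zZ i; rewrite subrr.
  by rewrite Im_ev/= rmorph_sum mulr_sumr; apply: eq_bigr.
Qed.

End Chaos.

(** * The integral defining the Macdonald function *)

Section MacdonaldIntegral.
Context {R : realType}.
Local Notation leb := (@lebesgue_measure R).

(** This majorant has an elementary antiderivative and the same integral for all z. *)
Definition majorant (z t : R) : R := z * (t + z ^+ 2) `^ (- (3 / 2)).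

Let pos (z t : R) : 0 < z -> 0 <= t -> 0 < t + z ^+ 2.
Proof. by move=> z0 t0; rewrite ltr_wpDl ?exprn_gt0. Qed.

Lemma measurable_majorant z : measurable_fun setT (majorant z : measurableTypeR R -> _).
Proof. by apply: measurable_funM => //; apply: measurable_powRp; exact: measurable_funD. Qed.

Let der_pow (z a t : R) : 0 < z -> 0 <= t ->
  der (fun t => (t + z ^+ 2) `^ a) t (a * (t + z ^+ 2) `^ (a - 1)).
Proof.
move=> z0 t0.
have d1 : der (fun t : R => t + z ^+ 2) t 1 by rewrite -[X in der _ _ X]addr0; exact: derD (derI _) (derC _ _).
have := @dercomp R (fun y => y `^ a) (fun y => a * y `^ (a - 1)) _ _ _ _ d1.
move=> /(_ (is_derive1_powR a (pos z0 t0))) h.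
by apply: (derE h); rewrite mul1r.
Qed.

Lemma integral_majorant (z : R) : 0 < z ->
  (\int[leb]_(t in `]0%R, +oo[) (majorant z t)%:E = 2%:E)%E.
Proof.
move=> z0; pose F t := -2 * z * (t + z ^+ 2) `^ (- (1 / 2)).
have dF t : 0 <= t -> der F t (majorant z t).
  move=> t0; have := derM (derC (-2 * z) t) (der_pow (- (1 / 2)) z0 t0).
  move=> h; apply: (derE h); rewrite /majorant mul0r add0r.
  rewrite (_ : - (1 / 2) - 1 = - (3 / 2) :> R); last by lra.
  by rewrite mulrA; congr (_ * _); lra.
have mF t : 0 <= t -> {for t, continuous (majorant z)}.
  by move=> t0; apply: (der_cont (derM (derC z t) (der_pow (- (3 / 2)) z0 t0))).
have cm : {within `[0, +oo[, continuous (majorant z)}.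
  apply: continuous_in_subspaceT => t; rewrite inE/= in_itv/= andbT; exact: mF.
have FT : F x @[x --> +oo%R] --> (0 : R).
  apply/cvgrPdist_lt => e e0.
  near=> t; rewrite sub0r normrN /F.
  have t0 : 0 <= t by near: t; exact: nbhs_pinfty_ge.
  have te : (2 * z / e) ^+ 2 < t by near: t; exact: nbhs_pinfty_gt (num_real _).
  have p0 := pos z0 t0.
  have q0 : 0 < 2 * z / e by rewrite divr_gt0 ?mulr_gt0.
  have hq : 2 * z / e < (t + z ^+ 2) `^ (1 / 2).
    rewrite div1r powR12_sqrt ?ltW// -(ger0_norm (ltW q0)) -sqrtr_sqr ltr_sqrt//.
    by rewrite (lt_le_trans te)// lerDl sqr_ge0.
  rewrite !mulNr normrN ger0_norm ?mulr_ge0 ?powR_ge0 ?(ltW z0)//.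
  by rewrite powRN ltr_pdivrMr ?powR_gt0// [ltRHS]mulrC -ltr_pdivrMr.
rewrite integral_itv_obnd_cbnd; last first.
  by apply/measurable_EFinP; apply: measurable_funTS; exact: measurable_majorant.
rewrite (@ge0_continuous_FTC2y _ (majorant z) F 0 0).
- have zz : (z ^+ 2) `^ (- (1 / 2)) = z^-1.
    by rewrite -(powR_mulrn 2 (ltW z0)) -powRrM (_ : _ * _ = -1) ?powR_inv1 ?ltW//; lra.
  have F0 : F 0 = -2 by rewrite /F (add0r (z ^+ 2)) zz mulfK ?gt_eqF.
  by rewrite F0 sub0e -EFinN opprK.
- by move=> t t0; rewrite mulr_ge0 ?powR_ge0 ?ltW.
- exact: cm.
- exact: FT.
- by move=> t /ltW/dF; exact: der_derivable.
- by apply: cvg_at_right_filter; exact: der_cont (dF _ (lexx _)).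
- by move=> t; rewrite in_itv/= andbT => /ltW/dF; exact: der_derive1.
Unshelve. all: by end_near. Qed.

Definition mac (nu z t : R) : R := expR (- (t + z ^+ 2 / (4 * t))) * t `^ (- nu - 1).

Lemma mac_ge0 nu z t : 0 <= mac nu z t.
Proof. by rewrite mulr_ge0 ?expR_ge0 ?powR_ge0. Qed.

Lemma macdonald_tilde_mac nu z : 0 < z ->
  macdonald_tilde nu z = z `^ nu * (2^-1 * (z / 2) `^ nu * \int[leb]_(t in `]0, +oo[) mac nu z t).
Proof. by rewrite /macdonald_tilde => ->. Qed.

Lemma powRD_pos (x r s : R) : 0 < x -> x `^ r * x `^ s = x `^ (r + s).
Proof. by move=> x0; rewrite powRD// (gt_eqF x0) implybT. Qed.

Lemma powRV1 (x a : R) : 0 < x -> a = -1 -> x `^ a = x^-1.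
Proof. by move=> x0 ->; rewrite powR_inv1// ltW. Qed.

(** In terms of u = z^2 / t the claim reads
u^nu exp (- eps u / 4) <= C u^(1/2) (1 + u)^(-3/2), where nu is at least 1/2. *)
Lemma mac_le_majorant nu eps : 2^-1 <= nu -> 0 < eps -> eps < 1 ->
  exists2 C, 0 < C & forall z t, 0 < z -> 0 < t ->
  z `^ nu * z `^ nu * mac nu z t <= C * expR (- ((1 - eps) * z)) * majorant z t.
Proof.
move=> nu2 e0 e1; pose m := Num.bound (nu + 1); pose r := eps / 4.
have r0 : 0 < r by rewrite divr_gt0.
have num : nu + 1 <= m%:R by apply/ltW/archi_boundP; lra.
pose C := m`!%:R * r^-1 ^+ m * expR r.
have fact0 : 0 < m`!%:R :> R by rewrite ltr0n fact_gt0.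
exists C => [|z t z0 t0]; first by rewrite !mulr_gt0 ?exprn_gt0 ?invr_gt0 ?expR_gt0.
pose u := z ^+ 2 / t.
have u0 : 0 < u by rewrite divr_gt0 ?exprn_gt0.
have u1 : 1 <= 1 + u by rewrite lerDl ltW.
have u1' : 0 < 1 + u by lra.
have z2E : z ^+ 2 = u * t by rewrite /u divfK ?gt_eqF.
have zE : z = u `^ 2^-1 * t `^ 2^-1.
  by rewrite -powRM ?ltW// -z2E -powR_mulrn ?ltW// -powRrM divff// powRr1 ?ltW.
have zz : z `^ nu * z `^ nu = u `^ nu * t `^ nu.
  by rewrite -powRM ?ltW// -expr2 z2E powRM ?ltW.
have tt : t `^ nu * t `^ (- nu - 1) = t^-1.
  by rewrite powRD_pos//; apply: powRV1 => //; lra.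
have majE : majorant z t = t^-1 * (u `^ 2^-1 * (1 + u) `^ (- (3 / 2))).
  rewrite /majorant z2E (_ : t + u * t = t * (1 + u)); last by lra.
  have tt' : t `^ 2^-1 * t `^ (- (3 / 2)) = t^-1.
    by rewrite powRD_pos//; apply: powRV1 => //; lra.
  by rewrite powRM ?ltW// {1}zE -tt'; ring.
have expo : expR (- (t + z ^+ 2 / (4 * t))) <= expR (- ((1 - eps) * z)) * expR (- (r * u)).
  rewrite -expRD ler_expR.
  have -> : z ^+ 2 / (4 * t) = u / 4 by rewrite /u invfM mulrA mulrAC.
  have amgm : z <= t + u / 4.
    have tu0 : 0 <= t + u / 4 by lra.
    have sq : z ^+ 2 <= (t + u / 4) ^+ 2.
      rewrite z2E -subr_ge0 (_ : _ - _ = (t - u / 4) ^+ 2) ?sqr_ge0//; by field.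
    by rewrite -(ler_pXn2r (n := 2)) ?nnegrE// ltW.
  have h1 : (1 - eps) * z <= (1 - eps) * (t + u / 4) by apply: ler_wpM2l amgm; lra.
  have h2 : 0 <= eps * t by rewrite mulr_ge0 ?ltW.
  rewrite /r; lra.
have key : u `^ nu * expR (- (r * u)) <= C * (u `^ 2^-1 * (1 + u) `^ (- (3 / 2))).
  have -> : u `^ nu = u `^ 2^-1 * u `^ (nu - 2^-1).
    by rewrite powRD_pos//; congr (_ `^ _); lra.
  rewrite -mulrA [C * _]mulrCA ler_wpM2l ?powR_ge0// powRN ler_pdivlMr ?powR_gt0//.
  apply: (@le_trans _ _ ((1 + u) `^ (nu - 2^-1) * expR (- (r * u)) * (1 + u) `^ (3 / 2))).
    rewrite !ler_wpM2r ?powR_ge0 ?expR_ge0//.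
    apply: ge0_ler_powR; rewrite ?nnegrE ?(ltW u0) ?(ltW u1')//; lra.
  rewrite mulrAC powRD_pos// expRN ler_pdivrMr ?expR_gt0//.
  apply: (@le_trans _ _ ((1 + u) ^+ m)).
    rewrite -(powR_mulrn m (ltW u1')); apply: ler_powR => //; lra.
  have := @powr_fact_le R r (1 + u) m r0 (ltW u1').
  rewrite ler_pdivrMr// => /le_trans; apply.
  rewrite mulrDr mulr1 expRD /C mulrA mulrC !mulrA.
  by rewrite [m`!%:R * _]mulrC -!mulrA.
set E := expR (- (t + _)) in expo; set e1' := expR (- ((1 - eps) * z)) in expo *.
set X := u `^ 2^-1 * _ in key majE.
have -> : z `^ nu * z `^ nu * mac nu z t = t^-1 * (u `^ nu * E).
  by rewrite zz /mac -/E -tt; ring.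
have ti : 0 <= t^-1 by rewrite invr_ge0 ltW.
apply: (@le_trans _ _ (t^-1 * (u `^ nu * (e1' * expR (- (r * u)))))).
  by rewrite !ler_wpM2l ?powR_ge0.
have -> : t^-1 * (u `^ nu * (e1' * expR (- (r * u)))) = t^-1 * e1' * (u `^ nu * expR (- (r * u))) by ring.
have -> : C * e1' * majorant z t = t^-1 * e1' * (C * X) by rewrite majE; ring.
by rewrite ler_wpM2l// mulr_ge0 ?expR_ge0.
Qed.

End MacdonaldIntegral.

(** * Two-sided bounds for the Macdonald function *)

Section MacdonaldBounds.
Context {R : realType}.
Local Notation leb := (@lebesgue_measure R).
Variable nu : R.
Hypothesis nu_ge : 2^-1 <= nu.

Lemma measurable_mac_indic :
  measurable_fun setT (fun x : measurableTypeR R * measurableTypeR R =>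
    (mac nu x.1 \_ (`]0, +oo[%classic : set (measurableTypeR R))) x.2).
Proof.
have mfst : measurable_fun setT (fun x : measurableTypeR R * measurableTypeR R => x.1 : R) by exact: measurable_fst.
have msnd : measurable_fun setT (fun x : measurableTypeR R * measurableTypeR R => x.2 : R) by exact: measurable_snd.
rewrite (_ : (fun x => _) = fun x : measurableTypeR R * measurableTypeR R => if 0 < (x.2 : R) then
    expR (- (x.2 + x.1 ^+ 2 * (4 * x.2) `^ (-1))) * x.2 `^ (- nu - 1) else 0).
  apply: measurable_fun_ifT; do ?[exact: measurable_cst].
    exact: (measurable_fun_ltr (measurable_cst _) msnd).
  apply: measurable_funM; last exact: measurable_powRp.
  apply: measurableT_comp => //; apply: measurableT_comp => //; apply: measurable_funD => //.
  apply: measurable_funM; first exact: measurable_funX.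
  by apply: measurable_powRp; exact: measurable_funM.
apply/funext => x; rewrite patchE; case: ifPn.
  rewrite inE/= in_itv/= andbT => x0; rewrite x0 /mac powR_inv1//.
  by rewrite mulr_ge0// ltW.
rewrite notin_setE/= in_itv/= andbT => x0; case: ifPn => // h; exfalso; exact: x0.
Qed.

Lemma measurable_mac z : measurable_fun (`]0, +oo[%classic : set (measurableTypeR R)) (mac nu z).
Proof.
apply/measurable_restrictT => //.
exact: (measurableT_comp measurable_mac_indic (pair1_measurable (z : measurableTypeR R))).
Qed.

Lemma measurable_macdonald_tilde : measurable_fun setT (macdonald_tilde nu : measurableTypeR R -> R).
Proof.
apply: measurable_fun_ifT.
- exact: (measurable_fun_ltr (measurable_cst _) (@measurable_id _ _ setT)).
- apply: measurable_funM; first exact: measurable_powRp.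
  apply: measurable_funM.
    by apply: measurable_funM => //; apply: measurable_powRp; exact: measurable_funM.
  have := measurable_Rintegral_param leb measurable_mac_indic; congr measurable_fun.
  by apply/funext => z; rewrite [RHS]Rintegral_mkcond.
- exact: measurable_cst.
Qed.

Lemma macdonald_tilde_pull z : 0 < z -> macdonald_tilde nu z =
  2^-1 * (2^-1 `^ nu) * (z `^ nu * z `^ nu * \int[leb]_(t in `]0, +oo[) mac nu z t).
Proof.
by move=> z0; rewrite macdonald_tilde_mac// powRM ?ltW ?invr_gt0//; ring.
Qed.

Let I z := (\int[leb]_(t in `]0%R, +oo[) (mac nu z t)%:E)%E.

Lemma integral_mac_le eps : 0 < eps -> eps < 1 -> exists2 C, 0 < C & forall z, 0 < z ->
  (I z <= (C * expR (- ((1 - eps) * z)) / (z `^ nu * z `^ nu))%:E)%E.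
Proof.
move=> e0 e1; have [C C0 h] := mac_le_majorant nu_ge e0 e1.
exists (C * 2); first by rewrite mulr_gt0.
move=> z z0; have zz : 0 < z `^ nu * z `^ nu by rewrite mulr_gt0 ?powR_gt0.
pose k := C * expR (- ((1 - eps) * z)) / (z `^ nu * z `^ nu).
have k0 : 0 <= k.
  by apply: mulr_ge0; [rewrite mulr_ge0 ?expR_ge0 ?(ltW C0)|rewrite invr_ge0 (ltW zz)].
apply: (@le_trans _ _ (\int[leb]_(t in `]0%R, +oo[) (k%:E * (majorant z t)%:E))%E).
  apply: ge0_le_integral => //.
  - by move=> t _; rewrite lee_fin mac_ge0.
  - by apply/measurable_EFinP; exact: measurable_mac.
  - apply: emeasurable_funM => //; apply/measurable_EFinP; apply: measurable_funTS.
    exact: measurable_majorant.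
  - move=> t; rewrite /= in_itv/= andbT => t0.
    by rewrite -EFinM lee_fin /k mulrAC ler_pdivlMr// mulrC h.
rewrite ge0_integralZl_EFin//; last 2 first.
- move=> t; rewrite /= in_itv/= andbT => t0.
  by rewrite lee_fin mulr_ge0 ?powR_ge0 ?ltW.
- by apply/measurable_EFinP; apply: measurable_funTS; exact: measurable_majorant.
rewrite integral_majorant// -EFinM lee_fin /k.
by rewrite mulrAC [C * expR _ * 2]mulrAC.
Qed.

Lemma integral_mac_fin z : 0 < z -> I z \is a fin_num.
Proof.
move=> z0; have h2 : 0 < 2^-1 :> R by rewrite invr_gt0.
have h21 : 2^-1 < 1 :> R by lra.
have [C C0 h] := integral_mac_le h2 h21.
rewrite ge0_fin_numE; last by apply: integral_ge0 => t _; rewrite lee_fin mac_ge0.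
exact: le_lt_trans (h z z0) (ltry _).
Qed.

Lemma macdonald_tilde_le eps : 0 < eps -> eps < 1 -> exists2 C, 0 < C & forall z, 0 < z ->
  macdonald_tilde nu z <= C * expR (- ((1 - eps) * z)).
Proof.
move=> e0 e1; have [C C0 h] := integral_mac_le e0 e1.
have c0 : 0 < 2^-1 * 2^-1 `^ nu :> R by rewrite mulr_gt0 ?powR_gt0 ?invr_gt0.
exists (2^-1 * 2^-1 `^ nu * C) => [|z z0]; first by rewrite mulr_gt0.
have zz : 0 < z `^ nu * z `^ nu by rewrite mulr_gt0 ?powR_gt0.
rewrite macdonald_tilde_pull// -[leRHS]mulrA ler_wpM2l ?(ltW c0)// [leLHS]mulrC -ler_pdivlMr//.
by rewrite -lee_fin /Rintegral fineK ?integral_mac_fin// h.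
Qed.

Lemma mac_window z u w k : 0 < z -> 0 < u -> u <= w -> (forall t, u <= t -> t <= w -> k <= mac nu z t) ->
  0 <= k -> k * (w - u) <= \int[leb]_(t in `]0, +oo[) mac nu z t.
Proof.
move=> z0 u0 uw hk k0; rewrite -lee_fin /Rintegral fineK ?integral_mac_fin//.
apply: (@le_trans _ _ (\int[leb]_(t in `[u, w]) (mac nu z t)%:E)%E).
  apply: (@le_trans _ _ (\int[leb]_(t in `[u, w]) (cst k%:E t))%E).
    rewrite integral_cst//= lebesgue_measure_itv/=; case: ifPn => h.
      by rewrite EFinM EFinB.
    rewrite mule0 lee_fin; move: h; rewrite lte_fin -leNgt => wu.
    by rewrite (_ : w - u = 0) ?mulr0//; apply/eqP; rewrite subr_eq0 eq_le wu.
  apply: ge0_le_integral => //.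
  - apply/measurable_EFinP; apply: measurable_funS (measurable_mac z) => //.
    by move=> t; rewrite /= !in_itv/= andbT => /andP[/(lt_le_trans u0)].
  - by move=> t; rewrite /= in_itv/= => /andP[h1 h2]; rewrite lee_fin hk.
apply: ge0_subset_integral => //.
- by apply/measurable_EFinP; exact: measurable_mac.
- by move=> t _; rewrite lee_fin mac_ge0.
- by move=> t; rewrite /= !in_itv/= andbT => /andP[/(lt_le_trans u0)].
Qed.

Lemma mac_lower z t w a : 0 < z -> 0 < t -> t <= w -> t + z ^+ 2 / (4 * t) <= a ->
  expR (- a) * w `^ (- nu - 1) <= mac nu z t.
Proof.
move=> z0 t0 tw h; rewrite /mac ler_pM ?expR_ge0 ?powR_ge0//.
  by rewrite ler_expR lerN2.
have e : - nu - 1 = - (nu + 1) by lra.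
rewrite e !powRN lef_pV2 ?posrE ?powR_gt0//; last exact: lt_le_trans tw.
apply: ge0_ler_powR; rewrite ?nnegrE ?(ltW t0) ?(ltW (lt_le_trans t0 tw))//.
by move: (nu_ge) => h'; lra.
Qed.

(** The integrand is concentrated around t = z / 2 with width of order sqrt z; for z below 1
the interval from z^2 to 2 z^2 suffices. *)
Lemma macdonald_tilde_ge : exists2 c, 0 < c & forall z, 0 < z ->
  c * ((1 + z) `^ (nu - 2^-1) * expR (- z)) <= macdonald_tilde nu z.
Proof.
move: (nu_ge) => nu2.
pose k0 : R := 2^-1 * 2^-1 `^ nu.
have k00 : 0 < k0 by rewrite mulr_gt0 ?powR_gt0 ?invr_gt0.
pose c1 := k0 * (expR (- 2) * (3 / 2) `^ (- nu - 1)) * 2^-1 `^ (nu - 2^-1).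
pose c2 := k0 * (expR (- (9 / 4)) * 2 `^ (- nu - 1)) * 2^-1 `^ (nu - 2^-1).
have h2 : 0 < 2^-1 :> R by rewrite invr_gt0.
have c10 : 0 < c1 by rewrite !mulr_gt0 ?expR_gt0 ?powR_gt0.
have c20 : 0 < c2 by rewrite !mulr_gt0 ?expR_gt0 ?powR_gt0.
have pw (x y : R) : 0 <= x -> x <= y -> x `^ (nu - 2^-1) <= y `^ (nu - 2^-1).
  by move=> x0 xy; apply: ge0_ler_powR; rewrite ?nnegrE ?(le_trans x0 xy)//; lra.
exists (Num.min c1 c2); first by rewrite lt_min c10.
move=> z z0; have [z1|z1] := lerP 1 z.
  apply: (@le_trans _ _ (c1 * ((1 + z) `^ (nu - 2^-1) * expR (- z)))).
    by rewrite ler_wpM2r ?mulr_ge0 ?powR_ge0 ?expR_ge0// ge_min lexx.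
  rewrite macdonald_tilde_pull// -/k0.
  pose k := expR (- (z + 2)) * (3 / 2 * z) `^ (- nu - 1).
  have sz : Num.sqrt z <= z.
    rewrite -[leRHS]ger0_norm ?(ltW z0)// -sqrtr_sqr ler_wsqrtr// expr2.
    by rewrite ler_peMr// ltW.
  have s0 : 0 < Num.sqrt z by rewrite sqrtr_gt0.
  (* On the window from z / 2 to z / 2 + sqrt z the exponent exceeds z by at most 2. *)
  have win : k * (z / 2 + Num.sqrt z - z / 2) <= \int[leb]_(t in `]0, +oo[) mac nu z t.
    apply: mac_window => //; rewrite ?divr_gt0 ?lerDl ?(ltW s0)//.
      move=> t t1 t2; have t0 : 0 < t by rewrite (lt_le_trans _ t1)// divr_gt0.
      apply: mac_lower => //; first by lra.
      rewrite -subr_le0 (_ : _ - _ = ((t - z / 2) ^+ 2 - 2 * t) / t); last by field; rewrite gt_eqF.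
      rewrite pmulr_lle0 ?invr_gt0// subr_le0.
      have : (t - z / 2) ^+ 2 <= Num.sqrt z ^+ 2 by rewrite ler_pXn2r ?nnegrE//; lra.
      rewrite sqr_sqrtr ?(ltW z0)//; lra.
    by rewrite mulr_ge0 ?expR_ge0 ?powR_ge0.
  rewrite addrAC subrr add0r in win.
  have zz : 0 <= z `^ nu * z `^ nu by rewrite mulr_ge0 ?powR_ge0.
  have := ler_wpM2l (ltW k00) (ler_wpM2l zz win); apply: le_trans.
  have -> : k0 * (z `^ nu * z `^ nu * (k * Num.sqrt z)) =
      k0 * (expR (- 2) * (3 / 2) `^ (- nu - 1)) * (z `^ (nu - 2^-1) * expR (- z)).
    have zE : z `^ nu * z `^ (- nu - 1) * Num.sqrt z * z `^ nu = z `^ (nu - 2^-1).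
      rewrite -powR12_sqrt ?(ltW z0)// !powRD_pos//; congr (_ `^ _); lra.
    rewrite -zE /k opprD expRD powRM ?divr_ge0 ?(ltW z0)//; ring.
  rewrite /c1 -[leLHS]mulrA ler_wpM2l//.
    by rewrite !mulr_ge0 ?(ltW k00) ?expR_ge0 ?powR_ge0.
  rewrite mulrA -powRM ?(ltW h2)//; last by lra.
  by rewrite ler_wpM2r ?expR_ge0// pw//; lra.
apply: (@le_trans _ _ (c2 * ((1 + z) `^ (nu - 2^-1) * expR (- z)))).
  by rewrite ler_wpM2r ?mulr_ge0 ?powR_ge0 ?expR_ge0// ge_min lexx orbT.
rewrite macdonald_tilde_pull// -/k0.
pose k := expR (- (9 / 4)) * (2 * z ^+ 2) `^ (- nu - 1).
have z20 : 0 < z ^+ 2 by rewrite exprn_gt0.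
have z21 : z ^+ 2 <= 1 by rewrite -[leRHS](expr1n _ 2) ler_pXn2r ?nnegrE// ltW.
have win : k * (2 * z ^+ 2 - z ^+ 2) <= \int[leb]_(t in `]0, +oo[) mac nu z t.
  apply: mac_window => //; first by lra.
    move=> t t1 t2; have t0 : 0 < t by rewrite (lt_le_trans _ t1).
    apply: mac_lower => //.
    have : z ^+ 2 / (4 * t) <= 1 / 4.
      by rewrite ler_pdivrMr ?mulr_gt0//; lra.
    lra.
  by rewrite mulr_ge0 ?expR_ge0 ?powR_ge0.
have zz : 0 <= z `^ nu * z `^ nu by rewrite mulr_ge0 ?powR_ge0.
have := ler_wpM2l (ltW k00) (ler_wpM2l zz win); apply: le_trans.
have -> : k0 * (z `^ nu * z `^ nu * (k * (2 * z ^+ 2 - z ^+ 2))) =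
    k0 * (expR (- (9 / 4)) * 2 `^ (- nu - 1)).
  have zE : z `^ nu * z `^ nu * ((z ^+ 2) `^ (- nu - 1) * z ^+ 2) = 1.
    rewrite -powRM ?(ltW z0)// -expr2 -{3}[z ^+ 2]powRr1 ?(ltW z20)// !powRD_pos//.
    by rewrite (_ : nu + _ = 0) ?powRr0//; lra.
  rewrite /k powRM ?(ltW z20)//.
  set A := (z ^+ 2) `^ _ in zE *; set B := 2 `^ _; set Z := z `^ nu in zE *; set X := expR _.
  have -> : k0 * (Z * Z * (X * (B * A) * (2 * z ^+ 2 - z ^+ 2))) =
      k0 * (X * B) * (Z * Z * (A * z ^+ 2)) by ring.
  by rewrite zE mulr1.
rewrite /c2 -[leLHS]mulrA -[leRHS]mulr1 ler_wpM2l//.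
  by rewrite !mulr_ge0 ?(ltW k00) ?expR_ge0 ?powR_ge0.
rewrite mulrA -powRM ?(ltW h2)//; last by lra.
rewrite -[leRHS]mulr1 ler_pM ?powR_ge0 ?expR_ge0//.
  have := pw (2^-1 * (1 + z)) 1; rewrite powR1; apply; lra.
by rewrite -expR0 ler_expR oppr_le0 ltW.
Qed.

End MacdonaldBounds.

(** * Chaos above the critical value *)

Section Weight.
Context {R : realType}.
Local Notation leb := (@lebesgue_measure R).
Local Notation lebn := (@lebesgue_euclidean R).
Local Notation E n := (euclidean R n).
Notation normc := Normc.normc.

Lemma integral_expR_norm_fin (d : R) : 0 < d -> (\int[leb]_x (expR (- d * `|x|))%:E < +oo)%E.
Proof.
move=> d0; have cf : continuous (fun x : R => expR (- d * `|x|)).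
  move=> x; apply: (@continuous_comp _ _ _ (fun x : R => - d * `|x|) expR); last exact: continuous_expR.
  by apply: cvgMr; exact: norm_continuous.
rewrite (@ge0_symfun_integralT R (fun x => expR (- d * `|x|))) => [||//|]; last 2 first.
- by move=> x; exact: expR_ge0.
- by move=> x /=; rewrite normrN.
rewrite -set_itvcy.
have dF x : der (fun x => - d^-1 * expR (- d * x)) x (expR (- d * x)).
  have dl : der (fun x : R => - d * x) x (- d).
    by have := derlin (- d) x; under eq_fun do rewrite mulrC.
  apply: (derE (derM (derC (- d^-1) x) (derexp dl))).
  by rewrite mul0r add0r mulrA mulrNN mulVf ?gt_eqF// mul1r.
rewrite (_ : \int[leb]_(x in _) _ = (\int[leb]_(x in `[0%R, +oo[) (expR (- d * x))%:E))%E; last first.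
  by apply: eq_integral => x; rewrite inE/= in_itv/= andbT => x0; rewrite ger0_norm.
rewrite (@ge0_continuous_FTC2y R (fun x => expR (- d * x)) (fun x => - d^-1 * expR (- d * x)) 0 0).
- by rewrite -EFinB -EFinM ltry.
- by move=> x _; exact: expR_ge0.
- apply: continuous_subspaceT => x; apply: (@continuous_comp _ _ _ (fun x : R => - d * x) expR).
    by apply: cvgMr; exact: cvg_id.
  exact: continuous_expR.
- rewrite -[X in _ --> X](mulr0 (- d^-1)); apply: cvgMr.
  apply/cvgrPdist_lt => e e0; near=> x.
  rewrite sub0r normrN gtr0_norm ?expR_gt0// mulNr expRN -[ltRHS]invrK ltf_pV2 ?posrE ?invr_gt0 ?expR_gt0//.
  apply: (@lt_le_trans _ _ (1 + d * x)); last exact: expR_ge1Dx.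
  have : (e^-1 / d) < x by near: x; exact: nbhs_pinfty_gt (num_real _).
  by rewrite ltr_pdivrMr// mulrC => h; rewrite ltr_wpDl.
- by move=> x _; exact: der_derivable (dF x).
- by apply: cvg_at_right_filter; exact: der_cont (dF 0).
- by move=> x _; exact: der_derive1 (dF x).
Unshelve. all: by end_near. Qed.

Lemma integral_Phi_fin n (d : R) : 0 < d -> (\int[lebn n]_x (Phi (- d) x)%:E < +oo)%E.
Proof.
move=> d0; have I0 : (0 <= \int[leb]_t (expR (- d * `|t|))%:E)%E.
  by apply: integral_ge0 => t _; rewrite lee_fin expR_ge0.
rewrite /Phi (@ge0_integral_prod _ n (fun _ s => expR (- d * `|s|))); last 2 first.
- by move=> i; exact: measurable_expR_norm.
- by move=> i t; exact: expR_ge0.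
apply: (@le_lt_trans _ _ (\prod_(i < n) fine (\int[leb]_t (expR (- d * `|t|))%:E))%:E); last exact: ltry.
apply: prode_le => // i; rewrite fineK// ge0_fin_numE//; exact: integral_expR_norm_fin.
Qed.

(** The Cauchy-Schwarz inequality, as the variance of the |x_i| being nonnegative. *)
Lemma l1_le_enorm n (x : E n) : \sum_(i < n) `|tnth x i : R| <= Num.sqrt n%:R * enorm x.
Proof.
set s := \sum_(i < n) _; have s0 : 0 <= s by apply: sumr_ge0.
case: (posnP n) => [n0|n0].
  have -> : s = 0 by rewrite /s; move: (x); rewrite n0 => y; rewrite big_ord0.
  by rewrite mulr_ge0 ?sqrtr_ge0.
rewrite -(ger0_norm s0) -sqrtr_sqr -(ger0_norm (enorm_ge0 x)) -(sqrtr_sqr (enorm x)).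
rewrite -sqrtrM// ler_wsqrtr// enorm_sqr.
have nR : 0 < n%:R :> R by rewrite ltr0n.
have : 0 <= \sum_(i < n) (n%:R * `|tnth x i : R| - s) ^+ 2 by apply: sumr_ge0 => i _; exact: sqr_ge0.
have -> : \sum_(i < n) (n%:R * `|tnth x i : R| - s) ^+ 2 =
    n%:R * (n%:R * (\sum_(i < n) (tnth x i : R) ^+ 2) - s ^+ 2).
  have e i : (n%:R * `|tnth x i : R| - s) ^+ 2 =
      n%:R ^+ 2 * (tnth x i : R) ^+ 2 - (2 * n%:R * s) * `|tnth x i : R| + s ^+ 2.
    by rewrite -[in RHS](real_normK (num_real (tnth x i))); ring.
  under eq_bigr do rewrite e.
  rewrite big_split sumrB/= -!mulr_sumr -/s sumr_const card_ord -mulr_natr; ring.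
by rewrite pmulr_rge0// subr_ge0.
Qed.

Lemma measurable_enorm n : measurable_fun setT (@enorm R n).
Proof.
have -> : @enorm R n = fun x => (\sum_(i < n) (tnth x i : R) ^+ 2) `^ 2^-1.
  by apply/funext => x; rewrite powR12_sqrt// -enorm_sqr sqr_ge0.
apply: measurable_powRp; apply: measurable_sum => i.
by apply: (measurable_coord (f := fun y : R => y ^+ 2)); exact: exprn_measurable.
Qed.

Section Exponent.
Variables (n : nat) (rho p : R).
Hypothesis n_gt0 : (0 < n)%N.
Hypothesis rho_gt0 : 0 < rho.
Hypothesis p_ge1 : 1 <= p.
Local Notation gamma := (gammap p%:E).

Definition weight (x : E n) : R := macdonald_tilde (n%:R / 2) (rho * enorm x) `^ (gamma * p).

Lemma weight_ge0 x : 0 <= weight x. Proof. exact: powR_ge0. Qed.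

Lemma half_n : 2^-1 <= n%:R / 2 :> R.
Proof. by rewrite ler_peMl ?invr_ge0// ler1n. Qed.

Lemma measurable_weight : measurable_fun setT weight.
Proof.
apply: measurable_powRp; apply: (measurableT_comp (measurable_macdonald_tilde _)).
by apply: measurable_funM => //; exact: measurable_enorm.
Qed.

Let p_gt0 : 0 < p. Proof. exact: lt_le_trans p_ge1. Qed.

Lemma Lrho_normE f : Lrho_norm rho p%:E f = (pint (lebn n) p weight f `^ p^-1)%E.
Proof. by []. Qed.

Lemma Lrho_norm_lt f e : 0 < e ->
  (Lrho_norm rho p%:E f < e%:E)%E <-> psmall (lebn n) p weight f (e `^ p).
Proof.
move=> e0; have pV0 : 0 < p^-1 by rewrite invr_gt0.
have pp (x : R) : 0 <= x -> (x `^ p) `^ p^-1 = x.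
  by move=> x0; rewrite -powRrM divff ?gt_eqF// powRr1.
have pp' (x : R) : 0 <= x -> (x `^ p^-1) `^ p = x.
  by move=> x0; rewrite -powRrM mulVf ?gt_eqF// powRr1.
rewrite psmallE Lrho_normE.
have := pint_ge0 (lebn n) p weight_ge0 f.
case: (pint (lebn n) p weight f) => [r r0||].
- rewrite poweR_EFin !lte_fin lee_fin in r0 *; split => h.
    rewrite -[ltLHS](pp' _ r0); apply: gt0_ltr_powR => //; rewrite ?nnegrE ?powR_ge0//; exact: ltW.
  rewrite -[ltRHS](pp _ (ltW e0)); apply: gt0_ltr_powR => //; rewrite ?nnegrE ?powR_ge0//.
- by move=> _; rewrite poweRyr ?gt_eqF.
- by rewrite leeNy_eq.
Qed.

Lemma Lrho_norm_fin f : (Lrho_norm rho p%:E f < +oo)%E <-> pfinite (lebn n) p weight f.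
Proof.
rewrite pfiniteE Lrho_normE; split; first by apply: lty_poweRy; rewrite gt_eqF// invr_gt0.
exact: poweR_lty.
Qed.

Lemma LrhoE f : Lrho n rho p%:E f <-> cmeasurable f /\ pfinite (lebn n) p weight f.
Proof. by rewrite /Lrho/= Lrho_norm_fin. Qed.

Lemma Lrho_norm0 : Lrho_norm rho p%:E (fun _ : E n => 0 : R[i]) = 0%E :> \bar R.
Proof.
rewrite Lrho_normE pintE.
under eq_integral do rewrite Normc.normc0 powR0 ?gt_eqF// mul0r.
by rewrite integral0 poweR0r// gt_eqF// invr_gt0.
Qed.

(** At the origin the weight is whatever the limit in its definition is; the
constant takes care of this point. *)
Lemma weight_le eps : 0 < eps -> eps < 1 -> 0 < gamma ->
  exists2 C, 0 < C & forall x, weight x <=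
    C * Phi (- ((1 - eps) * rho * (gamma * p) / Num.sqrt n%:R)) x.
Proof.
move=> e0 e1 g0; have [C C0 h] := macdonald_tilde_le half_n e0 e1.
have gp0 : 0 < gamma * p by rewrite mulr_gt0.
have n0 : 0 < Num.sqrt n%:R :> R by rewrite sqrtr_gt0 ltr0n.
pose D := Num.max (C `^ (gamma * p)) (macdonald_tilde (n%:R / 2) 0 `^ (gamma * p)).
have CD : C `^ (gamma * p) <= D by rewrite le_max lexx.
have D0 : 0 < D by rewrite (lt_le_trans _ CD)// powR_gt0.
exists D => // x; set s := (1 - eps) * rho * (gamma * p) / _.
have e1' : 0 <= 1 - eps by lra.
have s0 : 0 <= s.
  by apply: mulr_ge0 (mulr_ge0 (mulr_ge0 e1' (ltW rho_gt0)) (ltW gp0)) _; rewrite invr_ge0 ltW.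
have [xn|xn] := ltrP 0 (enorm x); last first.
  have en : enorm x = 0 by apply/eqP; rewrite eq_le xn enorm_ge0.
  rewrite PhiE (_ : - s * _ = 0); last first.
    have := l1_le_enorm x; rewrite en mulr0 => h1.
    by rewrite (_ : \sum_(i < n) _ = 0) ?mulr0//; apply/eqP; rewrite eq_le h1 sumr_ge0.
  by rewrite expR0 mulr1 /weight en mulr0 /D le_max lexx orbT.
have rx : 0 < rho * enorm x by rewrite mulr_gt0.
apply: (@le_trans _ _ ((C * expR (- ((1 - eps) * (rho * enorm x)))) `^ (gamma * p))).
  apply: ge0_ler_powR; rewrite ?nnegrE ?(ltW gp0) ?h// ?mulr_ge0 ?expR_ge0 ?(ltW C0)//.
  have [c c0 hc] := macdonald_tilde_ge half_n.
  by rewrite (le_trans _ (hc _ rx))// !mulr_ge0 ?(ltW c0) ?powR_ge0 ?expR_ge0.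
rewrite powRM ?expR_ge0 ?(ltW C0)// ler_pM ?powR_ge0//.
rewrite -expRM PhiE ler_expR !mulNr lerN2.
rewrite (_ : (1 - eps) * (rho * enorm x) * (gamma * p) = s * (Num.sqrt n%:R * enorm x)).
  by rewrite ler_wpM2l// l1_le_enorm.
rewrite [RHS]mulrA /s divfK ?gt_eqF//; ring.
Qed.

(** The weight decays at every rate below sigma p in |x|, and |x|_1 is at most
sqrt n times |x|. *)
Lemma Phi_pfinite b : 0 < b -> b ^+ 2 * n%:R < (gamma * rho) ^+ 2 ->
  pfinite (lebn n) p weight (fun x => (Phi b x)%:C).
Proof.
move=> b0 bs; have n0 : 0 < Num.sqrt n%:R :> R by rewrite sqrtr_gt0 ltr0n.
have g0 : 0 < gamma.
  have gge : 0 <= gamma by exact: normr_ge0.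
  rewrite lt_def gge andbT; apply/eqP => gE; move: bs; rewrite gE mul0r expr0n/=.
  by rewrite ltNge mulr_ge0// sqr_ge0.
have s0 : 0 < gamma * rho by rewrite mulr_gt0.
have bn : b * Num.sqrt n%:R < gamma * rho.
  rewrite -(ltr_pXn2r (n := 2)) ?nnegrE ?mulr_ge0 ?(ltW b0) ?(ltW n0) ?(ltW g0) ?(ltW rho_gt0)//.
  by rewrite exprMn sqr_sqrtr.
pose eps := (1 - b * Num.sqrt n%:R / (gamma * rho)) / 2.
have q1 : b * Num.sqrt n%:R / (gamma * rho) < 1 by rewrite ltr_pdivrMr// mul1r.
have q0 : 0 < b * Num.sqrt n%:R / (gamma * rho) by rewrite divr_gt0 ?mulr_gt0.
have e0 : 0 < eps by rewrite /eps; lra.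
have e1 : eps < 1 by rewrite /eps; lra.
have [C C0 h] := weight_le e0 e1 g0.
set s := (1 - eps) * _ * _ / _ in h.
have bp : b * p < s.
  rewrite /s ltr_pdivlMr// mulrA -[ltLHS]mulrA [p * _]mulrC mulrA ltr_pM2r//.
  have : b * Num.sqrt n%:R / (gamma * rho) < 1 - eps by rewrite /eps; lra.
  by rewrite ltr_pdivrMr// => /lt_le_trans; apply; rewrite mulrAC mulrA.
apply/pfiniteE; rewrite pintE.
apply: (@le_lt_trans _ _ (\int[lebn n]_x (C%:E * (Phi (- (s - b * p)) x)%:E))%E).
  apply: ge0_le_integral => //.
  - by move=> x _; rewrite lee_fin mulr_ge0 ?powR_ge0.
  - apply: (measurable_pint _ measurable_weight); apply: cmeasurable_real; exact: measurable_Phi.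
  - by apply: measurable_funeM; apply/measurable_EFinP; exact: measurable_Phi.
  move=> x _; rewrite -EFinM lee_fin normc_real ger0_norm ?Phi_ge0//.
  have -> : Phi b x `^ p = Phi (b * p) x by rewrite !PhiE -expRM; congr expR; ring.
  rewrite (_ : - (s - b * p) = b * p + - s); last by lra.
  by rewrite PhiD [leRHS]mulrCA ler_wpM2l ?Phi_ge0.
rewrite ge0_integralZl_EFin ?(ltW C0)//; last 2 first.
- by move=> x _; rewrite lee_fin Phi_ge0.
- by apply/measurable_EFinP; exact: measurable_Phi.
by rewrite lte_mul_pinfty ?lee_fin ?(ltW C0)// integral_Phi_fin// subr_gt0.
Qed.

End Exponent.

(** The condition on c says that (rho^2 - c) / n < sigma^2 / n for
sigma = gamma_p rho, which leaves room for b^2 in between. *)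
Theorem chaotic_above_critical n (rho p c : R) : (0 < n)%N -> 0 < rho -> 1 <= p -> p != 2 ->
  critical rho p%:E < c ->
  chaotic (Lrho n rho p%:E) (Lrho_norm rho p%:E) (heat_semigroup rho c).
Proof.
move=> n0 rho0 p1 p2 hc; have p0 : 0 < p by exact: lt_le_trans p1.
have nR : 0 < n%:R :> R by rewrite ltr0n.
pose m := (Num.max 0 (rho ^+ 2 - c) + (gammap p%:E * rho) ^+ 2) / 2.
have g0 : 0 < gammap p%:E :> R.
  rewrite lt_def normr_ge0 andbT normr_eq0 subr_eq0; apply: contra p2 => /eqP h.
  by rewrite -(divfK (lt0r_neq0 p0) 2) h mul1r.
have lt_max : Num.max 0 (rho ^+ 2 - c) < (gammap p%:E * rho) ^+ 2.
  rewrite gt_max; apply/andP; split; first by rewrite exprn_gt0 ?mulr_gt0.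
  by move: hc; rewrite /critical exprMn; lra.
have max0 : 0 <= Num.max 0 (rho ^+ 2 - c) by rewrite le_max lexx.
have maxr : rho ^+ 2 - c <= Num.max 0 (rho ^+ 2 - c) by rewrite le_max lexx orbT.
have m0 : 0 < m by rewrite /m; lra.
pose b := Num.sqrt (m / n%:R).
have b0 : 0 < b by rewrite sqrtr_gt0 divr_gt0.
have b2 : b ^+ 2 = m / n%:R by rewrite sqr_sqrtr// divr_ge0 ?(ltW m0)// ltW.
have b_kappa : (rho ^+ 2 - c) / n%:R < b ^+ 2 by rewrite b2 ltr_pM2r ?invr_gt0// /m; lra.
have b_s : b ^+ 2 * n%:R < (gammap p%:E * rho) ^+ 2 by rewrite b2 divfK ?gt_eqF// /m; lra.
have Pfin := Phi_pfinite n0 rho0 p1 b0 b_s.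
have mw : measurable_fun setT (@weight n rho p) by exact: measurable_weight.
have w0 := @weight_ge0 n rho p.
have [[v vd vH] per] := heat_chaotic n0 p0 b0 b_kappa mw w0 Pfin.
have LE f : Lrho n rho p%:E f <-> cmeasurable f /\ pfinite (lebn n) p (weight rho p) f by exact: LrhoE.
have inL (f : E n -> R[i]) : (exists A, dominated b A f) -> Lrho n rho p%:E f.
  move=> [A [mf fA]]; apply/LE; split => //; apply/pfiniteE.
  move/pfiniteE: Pfin => Pfin'.
  have mP : cmeasurable (fun x : E n => (Phi b x)%:C).
    by apply: cmeasurable_real; exact: measurable_Phi.
  have mh : measurable_fun setT (fun x : E n => `|A| * Phi b x).
    by apply: measurable_funM => //; exact: measurable_Phi.
  have fh x : normc (f x) <= `|A| * Phi b x.
    by rewrite (le_trans (fA x))// ler_wpM2r ?Phi_ge0// ler_norm.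
  apply: (le_lt_trans (le_pint_real (lebn n) p0 mw w0 mf mh fh)).
  rewrite (_ : \int[lebn n]_x _ = (`|A| `^ p)%:E * pint (lebn n) p (weight rho p)
      (fun x => (Phi b x)%:C))%E; first by rewrite lte_mul_pinfty ?lee_fin ?powR_ge0.
  rewrite pintE -ge0_integralZl_EFin ?powR_ge0//.
  - apply: eq_integral => x _; rewrite -EFinM normc_real (ger0_norm (Phi_ge0 _ _)) mulrA -powRM//.
    exact: Phi_ge0.
  - by move=> x _; rewrite lee_fin mulr_ge0 ?powR_ge0.
  - exact: measurable_pint.
have Nlt (f : E n -> R[i]) e : 0 < e ->
    (Lrho_norm rho p%:E f < e%:E)%E <-> psmall (lebn n) p (weight rho p) f (e `^ p) by exact: Lrho_norm_lt.
split.
  exists v; first by apply: inL; exists 4.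
  move=> g /LE[mg gfin] e e0.
  have [t [t0 TA ts]] := vH g (e `^ p) mg gfin (powR_gt0 p e0).
  exists (heat_semigroup rho c t v); split; first exact: inL.
    by exists t.
  exact/Nlt.
move=> g /LE[mg gfin] e e0.
have [u [t [t0 Tu ud us]]] := per g (e `^ p) mg gfin (powR_gt0 p e0).
exists u; split; [exact: inL| |exact/Nlt].
split; first exact: inL.
exists t => //; rewrite Tu -(Lrho_norm0 n rho p1); congr (Lrho_norm _ _ _).
by apply/funext => x /=; rewrite subrr.
Qed.

End Weight.

(** * The space of bounded functions *)

Section NoHypercyclicBounded.
Context {R : realType}.
Local Notation lebn := (@lebesgue_euclidean R).
Local Notation E n := (euclidean R n).
Notation Re := complex.Re.
Notation normc := Normc.normc.

Lemma ae_box n (P : E n -> Prop) (a b : R) : {ae lebn n, forall x, P x} -> a < b ->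
  exists2 x, P x & forall i, a < (tnth x i : R) < b.
Proof.
move=> [N [mN N0 PN]] ab; apply: contrapT => h.
pose Q := [set x : E n | forall i, `]a, b[%classic (tnth x i : R)].
have QN : Q `<=` N.
  by move=> x Qx; apply: PN => /= Px; apply: h; exists x.
have mQ : (lebn n Q = \prod_(i < n) (b - a)%:E)%E.
  rewrite [LHS](lebesgue_euclidean_box (A := fun _ => `]a, b[%classic)); last by move=> i; exact: measurable_itv.
  by apply: eq_bigr => i _; rewrite lebesgue_measure_itv/= lte_fin ab EFinB.
have Q0 : (0 < lebn n Q)%E.
  rewrite mQ; elim/big_rec: _ => [|i x _ x0]; first exact: lte01.
  by rewrite mule_gt0// lte_fin subr_gt0.
have mQ' : measurable Q.
  rewrite (_ : Q = \big[setI/setT]_(i < n) ((fun x : E n => tnth x i) @^-1` `]a, b[%classic)).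
    apply: bigsetI_measurable => i _; rewrite -[X in measurable X]setTI.
    exact: measurable_tnth.
  apply/seteqP; split => x /=.
    by move=> Ax; rewrite -bigcap_seq => i _ /=; exact: Ax.
  by rewrite -bigcap_seq => Ax i; apply: Ax; rewrite /= mem_index_enum.
have : (lebn n Q <= lebn n N)%E by apply: le_measure; rewrite ?inE.
by rewrite N0 leNgt Q0.
Qed.

Lemma gauss_shift_le (t x y : R) : 0 < t -> `|x| <= 1 ->
  gauss t (x - y) <= gauss t 0 * expR (t + 1) * expR (- 1 * `|y|).
Proof.
move=> t0 x1; rewrite /gauss expr0n/= oppr0 mul0r expR0 mulr1 -[leRHS]mulrA ler_wpM2l ?powR_ge0//.
rewrite -expRD ler_expR.
have h : `|y| <= `|x - y| + 1.
  have := ler_distD x y 0; rewrite !subr0 [`|y - x|]distrC => /le_trans; apply.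
  by rewrite lerD2l.
have sq : 0 <= (`|x - y| - 2 * t) ^+ 2 / (4 * t) by rewrite divr_ge0 ?sqr_ge0// mulr_ge0// ltW.
have e : (`|x - y| - 2 * t) ^+ 2 / (4 * t) = (x - y) ^+ 2 / (4 * t) - `|x - y| + t.
  by rewrite -[in RHS](real_normK (num_real (x - y))); field; rewrite gt_eqF.
rewrite mulNr; lra.
Qed.

(** Dominated convergence: a multiple of Phi (-1) |f| dominates for base points in
the unit cube. *)
Lemma kernel_cvg n (t : R) (f : E n -> R) (x_ : nat -> E n) (x : E n) : 0 < t ->
  measurable_fun setT f -> (\int[lebn n]_y (Phi (- 1) y * `|f y|)%:E < +oo)%E ->
  (forall k i, `|tnth (x_ k) i : R| <= 1) -> (forall i, `|tnth x i : R| <= 1) ->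
  (forall i, (tnth (x_ k) i : R) @[k --> \oo] --> (tnth x i : R)) ->
  \int[lebn n]_y (heat_kernel t (esub (x_ k) y) * f y) @[k --> \oo] -->
    \int[lebn n]_y (heat_kernel t (esub x y) * f y).
Proof.
move=> t0 mf fin x1 x1' xx.
pose C := (gauss t 0 * expR (t + 1)) ^+ n.
have mk z : measurable_fun setT (fun y : E n => heat_kernel t (esub z y) * f y).
  by apply: measurable_funM => //; exact: measurable_heat_kernel.
have mG : measurable_fun setT (fun y : E n => C * (Phi (- 1) y * `|f y|)).
  apply: measurable_funM => //; apply: measurable_funM; first exact: measurable_Phi.
  exact: measurableT_comp.
have C0 : 0 <= C by rewrite exprn_ge0// mulr_ge0 ?gauss_ge0 ?expR_ge0.
have G0 y : 0 <= C * (Phi (- 1) y * `|f y|) by rewrite !mulr_ge0 ?Phi_ge0.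
have iG : intble (lebn n) (fun y : E n => C * (Phi (- 1) y * `|f y|)).
  apply: intbleZ; apply: intble_ge0 => //.
    apply: measurable_funM; first exact: measurable_Phi.
    exact: measurableT_comp.
  by move=> y; rewrite mulr_ge0 ?Phi_ge0.
have dom z y : (forall i, `|tnth z i : R| <= 1) ->
    `|heat_kernel t (esub z y) * f y| <= C * (Phi (- 1) y * `|f y|).
  move=> z1; rewrite normrM mulrA ler_wpM2r// ger0_norm ?heat_kernel_ge0// heat_kernelE//.
  have -> : C * Phi (- 1) y = \prod_(i < n) (gauss t 0 * expR (t + 1) * expR (- 1 * `|tnth y i : R|)).
    by rewrite big_split/= prodr_const card_ord.
  by apply: ler_prod => i _; rewrite gauss_ge0 gauss_shift_le.
have gc : continuous (gauss t : R -> R).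
  move=> z; apply: cvgMr; apply: (@continuous_comp _ _ _ (fun z : R => - z ^+ 2 / (4 * t)) expR).
    by apply: cvgMl; apply: cvgN; exact: exprn_continuous.
  exact: continuous_expR.
have cv y : heat_kernel t (esub (x_ k) y) * f y @[k --> \oo] --> heat_kernel t (esub x y) * f y.
  have cvp (r : seq 'I_n) : \prod_(i <- r) gauss t (tnth (x_ k) i - tnth y i) @[k --> \oo] -->
      \prod_(i <- r) gauss t (tnth x i - tnth y i).
    elim: r => [|i r IH].
      rewrite big_nil (_ : (fun k => _) = fun=> 1); first exact: cvg_cst.
      by apply/funext => k; rewrite big_nil.
    rewrite big_cons (_ : (fun k => _) = fun k => gauss t (tnth (x_ k) i - tnth y i) *
      \prod_(i <- r) gauss t (tnth (x_ k) i - tnth y i)); last first.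
      by apply/funext => k; rewrite big_cons.
    apply: cvgM IH; apply: continuous_cvg; first exact: gc.
    by apply: cvgB; [exact: xx|exact: cvg_cst].
  apply: cvgMl; rewrite heat_kernelE//.
  by under eq_fun do rewrite heat_kernelE//; exact: cvp.
have ix : intble (lebn n) (fun y => heat_kernel t (esub x y) * f y).
  apply: (intble_le (mk x) _ iG) => y.
  exact: dom.
apply: fine_cvg; rewrite fineK; last exact: integrable_fin_num ix.
apply: (@dominated_cvg _ _ _ (lebn n) setT measurableT _ _ (fun y => (C * (Phi (- 1) y * `|f y|))%:E)) => //.
- by move=> k; apply/measurable_EFinP; exact: mk.
- by move=> y _; apply/fine_cvgP; split; [exact: nearW|exact: cv].
- by move=> k y _; rewrite lee_fin dom.
Unshelve. all: by end_near. Qed.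

Lemma Re_heat n (rho c t : R) (f : E n -> R[i]) x : 0 < t ->
  Re (heat_semigroup rho c t f x) =
  expR (t * (c - rho ^+ 2)) * \int[lebn n]_y (heat_kernel t (esub x y) * Re (f y)).
Proof.
move=> t0; rewrite heat_semigroupE// ReZ; congr (_ * _).
by apply: eq_Rintegral => y _; rewrite ReZ.
Qed.

(** After a positive time the elements of the orbit are continuous, so that neither the jump
function nor a multiple of it can be approximated by them in the supremum norm; and the initial
vector itself is not close to both. *)
Theorem not_hypercyclic_bounded n (rho c : R) : (0 < n)%N ->
  ~ hypercyclic (Lrho n rho +oo%E) (Lrho_norm rho +oo%E) (heat_semigroup rho c).
Proof.
move=> n0 [v [mv vfin] vdense]; pose i0 := Ordinal n0.
pose jump (a : R) (x : E n) : R[i] := (if 0 <= (tnth x i0 : R) then a else - a)%:C.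
have mu0 : (0 < lebn n setT)%E.
  rewrite lt0e measure_ge0 andbT; apply/eqP => h.
  have F : {ae lebn n, forall x, (fun _ : E n => False) x}.
    by exists setT; split => //; exact: measurableT.
  by have [] := @ae_box n (fun=> False) 0 1 F ltr01.
have njump a x : normc (jump a x) = `|a|.
  by rewrite normc_real; case: ifP => // _; rewrite normrN.
have jumpL a : Lrho n rho +oo%E (jump a).
  split; last first.
    apply: (@le_lt_trans _ _ `|a|%:E); last exact: ltry.
    by apply: ess_sup_ler => x; rewrite lee_fin njump.
  apply: cmeasurable_real; apply: measurable_fun_ifT; do ?[exact: measurable_cst].
  apply: (measurable_fun_ler (measurable_cst _)).
  exact: (@measurable_coord _ n (fun y : R => y) i0 (@measurable_id _ _ setT)).
have ae_norm (f : E n -> R[i]) (e : R) : (Lrho_norm rho +oo%E f < e%:E)%E ->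
    {ae lebn n, forall x, normc (f x) <= e}.
  by move=> /ltW /ess_supP; apply: filterS => x; rewrite lee_fin.
have wfin : (\int[lebn n]_y (Phi (- 1) y * `|Re (v y)|)%:E < +oo)%E.
  have [M hM] : exists M : R, {ae lebn n, forall x, normc (v x) <= M}.
    exists (fine (Lrho_norm rho +oo%E v)).
    have := ess_sup_ge (lebn n) (fun x => (normc (v x))%:E).
    apply: filterS => x; rewrite -lee_fin fineK//.
    rewrite ge0_fin_numE//; have := ess_sup_gee (f := fun x => (normc (v x))%:E) (a := 0%E) mu0.
    by apply; apply: aeW => y; rewrite lee_fin normc_ge0.
  apply: (@le_lt_trans _ _ (\int[lebn n]_y (`|M|%:E * (Phi (- 1) y)%:E))%E).
    apply: ae_ge0_le_integral => //.
    - by move=> y _; rewrite lee_fin mulr_ge0 ?Phi_ge0.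
    - apply/measurable_EFinP; apply: measurable_funM; first exact: measurable_Phi.
      by apply: measurableT_comp => //; case: mv.
    - by move=> y _; rewrite -EFinM lee_fin mulr_ge0 ?Phi_ge0.
    - by apply: measurable_funeM; apply/measurable_EFinP; exact: measurable_Phi.
    apply: filterS hM => y hy _; rewrite -EFinM lee_fin mulrC ler_wpM2r ?Phi_ge0//.
    by rewrite (le_trans (le_Re_normc _))// (le_trans hy)// ler_norm.
  rewrite ge0_integralZl_EFin//; last 2 first.
  - by move=> x _; rewrite lee_fin Phi_ge0.
  - by apply/measurable_EFinP; exact: measurable_Phi.
  by rewrite lte_mul_pinfty ?lee_fin ?integral_Phi_fin.
(* For t > 0 the limits of T_t v at the origin from the two sides of the jump agree,
so that the approximation has to happen at t = 0. *)
have start a : 1 <= a -> (Lrho_norm rho +oo%E (v \- jump a)%R < (2^-1)%:E)%E.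
  move=> a1; have h2 : 0 < 2^-1 :> R by rewrite invr_gt0.
  have [_ [_ [t /= t0 <-] close]] := vdense (jump a) (jumpL a) _ h2.
  move: t0; rewrite le_eqVlt => /predU1P[t0|t0].
    by move: close; rewrite -t0 heat_semigroup0.
  exfalso; have ca := ae_norm _ _ close.
  set u := heat_semigroup rho c t v in ca.
  pose L := Re (u [tuple 0 | _ < n]).
  have limit (x_ : nat -> E n) : (forall k i, `|tnth (x_ k) i : R| <= k.+1%:R^-1) ->
      Re (u (x_ k)) @[k --> \oo] --> L.
    move=> hx; rewrite /L /u (_ : (fun k => _) = fun k => expR (t * (c - rho ^+ 2)) *
        \int[lebn n]_y (heat_kernel t (esub (x_ k) y) * Re (v y))); last first.
      by apply/funext => k; rewrite Re_heat.
    rewrite Re_heat//; apply: cvgMr; apply: kernel_cvg => //.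
    - by case: mv.
    - by move=> k i; rewrite (le_trans (hx k i))// invf_le1 ?ltr0n// ler1n.
    - by move=> i; rewrite tnth_mktuple normr0 ler01.
    - move=> i; rewrite tnth_mktuple; apply: norm_cvg0.
      apply: (@squeeze_cvgr _ _ _ _ (fun=> 0) (fun k => k.+1%:R^-1)).
      + by apply: nearW => k; rewrite normr_ge0 hx.
      + exact: cvg_cst.
      + exact: cvg_harmonic.
  have points (s : R) : `|s| = 1 ->
      exists x_ : nat -> E n, forall k, normc (u (x_ k) - jump a (x_ k)) <= 2^-1 /\
        forall i, 0 < s * (tnth (x_ k) i : R) < k.+1%:R^-1.
    move=> s1; suff /choice[x_ hx] : forall k : nat, exists x : E n, normc (u x - jump a x) <= 2^-1 /\
        forall i, 0 < s * (tnth x i : R) < k.+1%:R^-1 by exists x_.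
    move=> k.
    have k0 : 0 < k.+1%:R^-1 :> R by rewrite invr_gt0 ltr0n.
    have [s0|s0] := ltrP 0 s.
      have sE : s = 1 by rewrite -s1 gtr0_norm.
      have [x ux xk] := ae_box ca k0.
      by exists x; split => // i; rewrite sE mul1r.
    have sE : s = -1 by rewrite -s1 ler0_norm// opprK.
    have k0' : - k.+1%:R^-1 < 0 :> R by rewrite oppr_lt0.
    have [x ux xk] := ae_box ca k0'.
    by exists x; split => // i; rewrite sE mulN1r oppr_gt0 ltrNl andbC.
  have Re_le (x : E n) (j : R) : jump a x = j%:C -> normc (u x - jump a x) <= 2^-1 ->
      `|Re (u x) - j| <= 2^-1.
    move=> -> ; apply: le_trans; have := le_Re_normc (u x - j%:C).
    by rewrite ReD ReN.
  have [x_ hx] := points 1 (normr1 R).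
  have [y_ hy] := points (-1) (normrN1 R).
  have Lx : a - 2^-1 <= L.
    apply: (cvgr_to_ge (limit x_ _)) => [k i|].
      by have /andP[h1 h2'] := (hx k).2 i; rewrite mul1r in h1 h2'; rewrite gtr0_norm// ltW.
    apply: nearW => k; have [h1 h2'] := hx k.
    have jE : jump a (x_ k) = a%:C.
      by rewrite /jump; have /andP[] := h2' i0; rewrite mul1r => /ltW -> _.
    by have := Re_le _ _ jE h1; rewrite ler_norml; lra.
  have Ly : L <= - a + 2^-1.
    apply: (cvgr_to_le (limit y_ _)) => [k i|].
      by have /andP[h1 h2'] := (hy k).2 i; rewrite mulN1r in h1 h2'; rewrite -normrN gtr0_norm// ltW.
    apply: nearW => k; have [h1 h2'] := hy k.
    have jE : jump a (y_ k) = (- a)%:C.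
      rewrite /jump; have /andP[] := h2' i0; rewrite mulN1r oppr_gt0 => h3 _.
      by rewrite leNgt h3.
    by have := Re_le _ _ jE h1; rewrite ler_norml; lra.
  by move: (a1) (le_trans Lx Ly); clear; lra.
have a1 := ae_norm _ _ (start 1 (lexx 1)).
have h4 : 1 <= 4 :> R by rewrite ler1n.
have a4 := ae_norm _ _ (start 4 h4).
have [x [h1 h2]] : exists x, normc (v x - jump 1 x) <= 2^-1 /\ normc (v x - jump 4 x) <= 2^-1.
  have a14 : {ae lebn n, forall x, normc (v x - jump 1 x) <= 2^-1 /\ normc (v x - jump 4 x) <= 2^-1}.
    by apply: filterS2 a1 a4 => x.
  by have [x hx _] := ae_box a14 ltr01; exists x.
have := le_normcD (jump 1 x - v x) (v x - jump 4 x).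
rewrite addrA subrK.
have -> : jump 1 x - jump 4 x = jump (- 3) x.
  by apply: complexP; rewrite ?ReD ?ReN ?ImD ?ImN/=; [case: ifP => _; lra|rewrite subr0].
rewrite njump normrN -[jump 1 x - v x]opprB normcN (ger0_norm (ler0n _ 3)).
lra.
Qed.

End NoHypercyclicBounded.

(** * Convolution of Gaussians *)

Section GaussConvolution.
Context {R : realType}.
Local Notation leb := (@lebesgue_measure R).
Local Notation lebn := (@lebesgue_euclidean R).
Local Notation E n := (euclidean R n).
Notation normc := Normc.normc.

(** Completing the square. *)
Lemma gauss_mul (s t x y : R) : 0 < s -> 0 < t ->
  gauss s x * gauss t (x - y) = gauss (s + t) y * gauss (s * t / (s + t)) (s * y / (s + t) - x).
Proof.
move=> s0 t0; have st0 : 0 < s + t by rewrite addr_gt0.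
have pi0 := @pi_gt0 R.
rewrite /gauss mulrACA [RHS]mulrACA -!expRD -!invfM -!sqrtrM ?mulr_ge0 ?(ltW pi0) ?(ltW s0) ?(ltW st0)//.
congr (_ * expR _).
  by congr ((Num.sqrt _)^-1); field; rewrite gt_eqF.
by field; rewrite !gt_eqF.
Qed.

Lemma gauss_convolution (s t y : R) : 0 < s -> 0 < t ->
  (\int[leb]_x (gauss s x * gauss t (x - y))%:E = (gauss (s + t) y)%:E)%E.
Proof.
move=> s0 t0; have u0 : 0 < s * t / (s + t) by rewrite divr_gt0 ?mulr_gt0 ?addr_gt0.
under eq_integral do rewrite gauss_mul// EFinM.
rewrite ge0_integralZl ?lee_fin ?gauss_ge0// ?integral_gauss ?mule1//.
- by apply/measurable_EFinP; exact: measurable_gauss.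
- by move=> x _; rewrite lee_fin gauss_ge0.
Qed.

Lemma heat_kernel_prod n (t : R) (x : E n) : 0 < t ->
  heat_kernel t x = \prod_(i < n) gauss t (tnth x i).
Proof.
move=> t0; have -> : x = esub x [tuple 0 | _ < n].
  by apply: eq_from_tnth => i; rewrite !tnth_mktuple subr0.
by rewrite heat_kernelE//; apply: eq_bigr => i _; rewrite !tnth_mktuple !subr0.
Qed.

Lemma heat_kernel_convolution n (s t : R) (y : E n) : 0 < s -> 0 < t ->
  (\int[lebn n]_x (heat_kernel s x * heat_kernel t (esub x y))%:E = (heat_kernel (s + t) y)%:E)%E.
Proof.
move=> s0 t0; have mg (u : R) m : 0 < u -> measurable_fun setT (fun x : R => gauss u (x - m)).
  move=> u0; have := measurable_gauss u0 m; congr measurable_fun; apply/funext => x.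
  by rewrite /gauss -(opprB x m) sqrrN.
rewrite heat_kernel_prod ?addr_gt0//.
under eq_integral do rewrite heat_kernel_prod// heat_kernelE// -big_split/=.
rewrite (@ge0_integral_prod _ n (fun i x => gauss s x * gauss t (x - tnth y i))).
- by under eq_bigr do rewrite gauss_convolution//; rewrite prodEFin.
- move=> i; apply: measurable_funM; last exact: mg.
  by have := mg s 0 s0; under eq_fun do rewrite subr0.
- by move=> i x; rewrite mulr_ge0 ?gauss_ge0.
Qed.

Lemma measurable_heat_kernel0 n (s : R) : 0 < s -> measurable_fun setT (@heat_kernel R n s).
Proof.
move=> s0; have := measurable_heat_kernel ([tuple 0 | _ < n] : E n) s0; congr measurable_fun.
apply/funext => x; rewrite heat_kernelE// heat_kernel_prod//; apply: eq_bigr => i _.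
by rewrite tnth_mktuple sub0r /gauss sqrrN.
Qed.

(** By the semigroup property of the heat kernel the Gaussian mass of an orbit at time t is
controlled by the initial datum tested against the kernel at time 1 + t. *)
Lemma gaussian_mass_le n rho c (t : R) (v : E n -> R[i]) : 0 <= t -> cmeasurable v ->
  (\int[lebn n]_x (heat_kernel 1 x * normc (heat_semigroup rho c t v x))%:E <=
   (2 * expR (t * (c - rho ^+ 2)))%:E * \int[lebn n]_y (heat_kernel (1 + t) y * normc (v y))%:E)%E.
Proof.
move=> t_ge0 mv.
have I0 (s : R) : (0 <= \int[lebn n]_y (heat_kernel s y * normc (v y))%:E)%E.
  by apply: integral_ge0 => y _; rewrite lee_fin mulr_ge0 ?heat_kernel_ge0 ?normc_ge0.
move: t_ge0; rewrite le_eqVlt => /predU1P[<-|t0].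
  under eq_integral do rewrite heat_semigroup0.
  rewrite addr0 mul0r expR0 mulr1.
  by rewrite -[leLHS]mul1e lee_wpmul2r// lee_fin ler1n.
pose e := expR (t * (c - rho ^+ 2)).
have e0 : 0 <= e by exact: expR_ge0.
have mnv := measurable_normc mv.
have mK x : measurable_fun setT (fun y : E n => heat_kernel t (esub x y) * normc (v y)).
  by apply: measurable_funM => //; exact: measurable_heat_kernel.
pose F (z : E n * E n) := (2 * e * (heat_kernel 1 z.1 * (heat_kernel t (esub z.1 z.2) * normc (v z.2))))%:E.
have mh1 := @measurable_heat_kernel0 n 1 ltr01.
have mF : measurable_fun setT F.
  apply/measurable_EFinP; apply: measurable_funM => //; apply: measurable_funM.
    by apply: (measurableT_comp mh1); exact: measurable_fst.
  apply: measurable_funM; first exact: measurable_heat_kernel2.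
  by apply: (measurableT_comp mnv); exact: measurable_snd.
have F0 z : (0 <= F z)%E.
  by rewrite lee_fin !mulr_ge0 ?powR_ge0 ?expR_ge0 ?normc_ge0.
apply: (@le_trans _ _ (\int[lebn n]_x \int[lebn n]_y F (x, y))%E).
  apply: ge0_le_integral => //.
  - by move=> x _; rewrite lee_fin mulr_ge0 ?heat_kernel_ge0 ?normc_ge0.
  - apply/measurable_EFinP; apply: measurable_funM => //; apply: measurable_normc.
    by apply: cmeasurable_heat => //; exact: ltW.
  - exact: measurable_fun_fubini_tonelli_F.
  move=> x _.
  have -> : (\int[lebn n]_y F (x, y) = (heat_kernel 1 x * e)%:E *
      (2%:E * \int[lebn n]_y (heat_kernel t (esub x y) * normc (v y))%:E))%E.
    rewrite muleA -EFinM -ge0_integralZl_EFin//.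
    - by apply: eq_integral => y _; rewrite /F -EFinM; congr (_%:E); ring.
    - by move=> y _; rewrite lee_fin mulr_ge0 ?heat_kernel_ge0 ?normc_ge0.
    - exact/measurable_EFinP.
    - by rewrite !mulr_ge0 ?powR_ge0 ?expR_ge0.
  rewrite heat_semigroupE// Normc.normcM normc_real (ger0_norm e0) -/e mulrA EFinM.
  rewrite lee_wpmul2l ?lee_fin ?mulr_ge0 ?powR_ge0 ?expR_ge0//.
  apply: normc_cintegral_le => //; first exact: cmeasurable_kernel_mul.
  by move=> y; rewrite Normc.normcM normc_real ger0_norm ?heat_kernel_ge0.
rewrite fubini_tonelli//.
rewrite -ge0_integralZl_EFin ?mulr_ge0//; last 2 first.
- by move=> y _; rewrite lee_fin mulr_ge0 ?heat_kernel_ge0 ?normc_ge0.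
- apply/measurable_EFinP; apply: measurable_funM => //; apply: measurable_heat_kernel0.
  by rewrite addr_gt0.
apply: ge0_le_integral => //.
- by move=> y _; apply: integral_ge0.
- exact: measurable_fun_fubini_tonelli_G.
- apply: measurable_funeM; apply/measurable_EFinP; apply: measurable_funM => //.
  by apply: measurable_heat_kernel0; rewrite addr_gt0.
move=> y _.
have -> : (\int[lebn n]_x F (x, y) = (2 * e * normc (v y))%:E *
    \int[lebn n]_x (heat_kernel 1 x * heat_kernel t (esub x y))%:E)%E.
  rewrite -ge0_integralZl_EFin.
  - by apply: eq_integral => x _; rewrite /F -EFinM; congr (_%:E); ring.
  - exact: measurableT.
  - by move=> x _; rewrite lee_fin mulr_ge0 ?heat_kernel_ge0.
  - apply/measurable_EFinP; apply: measurable_funM => //.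
    have := measurable_heat_kernel2 (n := n) t0.
    by move=> /(@measurable_fun_pair1 _ _ _ _ _ _ _ y).
  - by rewrite !mulr_ge0 ?normc_ge0.
rewrite heat_kernel_convolution// -!EFinM lee_fin -/e.
by rewrite -[leLHS]mulrA [normc _ * _]mulrC.
Qed.

End GaussConvolution.

(** * Dilations of the Euclidean space *)

Section Scaling.
Context {R : realType}.
Local Notation leb := (@lebesgue_measure R).
Local Notation lebn := (@lebesgue_euclidean R).
Local Notation E n := (euclidean R n).

(** The measure of half-open intervals determines the Lebesgue measure. *)
Lemma lebesgue_scaling (l : R) (f : measurableTypeR R -> \bar R) : 0 < l ->
  measurable_fun setT f -> (forall x, 0 <= f x)%E ->
  (\int[leb]_x f x = l%:E * \int[leb]_x f (l * x)%R)%E.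
Proof.
move=> l0 mf f0; pose phi (x : measurableTypeR R) : measurableTypeR R := l * x.
have mphi : measurable_fun setT phi by exact: measurable_funM.
pose ln : {nonneg R} := NngNum (ltW l0).
rewrite (eq_measure_integral (mscale ln (pushforward leb phi))); last first.
  move=> A mA _; apply: lebesgue_measure_unique => // X [[a b] /= ab <-].
  rewrite /mscale/= /pushforward.
  have -> : phi @^-1` `]a, b] = `]a / l, b / l]%classic.
    by apply/seteqP; split => x /=; rewrite !in_itv/= /phi ltr_pdivrMr// ler_pdivlMr// ![_ * l]mulrC.
  rewrite !lebesgue_measure_itv/= !lte_fin ltr_pM2r ?invr_gt0//.
  case: ifP => _; last by rewrite mule0.
  by rewrite -!EFinD -EFinM -mulNr -mulrDl mulrC divfK ?gt_eqF.
rewrite ge0_integral_mscale//; congr (_ * _)%E.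
by rewrite ge0_integral_pushforward.
Qed.

Definition escale n (l : R) (x : E n) : E n := [tuple l * (tnth x i : R) | i < n].

Lemma measurable_escale n l : measurable_fun setT (@escale n l).
Proof.
apply/measurable_fun_tnthP => i; rewrite (_ : _ \o _ = fun x : E n => l * (tnth x i : R)).
  exact: (@measurable_coord _ n (fun y : R => l * y) i (@mulrl_measurable _ _ _)).
by apply/funext => x /=; rewrite tnth_mktuple.
Qed.

Lemma escale_cons n l (a : R) (y : E n) :
  escale l (cons_euclidean (a, y)) = cons_euclidean (l * a, escale l y).
Proof.
apply: eq_from_tnth => i; rewrite tnth_mktuple.
by case: (unliftP ord0 i) => [j ->|->]; rewrite /cons_euclidean/= ?tnthS ?tnth_mktuple.
Qed.

Lemma enorm_escale n l (x : E n) : 0 <= l -> enorm (escale l x) = l * enorm x.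
Proof.
move=> l0; rewrite /enorm -[l in RHS](ger0_norm l0) -sqrtr_sqr -sqrtrM ?sqr_ge0//.
by congr (Num.sqrt _); rewrite mulr_sumr; apply: eq_bigr => i _; rewrite tnth_mktuple exprMn.
Qed.

Lemma lebesgue_euclidean_scaling n (l : R) (f : E n -> \bar R) : 0 < l ->
  measurable_fun setT f -> (forall x, 0 <= f x)%E ->
  (\int[lebn n]_x f x = (l ^+ n)%:E * \int[lebn n]_x f (escale l x))%E.
Proof.
move=> l0; elim: n f => [|n IH] f mf f0.
  rewrite expr0 mul1e; apply: eq_integral => x _; congr f.
  by apply: eq_from_tnth => -[].
have mfs : measurable_fun setT (f \o escale l) by apply: measurableT_comp => //; exact: measurable_escale.
rewrite !ge0_integral_cons//.
have mfc : measurable_fun setT (f \o @cons_euclidean R n).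
  by apply: measurableT_comp => //; exact: measurable_cons_euclidean.
transitivity (\int[leb]_a ((l ^+ n)%:E * \int[lebn n]_y f (cons_euclidean (a, escale l y))))%E.
  apply: eq_integral => a _; apply: (IH (fun y => f (cons_euclidean (a, y)))) => //.
  exact: (measurableT_comp mfc (pair1_measurable (a : measurableTypeR R))).
pose G (a : measurableTypeR R) := (\int[lebn n]_y f (cons_euclidean (a, escale l y)))%E.
have mG : measurable_fun setT G.
  have mF : measurable_fun setT (fun z : measurableTypeR R * E n => f (cons_euclidean (z.1, escale l z.2))).
    apply: (measurableT_comp mfc); apply: measurable_fun_pair; first exact: measurable_fst.
    by apply: measurableT_comp; [exact: measurable_escale|exact: measurable_snd].
  exact: (measurable_fun_fubini_tonelli_F (m2 := lebn n) _ mF).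
have G0 a : (0 <= G a)%E by apply: integral_ge0.
have ln0 : 0 <= l ^+ n by rewrite exprn_ge0// ltW.
transitivity ((l ^+ n)%:E * \int[leb]_a G a)%E.
  exact: (ge0_integralZl_EFin leb measurableT (fun a _ => G0 a) mG ln0).
rewrite (lebesgue_scaling l0 mG G0) muleA -EFinM -exprSr.
congr (_ * _)%E; apply: eq_integral => a _; apply: eq_integral => y _.
by rewrite escale_cons.
Qed.

End Scaling.

(** * Integrals concentrated near a sphere *)

Section ShellIntegral.
Context {R : realType}.
Local Notation leb := (@lebesgue_measure R).
Local Notation lebn := (@lebesgue_euclidean R).
Local Notation E n := (euclidean R n).

Lemma integral_heat_kernel n (t : R) : 0 < t -> (\int[lebn n]_x (heat_kernel t x)%:E = 1)%E.
Proof.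
move=> t0; under eq_integral do rewrite heat_kernel_prod//.
have gE (y : R) : gauss t (0 - y) = gauss t y by rewrite /gauss sub0r sqrrN.
rewrite (@ge0_integral_prod _ n (fun _ => gauss t)).
- rewrite big1// => i _; rewrite -(integral_gauss t0 0).
  by apply: eq_integral => y _; rewrite gE.
- move=> i; have := measurable_gauss t0 0; congr measurable_fun; apply/funext => y; exact: gE.
- by move=> i y; exact: gauss_ge0.
Qed.

Lemma integral_gaussian n (u : R) : 0 < u ->
  (\int[lebn n]_x (expR (- (enorm x ^+ 2 / u)))%:E = ((pi * u) `^ (n%:R / 2))%:E)%E.
Proof.
move=> u0; have t0 : 0 < u / 4 by rewrite divr_gt0.
have pu : 0 < pi * u :> R by rewrite mulr_gt0 ?pi_gt0.
have E4 : 4 * (u / 4) = u by rewrite mulrC divfK.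
have e (x : E n) : expR (- (enorm x ^+ 2 / u)) = (pi * u) `^ (n%:R / 2) * heat_kernel (u / 4) x.
  rewrite /heat_kernel (_ : 4 * pi * (u / 4) = pi * u); last by rewrite mulrAC E4 mulrC.
  by rewrite E4 mulrA powRD_pos// addrN powRr0 mul1r mulNr.
under eq_integral do rewrite e EFinM.
rewrite ge0_integralZl_EFin ?powR_ge0//.
- by rewrite integral_heat_kernel// mule1.
- by move=> x _; rewrite lee_fin heat_kernel_ge0.
- by apply/measurable_EFinP; exact: measurable_heat_kernel0.
Qed.

Lemma integral_gaussian_line (a T r m : R) : 0 < a -> 0 < T -> 0 < r ->
  (\int[leb]_l (expR (- (a * (l * r - m) ^+ 2 / T)))%:E = (Num.sqrt (pi * T / (a * r ^+ 2)))%:E)%E.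
Proof.
move=> a0 T0 r0; pose t := T / (4 * (a * r ^+ 2)).
have ar0 : 0 < a * r ^+ 2 by rewrite mulr_gt0 ?exprn_gt0.
have t0 : 0 < t by rewrite divr_gt0// mulr_gt0.
have tE : pi * T / (a * r ^+ 2) = 4 * pi * t by rewrite /t; field; rewrite !gt_eqF.
have s0 : 0 < Num.sqrt (4 * pi * t) by rewrite sqrtr_gt0; apply: mulr_gt0 t0; rewrite mulr_gt0 ?pi_gt0.
have e l : expR (- (a * (l * r - m) ^+ 2 / T)) = Num.sqrt (4 * pi * t) * gauss t (m / r - l).
  rewrite /gauss mulVKf ?gt_eqF//; congr expR; rewrite /t.
  by field; rewrite !gt_eqF.
rewrite tE; under eq_integral do rewrite e EFinM.
rewrite ge0_integralZl_EFin ?(ltW s0)// ?integral_gauss ?mule1//.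
- by move=> l _; rewrite lee_fin gauss_ge0.
- by apply/measurable_EFinP; exact: measurable_gauss.
Qed.

Section Shell.
Variables (n : nat) (a sg k th : R).
Hypothesis a_gt0 : 0 < a.
Hypothesis sg_gt0 : 0 < sg.
Hypothesis k_gt0 : 0 < k.
Hypothesis th_ge0 : 0 <= th.

Let w (r : R) : R := (1 + k * r) `^ (- th).
Let F (T r : R) : R := expR (- (a * (r - 2 * sg * T) ^+ 2 / T)).
Let I (T : R) := (\int[lebn n]_y (F T (enorm y) * w (enorm y))%:E)%E.
Let i12 (l : R) : R := \1_(`[1, 2]%classic : set (measurableTypeR R)) l.

Let w_ge0 r : 0 <= w r. Proof. exact: powR_ge0. Qed.
Let F_ge0 T r : 0 <= F T r. Proof. exact: expR_ge0. Qed.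
Let i12_ge0 l : 0 <= i12 l. Proof. by rewrite /i12 indicE. Qed.
Let i12_int : (\int[leb]_l (i12 l)%:E = 1)%E.
Proof.
rewrite integral_indic// setIT; apply: etrans (lebesgue_measure_itv `[1%R, 2%R]) _.
rewrite /= lte_fin ltr1n/= -EFinD.
by congr (_%:E); lra.
Qed.

Let w_decr r s : 0 <= r -> r <= s -> w s <= w r.
Proof.
move: (k_gt0) => k0 r0 rs; rewrite /w !powRN.
have h : 0 <= k * r by rewrite mulr_ge0// ltW.
have h' : k * r <= k * s by rewrite ler_wpM2l// ltW.
rewrite lef_pV2 ?posrE ?powR_gt0//; try lra.
by apply: ge0_ler_powR; rewrite ?nnegrE//; lra.
Qed.

Let w_le1 r : 0 <= r -> w r <= 1.
Proof. by move=> r0; apply: le_trans (w_decr (lexx 0) r0) _; rewrite /w mulr0 addr0 powR1. Qed.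

Let measurable_F T : measurable_fun setT (F T : measurableTypeR R -> R).
Proof.
apply: measurableT_comp => //; apply: measurableT_comp => //; apply: measurable_funM => //.
by apply: measurable_funM => //; apply: measurable_funX; exact: measurable_funD.
Qed.

Let measurable_w : measurable_fun setT (w : measurableTypeR R -> R).
Proof. by apply: measurable_powRp; apply: measurable_funD => //; exact: measurable_funM. Qed.

Let D (T : R) (z : measurableTypeR R * E n) : R := i12 z.1 * (F T (z.1 * enorm z.2) * w (enorm z.2)).

Let measurable_D T : measurable_fun setT (D T).
Proof.
have m1 : measurable_fun setT (fun z : measurableTypeR R * E n => z.1 : R) by exact: measurable_fst.
have m2 : measurable_fun setT (fun z : measurableTypeR R * E n => enorm z.2).
  by apply: measurableT_comp; [exact: measurable_enorm|exact: measurable_snd].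
apply: measurable_funM; first by apply: measurableT_comp m1; exact: measurable_indic.
apply: measurable_funM; last exact: (measurableT_comp measurable_w m2).
by apply: (measurableT_comp (measurable_F T)); exact: measurable_funM.
Qed.

Let D_ge0 T z : 0 <= D T z. Proof. by rewrite !mulr_ge0 ?i12_ge0 ?F_ge0 ?w_ge0. Qed.

(** The integral does not change, up to a constant, under dilations by factors between 1 and 2,
hence can be averaged over them: the averages of the Gaussian profile are of order
T^(1/2) / |y|. *)
Let averaged (T : R) : (I T <= (2 ^+ n)%:E * \int[lebn n]_y \int[leb]_l (D T (l, y))%:E)%E.
Proof.
have mFw (l : R) : measurable_fun setT (fun y : E n => F T (l * enorm y) * w (enorm y)).
  apply: measurable_funM; last exact: (measurableT_comp measurable_w (@measurable_enorm _ n)).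
  apply: (measurableT_comp (measurable_F T)); apply: measurable_funM => //.
  exact: measurable_enorm.
pose J (l : measurableTypeR R) := (\int[lebn n]_y (F T (l * enorm y) * w (enorm y))%:E)%E.
have J0 l : (0 <= J l)%E by apply: integral_ge0 => y _; rewrite lee_fin mulr_ge0.
have IJ (l : R) : 1 <= l -> l <= 2 -> (I T <= (2 ^+ n)%:E * J l)%E.
  move=> l1 l2; have l0 : 0 < l by lra.
  rewrite /I (lebesgue_euclidean_scaling l0); last 2 first.
  - apply/measurable_EFinP; have := mFw 1; congr measurable_fun.
    by apply/funext => y; rewrite mul1r.
  - by move=> y; rewrite lee_fin mulr_ge0.
  apply: lee_pmul.
  - by rewrite lee_fin exprn_ge0// ltW.
  - by apply: integral_ge0 => y _; rewrite lee_fin mulr_ge0.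
  - by rewrite lee_fin; apply: lerXn2r; rewrite ?nnegrE ?(ltW l0).
  apply: ge0_le_integral => //.
  - by move=> y _; rewrite lee_fin mulr_ge0.
  - apply/measurable_EFinP; have := measurableT_comp (mFw 1) (@measurable_escale R n l).
    by congr measurable_fun; apply/funext => y /=; rewrite mul1r.
  - by apply/measurable_EFinP; exact: mFw.
  move=> y _; rewrite lee_fin enorm_escale ?(ltW l0)// ler_wpM2l// w_decr ?enorm_ge0//.
  by rewrite ler_peMl ?enorm_ge0.
have n2 : 0 <= 2 ^+ n :> R by rewrite exprn_ge0.
have mDE : measurable_fun setT (fun z => (D T z)%:E) by apply/measurable_EFinP; exact: measurable_D.
have DE0 z : (0 <= (D T z)%:E)%E by rewrite lee_fin D_ge0.
rewrite -(@fubini_tonelli _ _ _ _ _ leb (lebn n) (fun z => (D T z)%:E) mDE DE0).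
have I_ge0 : (0 <= I T)%E by apply: integral_ge0 => y _; rewrite lee_fin mulr_ge0.
have mi12 : measurable_fun setT (fun l : measurableTypeR R => (i12 l)%:E).
  by apply/measurable_EFinP; exact: measurable_indic.
have innerE l : (\int[lebn n]_y (D T (l, y))%:E = (i12 l)%:E * J l)%E.
  rewrite /J -ge0_integralZl_EFin//.
  - by move=> y _; rewrite lee_fin mulr_ge0.
  - by apply/measurable_EFinP; exact: mFw.
rewrite -[leLHS]mul1e -i12_int -ge0_integralZr//; last by move=> l _; rewrite lee_fin.
rewrite -ge0_integralZl_EFin//; last 2 first.
- by move=> l _; apply: integral_ge0.
- exact: (measurable_fun_fubini_tonelli_F (m2 := lebn n) _ mDE).
apply: ge0_le_integral => //.
- by move=> l _; rewrite mule_ge0// lee_fin.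
- exact: emeasurable_funM.
- by apply: measurable_funeM; exact: (measurable_fun_fubini_tonelli_F (m2 := lebn n) _ mDE).
move=> l _; rewrite innerE /i12 indicE; case: (boolP (l \in _)) => h /=.
  by rewrite !mul1e; move: h; rewrite inE/= in_itv/= => /andP[]; exact: IJ.
by rewrite !mul0e mule0.
Qed.

Let M := Num.sqrt (4 * pi / (a * sg ^+ 2)) * (k * sg / 2) `^ (- th).

(** Away from the sphere of radius 2 sg T the profile is exponentially small; near
the sphere the average over the dilations gains T^(-1/2), and a Gaussian
majorizes the indicator of a ball. *)
Let inner_le (T : R) (y : E n) : 1 <= T ->
  (\int[leb]_l (D T (l, y))%:E <=
   (expR (- (a * sg ^+ 2 / 2 * T)) * expR (- (enorm y ^+ 2 / (8 * T / a))) +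
    M * T `^ (- (1 / 2) - th) * expR 4 * expR (- (enorm y ^+ 2 / (2 * sg * T) ^+ 2)))%:E)%E.
Proof.
move: (a_gt0) (sg_gt0) (k_gt0) (th_ge0) => a0 sg0 k0 th0 T1.
set r := enorm y; have r0 : 0 <= r := enorm_ge0 y.
have T0 : 0 < T by lra.
set c1 := expR _ * expR _; set c2 := M * _ * _ * _.
have c10 : 0 <= c1 by rewrite mulr_ge0 ?expR_ge0.
have M0 : 0 <= M by rewrite mulr_ge0 ?sqrtr_ge0 ?powR_ge0.
have c20 : 0 <= c2 by rewrite !mulr_ge0 ?expR_ge0 ?powR_ge0.
pose Rr := 2 * sg * T.
have R0 : 0 < Rr by rewrite !mulr_gt0.
have mi12 : measurable_fun setT (fun l : measurableTypeR R => i12 l) by exact: measurable_indic.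
have mFl : measurable_fun setT (fun l : measurableTypeR R => F T (l * r)).
  by apply: (measurableT_comp (measurable_F T)); exact: measurable_funM.
have mDl : measurable_fun setT (fun l : measurableTypeR R => D T (l, y)).
  exact: (measurableT_comp (measurable_D T) (pair2_measurable y)).
have [out|] := boolP ((r <= Rr / 4) || (2 * Rr <= r)).
  apply: (@le_trans _ _ (\int[leb]_l (c1%:E * (i12 l)%:E))%E).
    apply: ge0_le_integral => //.
    - by move=> l _; rewrite lee_fin D_ge0.
    - by apply/measurable_EFinP; exact: mDl.
    - by apply: measurable_funeM; exact/measurable_EFinP.
    move=> l _; rewrite -EFinM lee_fin /D/= mulrC /i12 indicE.
    case: (boolP (l \in _)) => h /=; last by rewrite !mulr0.
    rewrite !mulr1; move: h; rewrite inE/= in_itv/= => /andP[l1 l2].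
    rewrite -[leRHS]mulr1 ler_pM// ?w_le1//.
    rewrite /c1 /F -expRD ler_expR -/Rr -opprD lerN2.
    have sq : Rr ^+ 2 / 8 + r ^+ 2 / 8 <= (l * r - Rr) ^+ 2.
      have lr1 : r <= l * r by rewrite ler_peMl.
      have lr2 : l * r <= 2 * r by rewrite ler_wpM2r.
      by case/orP: out => h; nra.
    have -> : a * sg ^+ 2 / 2 * T + r ^+ 2 / (8 * T / a) = a / T * (Rr ^+ 2 / 8 + r ^+ 2 / 8).
      by rewrite /Rr; field; rewrite !gt_eqF.
    rewrite [leRHS](_ : _ = a / T * (l * r - Rr) ^+ 2); last by rewrite mulrAC.
    by rewrite ler_wpM2l// divr_ge0// ltW.
  rewrite ge0_integralZl_EFin//; last 2 first.
  - by move=> l _; rewrite lee_fin.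
  - exact/measurable_EFinP.
  by rewrite i12_int mule1 lee_fin lerDl.
rewrite negb_or -!ltNge => /andP[r1 r2].
have r_gt0 : 0 < r by apply: lt_trans r1; rewrite divr_gt0.
have w_le : w r <= (k * sg / 2) `^ (- th) * T `^ (- th).
  have ks0 : 0 < k * sg / 2 by rewrite divr_gt0 ?mulr_gt0.
  rewrite -powRM ?(ltW ks0) ?(ltW T0)// /w !powRN lef_pV2 ?posrE ?powR_gt0 ?mulr_gt0//; last first.
    by have := mulr_gt0 k0 r_gt0; lra.
  apply: ge0_ler_powR; rewrite ?nnegrE//.
  - by rewrite mulr_ge0 ?(ltW ks0) ?(ltW T0).
  - by have := mulr_gt0 k0 r_gt0; lra.
  - have h : k * (Rr / 4) <= k * r by rewrite ler_wpM2l ?(ltW k0) ?(ltW r1).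
    have e : k * (Rr / 4) = k * sg / 2 * T by rewrite /Rr; field.
    by rewrite -e; lra.
(* The exponent 4 - (r / Rr)^2 is nonnegative, since r is below 2 Rr. *)
have e4 : 1 <= expR 4 * expR (- (r ^+ 2 / Rr ^+ 2)).
  rewrite -expRD -[leLHS]expR0 ler_expR subr_ge0 ler_pdivrMr ?exprn_gt0//; nra.
have sqrt_le : Num.sqrt (pi * T / (a * r ^+ 2)) <= Num.sqrt (4 * pi / (a * sg ^+ 2)) * T `^ (- (1 / 2)).
  have pi0 := @pi_gt0 R.
  have -> : T `^ (- (1 / 2)) = Num.sqrt T^-1.
    by rewrite powRN div1r powR12_sqrt ?(ltW T0)// sqrtrV// ltW.
  have q0 : 0 <= 4 * pi / (a * sg ^+ 2) by rewrite divr_ge0 ?mulr_ge0 ?(ltW pi0) ?(ltW a0) ?(ltW sg0).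
  rewrite -sqrtrM// ler_wsqrtr//.
  rewrite ler_pdivrMr ?mulr_gt0 ?exprn_gt0//.
  rewrite [leRHS](_ : _ = 4 * pi * r ^+ 2 / (sg ^+ 2 * T)); last by field; rewrite !gt_eqF.
  rewrite ler_pdivlMr ?mulr_gt0 ?exprn_gt0//.
  have rs : (sg * T / 2) ^+ 2 <= r ^+ 2.
    by rewrite ler_pXn2r ?nnegrE ?(ltW r_gt0) ?divr_ge0 ?mulr_ge0 ?(ltW sg0) ?(ltW T0)//; move: r1; rewrite /Rr; lra.
  rewrite [leLHS](_ : _ = 4 * pi * (sg * T / 2) ^+ 2); last by field.
  by rewrite ler_wpM2l// mulr_ge0// ltW.
apply: (@le_trans _ _ (\int[leb]_l ((w r)%:E * (F T (l * r))%:E))%E).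
  apply: ge0_le_integral => //.
  - by move=> l _; rewrite lee_fin D_ge0.
  - by apply/measurable_EFinP; exact: mDl.
  - by apply: measurable_funeM; exact/measurable_EFinP.
  move=> l _; rewrite -EFinM lee_fin /D/= -/r [w r * _]mulrC -[leRHS]mul1r ler_wpM2r ?mulr_ge0//.
  by rewrite /i12 indicE lern1 leq_b1.
rewrite ge0_integralZl_EFin//; last 2 first.
- by move=> l _; rewrite lee_fin.
- exact/measurable_EFinP.
rewrite integral_gaussian_line// -EFinM lee_fin; apply: ler_wpDl => //.
apply: (@le_trans _ _ (M * T `^ (- (1 / 2) - th))).
  rewrite -powRD_pos// /M mulrC mulrACA ler_pM ?sqrtr_ge0//.
have X0 : 0 <= M * T `^ (- (1 / 2) - th) by exact: mulr_ge0 M0 (powR_ge0 _ _).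
by rewrite /c2 -[leRHS]mulrA -[leLHS]mulr1 ler_wpM2l.
Qed.

(** The sphere of radius 2 sg T has an area of order T^(n-1), the profile has a
width of order T^(1/2), and the last factor is of order T^(-th) there. *)
Lemma shell_integral : exists2 C : R, 0 <= C & forall T, 1 <= T ->
  (\int[lebn n]_y (expR (- (a * (enorm y - 2 * sg * T) ^+ 2 / T)) * (1 + k * enorm y) `^ (- th))%:E <=
   (C * (T `^ (n%:R - 1 / 2 - th) + 1))%:E)%E.
Proof.
move: (a_gt0) (sg_gt0) (k_gt0) (th_ge0) => a0 sg0 k0 th0.
have pi0 := @pi_gt0 R.
pose b := a * sg ^+ 2 / 2.
have b0 : 0 < b by rewrite divr_gt0 ?mulr_gt0 ?exprn_gt0.
pose C1 := (8 * pi / a) `^ (n%:R / 2) * (n`!%:R * b^-1 ^+ n).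
pose C2 := M * expR 4 * (pi * (2 * sg) ^+ 2) `^ (n%:R / 2).
have M0 : 0 <= M by rewrite mulr_ge0 ?sqrtr_ge0 ?powR_ge0.
have C10 : 0 <= C1 by rewrite !mulr_ge0 ?powR_ge0 ?exprn_ge0 ?invr_ge0 ?(ltW b0).
have C20 : 0 <= C2 by rewrite !mulr_ge0 ?powR_ge0 ?expR_ge0.
exists (2 ^+ n * (C1 + C2)); first by rewrite mulr_ge0 ?exprn_ge0 ?addr_ge0.
move=> T T1; have T0 : 0 < T by lra.
apply: (le_trans (averaged T)).
rewrite -[_ * (C1 + C2) * _]mulrA EFinM lee_wpmul2l ?lee_fin ?exprn_ge0//.
pose k1 := expR (- (b * T)); pose k2 := M * T `^ (- (1 / 2) - th) * expR 4.
have k10 : 0 <= k1 by exact: expR_ge0.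
have k20 : 0 <= k2 by rewrite !mulr_ge0 ?powR_ge0 ?expR_ge0.
pose g1 (y : E n) := expR (- (enorm y ^+ 2 / (8 * T / a))).
pose g2 (y : E n) := expR (- (enorm y ^+ 2 / (2 * sg * T) ^+ 2)).
have mg u : measurable_fun setT (fun y : E n => expR (- (enorm y ^+ 2 / u))).
  apply: measurableT_comp => //; apply: measurableT_comp => //; apply: measurable_funM => //.
  by apply: measurable_funX; exact: measurable_enorm.
have mDE : measurable_fun setT (fun z => (D T z)%:E) by apply/measurable_EFinP; exact: measurable_D.
have DE0 z : (0 <= (D T z)%:E)%E by rewrite lee_fin D_ge0.
apply: (@le_trans _ _ (\int[lebn n]_y (k1%:E * (g1 y)%:E + k2%:E * (g2 y)%:E))%E).
  apply: ge0_le_integral => //.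
  - by move=> y _; apply: integral_ge0.
  - exact: (measurable_fun_fubini_tonelli_G (m1 := leb) _ mDE).
  - by apply: emeasurable_funD; apply: measurable_funeM; apply/measurable_EFinP; exact: mg.
  - by move=> y _; rewrite -!EFinM -EFinD; exact: inner_le.
have u1 : 0 < 8 * T / a by rewrite divr_gt0 ?mulr_gt0.
have u2 : 0 < (2 * sg * T) ^+ 2 by rewrite exprn_gt0 ?mulr_gt0.
rewrite ge0_integralD//; do ?[by move=> y _; rewrite -EFinM lee_fin mulr_ge0 ?expR_ge0];
  do ?[by apply: measurable_funeM; apply/measurable_EFinP; exact: mg].
rewrite !ge0_integralZl_EFin//; do ?[by move=> y _; rewrite lee_fin expR_ge0];
  do ?[by apply/measurable_EFinP; exact: mg].
rewrite !integral_gaussian// -!EFinM -EFinD lee_fin.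
rewrite mulrDr mulr1 addrC [leRHS](_ : _ = C2 * T `^ (n%:R - 1 / 2 - th) + C1 +
  (C1 * T `^ (n%:R - 1 / 2 - th) + C2)); last by ring.
apply: ler_wpDr; first by rewrite addr_ge0// mulr_ge0// powR_ge0.
apply: lerD.
  rewrite [_ ^+ 2]exprMn [pi * (_ * _)]mulrA powRM ?mulr_ge0 ?sqr_ge0 ?(ltW pi0) ?(ltW sg0) ?(ltW T0)//.
  have -> : (T ^+ 2) `^ (n%:R / 2) = T `^ n%:R.
    by rewrite -(powR_mulrn 2 (ltW T0)) -powRrM; congr (_ `^ _); rewrite mulrC divfK.
  have -> : T `^ (n%:R - 1 / 2 - th) = T `^ (- (1 / 2) - th) * T `^ n%:R.
    by rewrite powRD_pos//; congr (_ `^ _); lra.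
  rewrite /k2 /C2; set A := T `^ (_ - th); set B := T `^ n%:R; set G := _ `^ (n%:R / 2).
  by rewrite [leLHS](_ : _ = M * expR 4 * G * (A * B)); last by ring.
have -> : pi * (8 * T / a) = 8 * pi / a * T by field; rewrite gt_eqF.
rewrite powRM ?divr_ge0 ?mulr_ge0 ?(ltW pi0) ?(ltW a0) ?(ltW T0)//.
rewrite /C1 mulrCA ler_wpM2l ?powR_ge0//.
have Tn : T `^ (n%:R / 2) <= T ^+ n.
  rewrite -(powR_mulrn n (ltW T0)); apply: ler_powR => //.
  by rewrite ler_pdivrMr// ler_peMr ?ler0n// ler1n.
apply: (@le_trans _ _ (k1 * T ^+ n)); first by rewrite ler_wpM2l.
have := @powr_fact_le R b T n b0 (ltW T0).
rewrite ler_pdivrMr ?ltr0n ?fact_gt0// => h.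
rewrite /k1 expRN mulrC ler_pdivrMr ?expR_gt0// (le_trans h)//.
by rewrite [leRHS](_ : _ = b^-1 ^+ n * expR (b * T) * n`!%:R)//; ring.
Qed.

End Shell.
End ShellIntegral.

(** * No hypercyclic vectors up to the critical value *)

Section Subcritical.
Context {R : realType}.
Local Notation lebn := (@lebesgue_euclidean R).
Local Notation E n := (euclidean R n).
Notation normc := Normc.normc.
Variables (n : nat) (rho p : R).
Hypothesis n_gt0 : (0 < n)%N.
Hypothesis rho_gt0 : 0 < rho.
Hypothesis p_ge1 : 1 <= p.
Local Notation gamma := (gammap p%:E).
Local Notation sigma := (gamma * rho).
Local Notation wt := (@weight R n rho p).

Let p_gt0 : 0 < p. Proof. exact: lt_le_trans p_ge1. Qed.
Let gamma_ge0 : 0 <= gamma. Proof. exact: normr_ge0. Qed.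
Let n_ge1 : 1 <= n%:R :> R. Proof. by rewrite ler1n. Qed.

Let half : 2^-1 <= n%:R / 2 :> R. Proof. by apply: half_n. Qed.

Let dim : R := gamma * (n%:R / 2 - 2^-1).
Let dim_ge0 : 0 <= dim. Proof. by rewrite mulr_ge0// subr_ge0. Qed.

Lemma powR_mul_expR (x a b c : R) : (x `^ a * expR b) `^ c = x `^ (a * c) * expR (b * c).
Proof. by rewrite powRM ?powR_ge0 ?expR_ge0// powRrM expRM. Qed.

(** The asymptotics at infinity of the weight to the power 1 / p, up to a constant. *)
Definition envelope (y : E n) : R := (1 + rho * enorm y) `^ dim * expR (- (sigma * enorm y)).

Lemma envelope_ge0 y : 0 <= envelope y. Proof. by rewrite mulr_ge0 ?powR_ge0 ?expR_ge0. Qed.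

Lemma measurable_envelope : measurable_fun setT envelope.
Proof.
apply: measurable_funM.
  apply: measurable_powRp; apply: measurable_funD => //; apply: measurable_funM => //.
  exact: measurable_enorm.
apply: measurableT_comp => //; apply: measurableT_comp => //; apply: measurable_funM => //.
exact: measurable_enorm.
Qed.

Lemma envelope_le_weight : exists2 C, 0 < C & forall y, 0 < enorm y ->
  envelope y `^ p <= C * wt y.
Proof.
have [k k0 h] := macdonald_tilde_ge half.
have gp0 : 0 <= gamma * p by rewrite mulr_ge0// ltW.
exists (k `^ (gamma * p))^-1 => [|y y0]; first by rewrite invr_gt0 powR_gt0.
have z0 : 0 < rho * enorm y by rewrite mulr_gt0.
rewrite -ler_pdivrMl ?invr_gt0 ?powR_gt0// invrK.
have -> : envelope y `^ p =
    ((1 + rho * enorm y) `^ (n%:R / 2 - 2^-1) * expR (- (rho * enorm y))) `^ (gamma * p).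
  rewrite /envelope !powR_mul_expR; congr (_ `^ _ * expR _).
    by rewrite /dim; ring.
  by ring.
rewrite -powRM ?mulr_ge0 ?powR_ge0 ?expR_ge0 ?(ltW k0)//.
have lhs0 : 0 <= k * ((1 + rho * enorm y) `^ (n%:R / 2 - 2^-1) * expR (- (rho * enorm y))).
  by rewrite !mulr_ge0 ?powR_ge0 ?expR_ge0 ?(ltW k0).
apply: ge0_ler_powR; rewrite ?nnegrE//; last exact: h.
exact: le_trans lhs0 (h _ z0).
Qed.

Lemma ae_enorm_gt0 : {ae lebn n, forall y, 0 < enorm y}.
Proof.
pose A (i : 'I_n) : set (measurableTypeR R) := [set 0].
have mA i : measurable (A i) by exact: measurable_set1.
exists [set x : E n | forall i, A i (tnth x i)]; split.
- rewrite (_ : mkset _ = \big[setI/setT]_(i < n) ((fun x : E n => tnth x i) @^-1` A i)).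
    apply: bigsetI_measurable => i _; rewrite -[X in measurable X]setTI.
    exact: measurable_tnth.
  apply/seteqP; split => x /=.
    by move=> Ax; rewrite -bigcap_seq => i _ /=; exact: Ax.
  by rewrite -bigcap_seq => Ax i; apply: Ax; rewrite /= mem_index_enum.
- rewrite [LHS](lebesgue_euclidean_box mA) (bigD1 (Ordinal n_gt0))//=.
  by rewrite lebesgue_measure_set1 mul0e.
- move=> x /= h i; rewrite /A/=; apply/eqP; rewrite -normr_eq0.
  have en : enorm x = 0 by apply/eqP; rewrite eq_le enorm_ge0 leNgt; apply/andP; split => //; apply/negP.
  have := l1_le_enorm x; rewrite en mulr0 (bigD1 i)//= => h1.
  rewrite eq_le normr_ge0 andbT (le_trans _ h1)// lerDl sumr_ge0//.
Qed.

Lemma integral_envelope_le : exists2 C, 0 < C & forall v, cmeasurable v ->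
  (\int[lebn n]_y ((envelope y * normc (v y)) `^ p)%:E <= C%:E * pint (lebn n) p wt v)%E.
Proof.
have [C C0 h] := envelope_le_weight; exists C => // v mv.
have mnv := measurable_normc mv.
have mw : measurable_fun setT wt by exact: measurable_weight.
have w0 := @weight_ge0 R n rho p.
rewrite pintE -ge0_integralZl_EFin ?(ltW C0)//; last 2 first.
- by move=> y _; rewrite lee_fin mulr_ge0 ?powR_ge0.
- by apply: measurable_pint.
apply: ae_ge0_le_integral => //.
- by move=> y _; rewrite lee_fin powR_ge0.
- by apply/measurable_EFinP; apply: measurable_powRp; apply: measurable_funM => //; exact: measurable_envelope.
- by move=> y _; rewrite -EFinM lee_fin !mulr_ge0 ?powR_ge0 ?(ltW C0).
- by apply: measurable_funeM; exact: measurable_pint.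
apply: filterS ae_enorm_gt0 => y y0 _; rewrite -EFinM lee_fin.
rewrite powRM ?envelope_ge0 ?normc_ge0// mulrC mulrCA ler_wpM2l ?powR_ge0//.
exact: h.
Qed.

(** The heat kernel at time T, damped by exp (- T sigma^2), is the product of this
profile, concentrated near |y| = 2 sigma T, with the envelope. *)
Let profile (T : R) (y : E n) : R := (4 * pi * T) `^ (- (n%:R / 2)) *
  (expR (- ((enorm y - 2 * sigma * T) ^+ 2 / (4 * T))) * (1 + rho * enorm y) `^ (- dim)).

Let profile_ge0 T y : 0 <= profile T y.
Proof. by rewrite !mulr_ge0 ?powR_ge0 ?expR_ge0. Qed.

Let measurable_profile T : measurable_fun setT (profile T).
Proof.
have me := @measurable_enorm R n.
apply: measurable_funM => //; apply: measurable_funM.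
  apply: measurableT_comp => //; apply: measurableT_comp => //; apply: measurable_funM => //.
  by apply: measurable_funX; exact: measurable_funD.
by apply: measurable_powRp; apply: measurable_funD => //; exact: measurable_funM.
Qed.

Let pos1 (y : E n) : 1 <= 1 + rho * enorm y.
Proof. by rewrite lerDl mulr_ge0 ?enorm_ge0// ltW. Qed.

Let kernel_factor (T : R) (y : E n) : 0 < T ->
  heat_kernel T y * expR (- (T * sigma ^+ 2)) = profile T y * envelope y.
Proof.
move=> T0; rewrite /heat_kernel /profile /envelope.
have h : (1 + rho * enorm y) `^ (- dim) * (1 + rho * enorm y) `^ dim = 1.
  by rewrite powRD_pos ?addNr ?powRr0// (lt_le_trans ltr01).
set K := (4 * pi * T) `^ _; set s := sigma; set P := _ `^ (- dim) in h *; set Q := _ `^ dim in h *.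
rewrite [RHS](_ : _ = K * ((P * Q) * (expR (- ((enorm y - 2 * s * T) ^+ 2 / (4 * T))) *
  expR (- (s * enorm y))))); last by ring.
rewrite h mul1r -expRD -mulrA -expRD; congr (_ * expR _).
by field; rewrite gt_eqF.
Qed.

Let pow_le1 (x a : R) : 1 <= x -> 0 <= a -> x `^ (- a) <= 1.
Proof. by move=> x1 a0; rewrite -[leRHS](powRr0 x) ler_powR// oppr_le0. Qed.

Let piT (T : R) : 1 <= T -> 1 <= 4 * pi * T.
Proof. by move=> T1; have := @pi_ge2 R; nra. Qed.

Let profile_le1 (T : R) y : 1 <= T -> profile T y <= 1.
Proof.
move=> T1; have n2 : 0 <= n%:R / 2 :> R by rewrite divr_ge0.
rewrite -[leRHS]mulr1 ler_pM ?mulr_ge0 ?powR_ge0 ?expR_ge0 ?pow_le1 ?piT//.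
rewrite -[leRHS]mulr1 ler_pM ?powR_ge0 ?expR_ge0 ?pow_le1//.
by rewrite -expR0 ler_expR oppr_le0 divr_ge0 ?sqr_ge0// mulr_ge0//; lra.
Qed.

(** The power (n - 1) / 2 in the asymptotics of the weight is essential here: with q = p / (p - 1)
the resulting exponent n - 1/2 - q dim - q n / 2 of T is not positive. *)
Let integral_profile : 1 < p -> exists2 J, 0 <= J & forall T, 1 <= T ->
  (\int[lebn n]_y (profile T y `^ (p / (p - 1)))%:E <= J%:E)%E.
Proof.
move=> p1; move: (n_ge1) (dim_ge0) (gamma_ge0) (rho_gt0) => n1 d0 g0 r0.
set q := p / (p - 1); have pp0 : 0 < p - 1 by lra.
have q1 : 1 < q by rewrite ltr_pdivlMr//; lra.
have qE : q * (p - 1) = p by rewrite /q divfK// gt_eqF.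
have q0 : 0 < q by lra.
have powE T y : 1 <= T -> profile T y `^ q = (4 * pi * T) `^ (- (q * n%:R / 2)) *
    (expR (- (q / 4 * (enorm y - 2 * sigma * T) ^+ 2 / T)) * (1 + rho * enorm y) `^ (- (dim * q))).
  move=> T1; have T0 : T != 0 by rewrite gt_eqF// (lt_le_trans ltr01).
  rewrite /profile (mulrC (expR _)) powRM ?powR_ge0// ?mulr_ge0 ?powR_ge0 ?expR_ge0//.
  rewrite powR_mul_expR -powRrM [RHS]mulrCA [RHS]mulrC -[RHS]mulrA; congr (_ `^ _ * (_ `^ _ * expR _)).
  - by field.
  - by ring.
  - by field.
have [g_gt0|] := ltrP 0 gamma; last first.
  move=> g_le0; have gE : gamma = 0 by apply/eqP; rewrite eq_le g_le0.
  exists 1 => // T T1; have T0 : 0 < T by lra.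
  have pT : 0 < 4 * pi * T by rewrite (lt_le_trans ltr01)// piT.
  have u0 : 0 < 4 * T / q by rewrite divr_gt0// mulr_gt0.
  under eq_integral => y _.
    rewrite powE// /dim gE !mul0r oppr0 powRr0 mulr1 mulr0 mul0r subr0.
    rewrite (_ : q / 4 * enorm y ^+ 2 / T = enorm y ^+ 2 / (4 * T / q)); last first.
      by field; rewrite !gt_eqF.
    rewrite EFinM; over.
  rewrite ge0_integralZl_EFin ?powR_ge0//; last first.
    apply/measurable_EFinP; apply: measurableT_comp => //; apply: measurableT_comp => //.
    by apply: measurable_funM => //; apply: measurable_funX; exact: measurable_enorm.
  rewrite integral_gaussian// -EFinM lee_fin powRN mulrC ler_pdivrMr ?powR_gt0// mul1r.
  apply: (@le_trans _ _ ((4 * pi * T) `^ (n%:R / 2))).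
    apply: ge0_ler_powR; rewrite ?nnegrE ?divr_ge0 ?mulr_ge0 ?invr_ge0 ?(ltW (pi_gt0 R)) ?(ltW T0) ?(ltW q0)//.
    rewrite (_ : pi * (4 * T / q) = 4 * pi * T / q); last by ring.
    by rewrite ler_pdivrMr// ler_peMr// ltW.
  by apply: ler_powR; rewrite ?piT//; nra.
have s0 : 0 < sigma by rewrite mulr_gt0.
have q4 : 0 < q / 4 by rewrite divr_gt0.
have th0 : 0 <= dim * q by rewrite mulr_ge0// ltW.
have [C C0 hC] := shell_integral n q4 s0 r0 th0.
exists (2 * C) => [|T T1]; first by rewrite mulr_ge0.
have T0 : 0 < T by lra.
have gq : gamma * p = `|2 - p|.
  rewrite /gammap -{2}(ger0_norm (ltW p_gt0)) -normrM mulrBl divfK ?mul1r// gt_eqF//; exact: p_gt0.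
have expo : n%:R - 1 / 2 - dim * q <= q * n%:R / 2.
  have gqE : gamma * q * (p - 1) = `|2 - p| by rewrite -mulrA qE.
  rewrite -(ler_pM2r pp0) mulrBl.
  have -> : dim * q * (p - 1) = `|2 - p| * (n%:R / 2 - 2^-1) by rewrite -gqE /dim; ring.
  have -> : q * n%:R / 2 * (p - 1) = p * (n%:R / 2) by rewrite -{2}qE; ring.
  have [p2|p2] := lerP 2 p; first by nra.
  have h : 0 <= (n%:R - 1) * (2 - p) by rewrite mulr_ge0 ?subr_ge0 ?(ltW p2).
  by nra.
under eq_integral => y _ do rewrite powE// EFinM.
rewrite ge0_integralZl_EFin ?powR_ge0//; last 2 first.
- by move=> y _; rewrite lee_fin mulr_ge0 ?powR_ge0 ?expR_ge0.
- have me := @measurable_enorm R n; apply/measurable_EFinP; apply: measurable_funM.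
    apply: measurableT_comp => //; apply: measurableT_comp => //; apply: measurable_funM => //.
    by apply: measurable_funM => //; apply: measurable_funX; exact: measurable_funD.
  by apply: measurable_powRp; apply: measurable_funD => //; exact: measurable_funM.
have qn0 : 0 <= q * n%:R / 2 by rewrite -mulrA; apply: mulr_ge0; [exact: ltW|rewrite divr_ge0].
apply: (@le_trans _ _ ((4 * pi * T) `^ (- (q * n%:R / 2)) * (C * (T `^ (n%:R - 1 / 2 - dim * q) + 1)))%:E).
  by rewrite EFinM lee_wpmul2l ?lee_fin ?powR_ge0//; exact: hC.
rewrite lee_fin mulrC powRN ler_pdivrMr; last by rewrite powR_gt0// (lt_le_trans ltr01)// piT.
rewrite [2 * C]mulrC -[leRHS]mulrA ler_wpM2l//.
have h1 : T `^ (n%:R - 1 / 2 - dim * q) <= (4 * pi * T) `^ (q * n%:R / 2).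
  apply: (@le_trans _ _ (T `^ (q * n%:R / 2))); first exact: ler_powR.
  apply: ge0_ler_powR; rewrite ?nnegrE ?(ltW T0)//.
    by rewrite (le_trans _ (piT T1)).
  by have := @pi_ge2 R; nra.
have h2 : 1 <= (4 * pi * T) `^ (q * n%:R / 2).
  by rewrite -[leLHS](powRr0 (4 * pi * T)) ler_powR ?piT.
by rewrite [leRHS]mulr_natl mulr2n lerD.
Qed.

Let measurable_powp v : cmeasurable v ->
  measurable_fun setT (fun y => ((envelope y * normc (v y)) `^ p)%:E).
Proof.
move=> mv; apply/measurable_EFinP; apply: measurable_powRp; apply: measurable_funM.
  exact: measurable_envelope.
exact: measurable_normc.
Qed.

(** Young's inequality separates the heat kernel, whose profile has a bounded dual norm, from
the function. *)
Lemma kernel_test_le : exists C J : R, [/\ 0 < C, 0 <= J & forall T v, 1 <= T -> cmeasurable v ->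
  ((expR (- (T * sigma ^+ 2)))%:E * \int[lebn n]_y (heat_kernel T y * normc (v y))%:E <=
   J%:E + C%:E * pint (lebn n) p wt v)%E].
Proof.
have [C C0 hC] := integral_envelope_le.
have factor T v : 1 <= T -> cmeasurable v ->
    ((expR (- (T * sigma ^+ 2)))%:E * \int[lebn n]_y (heat_kernel T y * normc (v y))%:E =
     \int[lebn n]_y (profile T y * (envelope y * normc (v y)))%:E)%E.
  move=> T1 mv; have T0 : 0 < T by lra.
  rewrite -ge0_integralZl_EFin ?expR_ge0//.
  - by apply: eq_integral => y _; rewrite -EFinM [in RHS]mulrA -(kernel_factor y T0) mulrA [expR _ * _]mulrC.
  - by move=> y _; rewrite lee_fin mulr_ge0 ?heat_kernel_ge0 ?normc_ge0.
  - apply/measurable_EFinP; apply: measurable_funM; [exact: measurable_heat_kernel0|exact: measurable_normc].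
have mprod T v : cmeasurable v ->
    measurable_fun setT (fun y => (profile T y * (envelope y * normc (v y)))%:E).
  move=> mv; apply/measurable_EFinP; apply: measurable_funM => //; apply: measurable_funM.
    exact: measurable_envelope.
  exact: measurable_normc.
have ev0 v y : 0 <= envelope y * normc (v y) by rewrite mulr_ge0 ?envelope_ge0 ?normc_ge0.
have [p1|p1] := ltrP 1 p; last first.
  have pE : p = 1 by apply/eqP; rewrite eq_le p1 p_ge1.
  exists C, 0; split => // T v T1 mv; rewrite factor// add0e; apply: le_trans (hC v mv).
  apply: ge0_le_integral => //.
  - by move=> y _; rewrite lee_fin mulr_ge0.
  - exact: mprod.
  - exact: measurable_powp.
  by move=> y _; rewrite lee_fin pE powRr1// -[leRHS]mul1r ler_wpM2r// profile_le1.
have [J J0 hJ] := integral_profile p1.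
exists C, J; split => // T v T1 mv; rewrite factor//.
have pp0 : 0 < p - 1 by rewrite subr_gt0.
set q := p / (p - 1) in hJ; have q1 : 1 < q by rewrite ltr_pdivlMr// mul1r ltrBlDr ltrDl.
apply: (@le_trans _ _ (\int[lebn n]_y ((profile T y `^ q)%:E + ((envelope y * normc (v y)) `^ p)%:E))%E).
  apply: ge0_le_integral => //.
  - by move=> y _; rewrite lee_fin mulr_ge0.
  - exact: mprod.
  - apply: emeasurable_funD; last exact: measurable_powp.
    by apply/measurable_EFinP; exact: measurable_powRp.
  move=> y _; rewrite -EFinD lee_fin.
  have q0 : 0 < q by lra.
  have pq : q^-1 + p^-1 = 1.
    by rewrite /q invf_div -[X in _ + X]mul1r -mulrDl subrK divff// gt_eqF.
  apply: (le_trans (conjugate_powR (profile_ge0 T y) (ev0 v y) q0 p_gt0 pq)).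
  apply: lerD; rewrite ler_pdivrMr// ler_peMr ?powR_ge0//; exact: ltW.
rewrite ge0_integralD//.
- by rewrite leeD// ?hJ// hC.
- by move=> y _; rewrite lee_fin powR_ge0.
- by apply/measurable_EFinP; exact: measurable_powRp.
- by move=> y _; rewrite lee_fin powR_ge0.
- exact: measurable_powp.
Qed.

Lemma weight_bounded : exists2 D, 0 < D & forall x, wt x <= D.
Proof.
have [g0|g0] := ltrP 0 gamma; last first.
  have gE : gamma = 0 by apply/eqP; rewrite eq_le g0 gamma_ge0.
  by exists 1 => // x; rewrite /weight gE mul0r powRr0.
have h2 : 0 < 2^-1 :> R by rewrite invr_gt0.
have h21 : 2^-1 < 1 :> R by lra.
have [C C0 h] := weight_le n_gt0 rho_gt0 p_ge1 h2 h21 g0.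
exists C => // x; rewrite (le_trans (h x))// -[leRHS]mulr1 ler_wpM2l ?(ltW C0)//.
rewrite PhiE -[leRHS]expR0 ler_expR mulNr oppr_le0 !mulr_ge0 ?invr_ge0 ?sqrtr_ge0 ?(ltW rho_gt0) ?(ltW p_gt0)//.
  by lra.
by apply: sumr_ge0.
Qed.

Lemma heat_kernel_pfinite (M : R) : pfinite (lebn n) p wt (fun y => (M * heat_kernel 1 y)%:C).
Proof.
have [D D0 hD] := weight_bounded.
pose K := (gauss 1 0 * expR (1 + 1) : R) ^+ n.
have K0 : 0 <= K by rewrite exprn_ge0// mulr_ge0 ?gauss_ge0 ?expR_ge0.
have hK (y : E n) : heat_kernel 1 y <= K * Phi (- 1) y.
  rewrite heat_kernel_prod//.
  have -> : K * Phi (- 1) y = \prod_(i < n) (gauss 1 0 * expR (1 + 1) * expR (- 1 * `|tnth y i : R|)).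
    by rewrite big_split/= prodr_const card_ord.
  apply: ler_prod => i _; rewrite gauss_ge0/=.
  have := @gauss_shift_le R 1 0 (tnth y i) ltr01; rewrite normr0 sub0r => /(_ ler01).
  by rewrite {1}/gauss sqrrN.
have KD0 : 0 <= (`|M| * K) `^ p * D by rewrite mulr_ge0 ?powR_ge0// ltW.
apply/pfiniteE; rewrite pintE.
apply: (@le_lt_trans _ _ (\int[lebn n]_y (((`|M| * K) `^ p * D)%:E * (Phi (- p) y)%:E))%E).
  apply: ge0_le_integral => //.
  - by move=> y _; rewrite lee_fin mulr_ge0 ?powR_ge0.
  - apply: measurable_pint; first exact: measurable_weight.
    by apply: cmeasurable_real; apply: measurable_funM => //; exact: measurable_heat_kernel0.
  - by apply: measurable_funeM; apply/measurable_EFinP; exact: measurable_Phi.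
  move=> y _; rewrite -EFinM lee_fin normc_real normrM (ger0_norm (heat_kernel_ge0 _ _)).
  have -> : (`|M| * K) `^ p * D * Phi (- p) y = (`|M| * K * Phi (- 1) y) `^ p * D.
    rewrite [in RHS]powRM ?mulr_ge0 ?Phi_ge0// mulrAC; congr (_ * _ * _).
    by rewrite !PhiE -expRM; congr expR; ring.
  rewrite ler_pM ?powR_ge0 ?weight_ge0//.
  apply: ge0_ler_powR; rewrite ?nnegrE ?(ltW p_gt0)
    ?(mulr_ge0 (normr_ge0 M) (heat_kernel_ge0 _ _)) ?(mulr_ge0 (mulr_ge0 (normr_ge0 M) K0) (Phi_ge0 _ _))//.
  by rewrite -mulrA ler_wpM2l.
rewrite ge0_integralZl_EFin//; last 2 first.
- by move=> x _; rewrite lee_fin Phi_ge0.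
- by apply/measurable_EFinP; exact: measurable_Phi.
by rewrite lte_mul_pinfty ?lee_fin// integral_Phi_fin.
Qed.

(** The Gaussian masses along an orbit are bounded, hence the orbit does not approach large
multiples of the Gaussian. *)
Theorem not_hypercyclic_subcritical c : c <= critical rho p%:E ->
  ~ hypercyclic (Lrho n rho p%:E) (Lrho_norm rho p%:E) (heat_semigroup rho c).
Proof.
move=> hc [v vL vdense].
have LE f : Lrho n rho p%:E f <-> cmeasurable f /\ pfinite (lebn n) p wt f by exact: LrhoE.
have Nlt (f : E n -> R[i]) e : 0 < e ->
    (Lrho_norm rho p%:E f < e%:E)%E <-> psmall (lebn n) p wt f (e `^ p) by exact: Lrho_norm_lt.
have [mv /pfiniteE vfin] := (LE v).1 vL.
have [C [J [C0 J0 test]]] := kernel_test_le.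
have w0 := @weight_ge0 R n rho p.
pose V := fine (pint (lebn n) p wt v).
have V_ge0 : 0 <= V by apply: fine_ge0; exact: pint_ge0.
have VE : pint (lebn n) p wt v = V%:E by rewrite fineK// ge0_fin_numE// pint_ge0.
pose mass (f : E n -> R[i]) := (\int[lebn n]_y (heat_kernel 1 y * normc (f y))%:E)%E.
have mass_le T f (A : R) : 1 <= T -> cmeasurable f -> (pint (lebn n) p wt f <= A%:E)%E ->
    (\int[lebn n]_y (heat_kernel T y * normc (f y))%:E <= (expR (T * sigma ^+ 2) * (J + C * A))%:E)%E.
  move=> T1 mf fA; rewrite EFinM.
  have := test T f T1 mf; set X := (\int[_]_y _)%E => h.
  have {}h : ((expR (- (T * sigma ^+ 2)))%:E * X <= (J + C * A)%:E)%E.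
    by apply: (le_trans h); rewrite EFinD EFinM leeD// lee_wpmul2l// lee_fin ltW.
  have XE : X = ((expR (T * sigma ^+ 2))%:E * ((expR (- (T * sigma ^+ 2)))%:E * X))%E.
    by rewrite muleA -EFinM -expRD addrN expR0 mul1e.
  by rewrite XE; apply: lee_wpmul2l => //; rewrite lee_fin expR_ge0.
pose B1 := 2 * expR (sigma ^+ 2) * (J + C * V).
pose B2 := expR (sigma ^+ 2) * (J + C * 1).
have orbit_le t : 0 <= t -> (mass (heat_semigroup rho c t v) <= B1%:E)%E.
  move=> t0; apply: (le_trans (gaussian_mass_le rho c t0 mv)).
  have t1 : 1 <= 1 + t by lra.
  have VV : (pint (lebn n) p wt v <= V%:E)%E by rewrite VE.
  have := mass_le (1 + t) v V t1 mv VV => h.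
  have e0 : 0 <= 2 * expR (t * (c - rho ^+ 2)) by rewrite mulr_ge0 ?expR_ge0.
  apply: (le_trans (lee_wpmul2l (_ : (0 <= (2 * expR (t * (c - rho ^+ 2)))%:E)%E) h)); first by rewrite lee_fin.
  rewrite -EFinM lee_fin /B1 mulrA ler_wpM2r//.
    by rewrite addr_ge0// mulr_ge0// ltW.
  rewrite -mulrA ler_wpM2l// -expRD ler_expR.
  have : t * (c - rho ^+ 2) <= t * (- sigma ^+ 2).
    by rewrite ler_wpM2l// exprMn; move: hc; rewrite /critical; lra.
  rewrite mulrN mulrDl mul1r; lra.
pose m2 := heat_kernel 2 ([tuple 0 | _ < n] : E n).
have m20 : 0 < m2 by rewrite /m2 /heat_kernel mulr_gt0 ?expR_gt0// powR_gt0// !mulr_gt0 ?pi_gt0.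
(* The Gaussian mass of M h_1 is M m2, which exceeds the sum of the two bounds. *)
pose M := (B1 + B2 + 1) / m2.
have cJ (A : R) : 0 <= A -> 0 <= J + C * A by move=> A0; rewrite addr_ge0// mulr_ge0// ltW.
have B10 : 0 <= B1 by rewrite !mulr_ge0 ?expR_ge0 ?cJ.
have B20 : 0 <= B2 by rewrite !mulr_ge0 ?expR_ge0 ?cJ.
have M0 : 0 <= M by rewrite divr_ge0 ?addr_ge0 ?(ltW m20).
pose g (y : E n) : R[i] := (M * heat_kernel 1 y)%:C.
have mh1 : measurable_fun setT (@heat_kernel R n 1) by exact: measurable_heat_kernel0.
have mg : cmeasurable g by apply: cmeasurable_real; exact: measurable_funM.
have gL : Lrho n rho p%:E g by apply/LE; split => //; exact: heat_kernel_pfinite.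
have [u' [uL [t /= t0 uE] close]] := vdense g gL 1 ltr01.
move: uL close; rewrite -{u'}uE => uL close.
have mu : cmeasurable (heat_semigroup rho c t v) by have [] := (LE _).1 uL.
set u := heat_semigroup rho c t v in mu close uL.
have /psmallE close' := (Nlt _ 1 ltr01).1 close; rewrite powR1 in close'.
have mass_diff : (mass (fun y => u y - g y)%R <= B2%:E)%E.
  have := mass_le 1 (fun y => u y - g y) 1 (lexx 1) (cmeasurableB mu mg) (ltW close').
  by rewrite mul1r.
have mass_g : mass g = (M * m2)%:E.
  have := @heat_kernel_convolution R n 1 1 [tuple 0 | _ < n] ltr01 ltr01.
  have -> : 1 + 1 = 2 :> R by lra.
  have es (y : E n) : esub y [tuple 0 | _ < n] = y.
    by apply: eq_from_tnth => i; rewrite !tnth_mktuple subr0.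
  under eq_integral do rewrite es.
  move=> h; rewrite EFinM -h -ge0_integralZl_EFin//.
  - apply: eq_integral => y _; rewrite -EFinM; congr (_%:E).
    by rewrite /g normc_real ger0_norm ?(mulr_ge0 M0 (heat_kernel_ge0 _ _))// [LHS]mulrCA.
  - by move=> y _; rewrite lee_fin mulr_ge0 ?heat_kernel_ge0.
  - by apply/measurable_EFinP; apply: measurable_funM.
have tri : (mass g <= mass u + mass (fun y => u y - g y)%R)%E.
  have mn (f : E n -> R[i]) : cmeasurable f -> measurable_fun setT (fun y : E n => (heat_kernel 1 y * normc (f y))%:E).
    by move=> mf; apply/measurable_EFinP; apply: measurable_funM => //; exact: measurable_normc.
  have n0 (f : E n -> R[i]) y : (0 <= (heat_kernel 1 y * normc (f y))%:E)%E.
    by rewrite lee_fin mulr_ge0 ?heat_kernel_ge0 ?normc_ge0.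
  have mB := cmeasurableB mu mg.
  have := ge0_integralD (lebn n) measurableT (fun y _ => n0 u y) (mn u mu)
    (fun y _ => n0 (fun y => u y - g y) y) (mn _ mB).
  rewrite /mass => <-.
  apply: ge0_le_integral => //; first exact: mn.
    by apply: emeasurable_funD; exact: mn.
  move=> y _; rewrite -EFinD lee_fin -mulrDr ler_wpM2l ?heat_kernel_ge0//.
  by have := le_normcD (u y) (- (u y - g y)); rewrite normcN opprB addrC subrK.
have := le_trans tri (leeD (orbit_le t t0) mass_diff).
rewrite mass_g -EFinD lee_fin /M divfK ?gt_eqF// -subr_ge0; lra.
Qed.

End Subcritical.

(** * Chaotic and non-chaotic regimes *)

Theorem theorem1p4 (R : realType) (n : nat) (rho : R)
    (n_gt0 : (0 < n)%N) (rho_gt0 : 0 < rho) :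
  [/\ forall (p c : R), 1 <= p -> p != 2 -> critical rho p%:E < c ->
        chaotic (Lrho n rho p%:E) (Lrho_norm rho p%:E) (heat_semigroup rho c),
      forall c : R,
        ~ chaotic (Lrho n rho +oo%E) (Lrho_norm rho +oo%E)
            (heat_semigroup rho c) &
      forall (p c : R), 1 <= p -> c <= critical rho p%:E ->
        ~ chaotic (Lrho n rho p%:E) (Lrho_norm rho p%:E)
            (heat_semigroup rho c) /\
        (c < critical rho p%:E ->
         ~ hypercyclic (Lrho n rho p%:E) (Lrho_norm rho p%:E)
             (heat_semigroup rho c))].
Proof.
split=> [p c p1 p2 hc|c|p c p1 hc].
- exact: chaotic_above_critical.
- by move=> [hyp _]; exact: not_hypercyclic_bounded n_gt0 hyp.
- have h := not_hypercyclic_subcritical n_gt0 rho_gt0 p1 hc.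
  by split=> [[hyp _]|_ hyp]; exact: h hyp.
Qed.
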